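(* Let $\mathcal G$ be a locally finite $\Gamma$-periodic graph with fundamental graph $\mathcal G_*=(\mathcal V_*,\mathcal A_* )$, $\nu=\#\mathcal V_*$, let $V$ be a real $\Gamma$-periodic potential, let $H=A-\varkappa+V$ be the Schrödinger operator on $\ell^2(\mathcal V)$ and let $H(k)=A(k)-\varkappa+V$, $k\in\mathbb T^d$, be the fiber Schrödinger operator on $\ell^2(\mathcal V_* )$. Then: (i) The trace of the resolvent of $H(k)$ satisfies $$(1)\quad \operatorname{Tr}\big(H(k)-\lambda I\big)^{-1}=-\frac\nu\lambda+\frac1\lambda\sum_{\mathbf c_*\in\widetilde{\mathcal P}}|\mathbf c_*|\Big(1-\frac{\lambda^{|\mathbf c_*|}}{\omega(\mathbf c_* )}\,e^{i\langle\tau(\mathbf c_* ),k\rangle}\Big)^{-1},$$ $$(2)\quad \frac1{(2\pi)^d}\int_{\mathbb T^d}\operatorname{Tr}\big(H(k)-\lambda I\big)^{-1}dk=-\frac\nu\lambda+\frac1\lambda\sum_{\mathbf c_*\in\widetilde{\mathcal P}^0}|\mathbf c_*|\Big(1-\frac{\lambda^{|\mathbf c_*|}}{\omega(\mathbf c_* )}\Big)^{-1}.$$ The series in (1) converges absolutely for $|\lambda|>\|H(k)\|$, and the series in (2) converges absolutely for $|\lambda|>\|H\|$. (ii) The determinant of $I-tH(k)$ satisfies $$(3)\quad \det\big(I-tH(k)\big)=\prod_{\mathbf c_*\in\widetilde{\mathcal P}}\big(1-e^{-i\langle\tau(\mathbf c_* ),k\rangle}\omega(\mathbf c_* )t^{|\mathbf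 c_*|}\big),$$ $$(4)\quad \frac1{(2\pi)^d}\int_{\mathbb T^d}\operatorname{Tr}\log\big(I-tH(k)\big)\,dk=\log\prod_{\mathbf c_*\in\widetilde{\mathcal P}^0}\big(1-\omega(\mathbf c_* )t^{|\mathbf c_*|}\big).$$ The product in (3) converges for $|t|<\|H(k)\|^{-1}$, and the product in (4) converges for $|t|<\|H\|^{-1}$.
   Context: Periodic graph. $\mathcal G=(\mathcal V,\mathcal E)$ is a connected infinite graph, possibly having loops and multiple edges, embedded into $\mathbb R^d$; $\mathcal V$ is its vertex set, $\mathcal E$ its set of unoriented edges. Each edge in $\mathcal E$ has two orientations, and $\mathcal A$ is the set of all oriented edges. An oriented edge starting at $x$ and ending at $y$ is denoted $(x,y)$ (several edges may have the same end points). The degree $\varkappa_x$ is the number of edges of $\mathcal A$ starting at $x$. $\Gamma\subset\mathbb R^d$ is a lattice of rank $d$ with basis $a_1,\dots,a_d$. The graph is locally finite and $\Gamma$-periodic: $\mathcal G+a=\mathcal G$ for all $a\in\Gamma$, and the quotient (fundamental) graph $\mathcal G_*=\mathcal G/\Gamma=(\mathcal V_*,\mathcal A_* )$ with $\mathcal V_*=\mathcal V/\Gamma$, $\mathcal A_*=\mathcal A/\Gamma$ is finite. Edge index. Let $\Omega=\{\sum_s t_sa_s:\ t_s\in[0,1)\}$. Each $x\in\mathcal V$ is uniquely $x=x_0+[x]$ with $x_0\in\Omega$, $[x]\in\Gamma$; $[x]_{\mathbb A}\in\mathbb Z^d$ is the coordinate vector of $[x]$ in the basis $a_1,\dots,a_d$.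 For $\mathbf e=(x,y)\in\mathcal A$ put $\tau(\mathbf e)=[y]_{\mathbb A}-[x]_{\mathbb A}\in\mathbb Z^d$. This is $\Gamma$-invariant, so it induces the index $\tau(\mathbf e)$ for $\mathbf e\in\mathcal A_*$. Operators. $V$ is a real function on $\mathcal V$ with $V_{x+a}=V_x$ for $a\in\Gamma$; $V$ and $\varkappa$ are regarded as multiplication operators, also on $\mathcal V_*$. On $\ell^2(\mathcal V)$: $(Af)_x=\sum_{(x,y)\in\mathcal A}f_y$ and $H=A-\varkappa+V$ (bounded self-adjoint). With $\mathbb T^d=\mathbb R^d/(2\pi\mathbb Z)^d$: $(A(k)f)_x=\sum_{\mathbf e=(x,y)\in\mathcal A_*}e^{i\langle\tau(\mathbf e),k\rangle}f_y$ and $H(k)=A(k)-\varkappa+V$ on $\ell^2(\mathcal V_* )=\mathbb C^\nu$. $\|\cdot\|$ of an operator is the operator norm; $I$ is the identity; the logarithm of $I-tH(k)$ is given by the power series $-\sum_{n\ge1}t^nH^n(k)/n$. Modified graph and cycles. $\widetilde{\mathcal G}_*=(\mathcal V_*,\widetilde{\mathcal A}_* )$ is obtained by adding at each $x\in\mathcal V_*$ one loop $\mathbf e_x$ (a single element of $\widetilde{\mathcal A}_*$, its own inverse): $\widetilde{\mathcal A}_*=\mathcal A_*\cup\{\mathbf e_x\}_{x\in\mathcal V_*}$, $\tau(\mathbf e_x)=0$. A cycle of length $|\mathbf c|=n\geq1$ is a sequence $\mathbf c=(\mathbf e_1,\dots,\mathbf e_n)$ of oriented edges $\mathbf e_j=(x_j,x_{j+1})$,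 $x_{n+1}=x_1$ (a closed walk; backtracking is allowed); its index is $\tau(\mathbf c)=\sum_j\tau(\mathbf e_j)$. Edge weights: $\omega(\mathbf e)=1$ for $\mathbf e\in\mathcal A_*$, $\omega(\mathbf e_x)=V_x-\varkappa_x$; $\omega(\mathbf c)=\omega(\mathbf e_1)\cdots\omega(\mathbf e_n)$. Prime cycles. Repeating a cycle $\mathbf c$ $m$ times gives its $m$-multiple. A cycle is prime if it is not an $m$-multiple of a cycle with $m\ge2$. Two cycles are equivalent if one is obtained from the other by a cyclic permutation of edges. $\widetilde{\mathcal P}$ is the set of equivalence classes $\mathbf c_*$ of prime cycles in $\widetilde{\mathcal G}_*$; $|\mathbf c_*|,\tau(\mathbf c_* ),\omega(\mathbf c_* )$ are the length, index and weight of any representative; $\widetilde{\mathcal P}^0=\{\mathbf c_*\in\widetilde{\mathcal P}:\tau(\mathbf c_* )=0\}$. In (1), (2), a term with $\omega(\mathbf c_* )=0$ is understood as $0$.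
   Formalization: As printed the regions fail: on Z with V=ϰ a one-edge prime cycle makes (3) vanish at t=e^{ik}. (1)–(4) are proved on the printed regions as power series in 1/λ or t, and termwise with ‖H(k)‖, ‖H‖ replaced by the norms of A(0)+|V−ϰ|, A+|V−ϰ|. *)

(* Defs.v *)
From HB Require Import structures.
From mathcomp Require Import all_boot all_order all_algebra.
From mathcomp Require Import finmap.
From mathcomp Require Import all_classical all_reals all_analysis.
From mathcomp.real_closed Require Import complex.
Set Implicit Arguments.
Unset Strict Implicit.
Unset Printing Implicit Defensive.
Import Order.TTheory GRing.Theory Num.Theory.
Import numFieldNormedType.Exports.
Import Normc.
Local Open Scope classical_set_scope.
Local Open Scope ring_scope.
Local Open Scope complex_scope.

(** Complex numbers [R[i]]; [normc] is the modulus with values in [R]. *)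

Definition cis (R : realType) (x : R) : R[i] := cos x +i* sin x.

Definition cexp (R : realType) (z : R[i]) : R[i] :=
  (expR (complex.Re z))%:C * cis (complex.Im z).

Definition clim (R : realType) (u : nat -> R[i]) : R[i] :=
  lim (complex.Re (u n) @[n --> \oo]) +i* lim (complex.Im (u n) @[n --> \oo]).

(* [log (1 - z)], principal for |z| < 1 *)
Definition clog1B (R : realType) (z : R[i]) : R[i] :=
  clim (fun N => - \sum_(1 <= n < N) z ^+ n / n%:R).

(* [log (I - M)] *)
Definition mxlog1B (R : realType) (n : nat) (M : 'M[R[i]]_n) : 'M[R[i]]_n :=
  \matrix_(i, j)
    clim (fun N => - \sum_(1 <= m < N) (M ^+ m) i j / m%:R).

Section Families.
Variables (R : realType) (I : choiceType).
Implicit Types (D : set I) (f : I -> R[i]).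

Definition abs_summable D f : Prop :=
  (\esum_(i in D) (normc (f i))%:E < +oo)%E.

(* Sums and products over [D] are limits along the finite subsets of [D]
   directed by inclusion, so no enumeration of [D] is involved. *)
Definition sum_to D f (s : R[i]) : Prop :=
  forall eps : R, 0 < eps ->
    exists2 F0 : {fset I}, [set` F0] `<=` D &
      forall F : {fset I}, [set` F] `<=` D -> (F0 `<=` F)%fset ->
        normc (\sum_(i <- F) f i - s) < eps.

Definition prod_to D f (p : R[i]) : Prop :=
  forall eps : R, 0 < eps ->
    exists2 F0 : {fset I}, [set` F0] `<=` D &
      forall F : {fset I}, [set` F] `<=` D -> (F0 `<=` F)%fset ->
        normc (\prod_(i <- F) f i - p) < eps.

Definition abs_sum_to D f (s : R[i]) : Prop :=
  abs_summable D f /\ sum_to D f s.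

(* the product of the factors [1 - f i] *)
Definition abs_prod1B_to D f (p : R[i]) : Prop :=
  abs_summable D f /\ prod_to D (fun i => 1 - f i) p.

End Families.

Definition power_series_to (R : realType) (a : nat -> R[i]) (z s : R[i]) : Prop :=
  abs_sum_to [set: nat] (fun n => a n * z ^+ n) s.

Definition l2norm (R : realType) (T : choiceType) (f : T -> R[i]) : \bar R :=
  ((\esum_(x in [set: T]) (normc (f x) ^+ 2)%:E) `^ 2^-1)%E.

Definition opnorm (R : realType) (T : choiceType)
    (B : (T -> R[i]) -> (T -> R[i])) : \bar R :=
  ereal_sup [set l2norm (B f) | f in [set f | (l2norm f <= 1)%E]].

(* [(2 pi)^-d] times the integral over the torus, as an iterated integral over
   [0, 2 pi]; the integrands of interest are continuous. *)
Fixpoint torus_mean (R : realType) (d : nat) : ('rV[R]_d -> R) -> R :=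
  if d is d'.+1 then
    fun g => (2 * pi)^-1 *
      \int[@lebesgue_measure R]_(s in `[0, 2 * pi])
        torus_mean (fun k : 'rV[R]_d' => g (row_mx (const_mx s : 'rV[R]_1) k))
  else fun g => g 0.

Definition ctorus_mean (R : realType) (d : nat) (g : 'rV[R]_d -> R[i]) : R[i] :=
  torus_mean (fun k => complex.Re (g k)) +i*
  torus_mean (fun k => complex.Im (g k)).

Fixpoint is_walk (T E : Type) (src tgt : E -> T) (x : T) (s : seq E) (y : T) :
    Prop :=
  if s is e :: s' then src e = x /\ is_walk src tgt (tgt e) s' y else x = y.

(* Only the position of the vertices matters; edges are abstract oriented edges
   with an orientation reversal.  The lattice element [\sum_s a_s * basis_s] is
   given by its coordinates [a].  The finite quotients are presented by
   surjections whose fibres are exactly the orbits of the lattice. *)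
Record periodic_graph (R : realType) (d : nat) := PeriodicGraph {
  lattice_basis : 'M[R]_d;
  lattice_basis_unit : lattice_basis \in unitmx;
  vertex : choiceType;
  position : vertex -> 'rV[R]_d;
  position_inj : injective position;
  edge : choiceType;
  src : edge -> vertex;
  tgt : edge -> vertex;
  reversal : edge -> edge;
  reversalK : involutive reversal;
  reversal_neq : forall e, reversal e <> e;
  src_reversal : forall e, src (reversal e) = tgt e;
  infinite_graph : infinite_set [set: vertex];
  connected_graph : forall x y, exists s, is_walk src tgt x s y;
  locally_finite : forall x, finite_set [set e | src e = x];
  vshift : 'rV[int]_d -> vertex -> vertex;
  position_vshift : forall a x,
    position (vshift a x) = position x + map_mx intr a *m lattice_basis;
  eshift : 'rV[int]_d -> edge -> edge;
  eshift0 : forall e, eshift 0 e = e;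
  eshiftD : forall a b e, eshift (a + b) e = eshift a (eshift b e);
  src_eshift : forall a e, src (eshift a e) = vshift a (src e);
  tgt_eshift : forall a e, tgt (eshift a e) = vshift a (tgt e);
  reversal_eshift : forall a e, reversal (eshift a e) = eshift a (reversal e);
  fvertex : finType;
  vclass : vertex -> fvertex;
  vclass_surj : forall x, exists y, vclass y = x;
  vclassP : forall x y, vclass x = vclass y <-> exists a, y = vshift a x;
  fedge : finType;
  eclass : edge -> fedge;
  eclass_surj : forall e, exists e', eclass e' = e;
  eclassP : forall e e', eclass e = eclass e' <-> exists a, e' = eshift a e
}.

Section PeriodicGraph.
Variables (R : realType) (d : nat) (G : periodic_graph R d).

(* coordinates of [x], where [position x - [x]] lies in the half-open cell *)
Definition cell_index (x : vertex G) : 'rV[int]_d :=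
  map_mx Num.floor (position x *m invmx (lattice_basis G)).

Definition edge_index (e : edge G) : 'rV[int]_d :=
  cell_index (tgt e) - cell_index (src e).

Definition degree (x : vertex G) : nat := #|` fset_set [set e | src e = x] |.

Lemma cell_index_vshift a (x : vertex G) :
  cell_index (vshift a x) = cell_index x + a.
Proof.
rewrite /cell_index position_vshift mulmxDl mulmxK ?lattice_basis_unit //.
by apply/rowP => j; rewrite !mxE floorDrz ?intr_int // intrKfloor.
Qed.

(* so the index of an edge of the quotient may be computed on any lift *)
Lemma edge_index_eshift a (e : edge G) : edge_index (eshift a e) = edge_index e.
Proof.
by rewrite /edge_index src_eshift tgt_eshift !cell_index_vshift opprD addrACA subrr addr0.
Qed.

Definition vlift (x : fvertex G) : vertex G := sval (cid (vclass_surj x)).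
Definition elift (e : fedge G) : edge G := sval (cid (eclass_surj e)).

Definition fsrc (e : fedge G) : fvertex G := vclass (src (elift e)).
Definition ftgt (e : fedge G) : fvertex G := vclass (tgt (elift e)).
Definition fedge_index (e : fedge G) : 'rV[int]_d := edge_index (elift e).

Definition pairing (a : 'rV[int]_d) (k : 'rV[R]_d) : R :=
  \sum_i (a 0 i)%:~R * k 0 i.

Definition periodic_potential (V : vertex G -> R) : Prop :=
  forall a x, V (vshift a x) = V x.

Definition adjacency (f : vertex G -> R[i]) (x : vertex G) : R[i] :=
  \sum_(e \in [set e | src e = x]) f (tgt e).

Definition fadjacency (k : 'rV[R]_d) (f : fvertex G -> R[i]) (x : fvertex G) :
    R[i] :=
  \sum_(e : fedge G | fsrc e == x) cis (pairing (fedge_index e) k) * f (ftgt e).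

Section Potential.
Variable V : vertex G -> R.

Definition loop_weight (x : vertex G) : R := V x - (degree x)%:R.
Definition floop_weight (x : fvertex G) : R := loop_weight (vlift x).

Definition schrodinger (f : vertex G -> R[i]) (x : vertex G) : R[i] :=
  adjacency f x + (loop_weight x)%:C * f x.

Definition fiber (k : 'rV[R]_d) (f : fvertex G -> R[i]) (x : fvertex G) : R[i] :=
  fadjacency k f x + (floop_weight x)%:C * f x.

(* [fiber k] in the standard basis *)
Definition fiber_mx (k : 'rV[R]_d) : 'M[R[i]]_#|fvertex G| :=
  \matrix_(i, j) fiber k (fun y => (y == enum_val j)%:R) (enum_val i).

(* [A + |V - degree|] and its fiber at [k = 0].  A sum over prime cycles of
   moduli of weights grows with these operators and may diverge between
   [opnorm (fiber k)] and [opnorm abs_fiber0], because cancellation can make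
   [fiber k] small: on the line Z with [V = degree], [fiber (pi / 2) = 0], while
   the loop of index 1 has weight 1, so that its factor [1 - e^(-i k) t] vanishes
   at [t = 'i].  Between the two norms only the expansions in powers of [t] or
   [lam^-1] converge.  If [degree <= V] then [abs_schrodinger = schrodinger] and
   [abs_fiber0 = fiber 0]. *)
Definition abs_schrodinger (f : vertex G -> R[i]) (x : vertex G) : R[i] :=
  adjacency f x + `|loop_weight x|%:C * f x.

Definition abs_fiber0 (f : fvertex G -> R[i]) (x : fvertex G) : R[i] :=
  fadjacency 0 f x + `|floop_weight x|%:C * f x.

End Potential.

(* [inr x] is the loop added at [x] *)
Definition medge : finType := (fedge G + fvertex G)%type.

Definition msrc (e : medge) : fvertex G :=
  match e with inl e => fsrc e | inr x => x end.
Definition mtgt (e : medge) : fvertex G :=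
  match e with inl e => ftgt e | inr x => x end.
Definition medge_index (e : medge) : 'rV[int]_d :=
  match e with inl e => fedge_index e | inr _ => 0 end.
Definition medge_weight (V : vertex G -> R) (e : medge) : R :=
  match e with inl _ => 1 | inr x => floop_weight V x end.

Definition is_cycle (c : seq medge) : bool :=
  (c != [::]) && cycle (fun e e' => mtgt e == msrc e') c.

Definition is_prime_cycle (c : seq medge) : Prop :=
  is_cycle c /\
  ~ exists m c', [/\ (2 <= m)%N, is_cycle c' & c = flatten (nseq m c')].

Definition cyclic_class (c : seq medge) : set (seq medge) :=
  [set c' | exists j, c' = rot j c].

Definition prime_classes : set (set (seq medge)) :=
  [set X | exists2 c, is_prime_cycle c & X = cyclic_class c].

Implicit Types X : set (seq medge).

Definition class_repr X : seq medge := xget [::] X.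
Definition class_length X : nat := size (class_repr X).
Definition class_index X : 'rV[int]_d := \sum_(e <- class_repr X) medge_index e.
Definition class_weight (V : vertex G -> R) X : R[i] :=
  (\prod_(e <- class_repr X) medge_weight V e)%:C.

Definition prime_classes0 : set (set (seq medge)) :=
  [set X | prime_classes X /\ class_index X = 0].

Definition twisted_weight (V : vertex G -> R) (k : 'rV[R]_d) X : R[i] :=
  cis (- pairing (class_index X) k) * class_weight V X.

(* summand of the trace formulas; [phase] is [e^(i <index, k>)] or [1] *)
Definition resolvent_term (V : vertex G -> R) (lam : R[i])
    (phase : set (seq medge) -> R[i]) X : R[i] :=
  if class_weight V X == 0 then 0
  else (class_length X)%:R *
       (1 - lam ^+ class_length X / class_weight V X * phase X)^-1.

Section Expansions.
(* Coefficients of the expansions in powers of [z] of the series and products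
   over a set [D] of classes with weights [u]; the [n]-th one involves only the
   finitely many classes of length at most [n]. *)
Variables (D : set (set (seq medge))) (u : set (seq medge) -> R[i]).

(* [\sum_X |X| (1 - (u X z^|X|)^-1)^-1
      = - \sum_X |X| \sum_(m >= 1) (u X)^m z^(m |X|)], where [z = lam^-1] *)
Definition resolvent_coef (n : nat) : R[i] :=
  - \sum_(X \in [set X | [/\ D X, (0 < n)%N & (class_length X %| n)%N]])
      (class_length X)%:R * u X ^+ (n %/ class_length X).

(* [\prod_X (1 - u X z^|X|)]: the factors with [n < |X|] do not contribute *)
Definition product_coef (n : nat) : R[i] :=
  (\big[*%R/1%R]_(X \in [set X | D X /\ (class_length X <= n)%N])
      (1 - (u X)%:P * 'X^(class_length X)))`_n.

(* [\sum_X log (1 - u X z^|X|)] *)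
Definition log_product_coef (n : nat) : R[i] :=
  - \sum_(X \in [set X | [/\ D X, (0 < n)%N & (class_length X %| n)%N]])
      u X ^+ (n %/ class_length X) / (n %/ class_length X)%:R.

End Expansions.

End PeriodicGraph.

(* Main.v *)
Require Import Defs.
From HB Require Import structures.
From mathcomp Require Import all_boot all_order all_algebra.
From mathcomp Require Import finmap.
From mathcomp Require Import all_classical all_reals all_analysis.
From mathcomp.real_closed Require Import complex.
From mathcomp Require Import ring lra.
From mathcomp Require Import zify.

(* The trace of H(k)^n is the sum of the weights of the closed walks of length n on
   the modified graph.  Every closed walk is a power of a unique primitive one, so
   this trace equals the sum of |X| u(X)^(n/|X|) over the prime classes X whose
   length divides n; since H(-k) is the transpose of H(k), the sign of k in the
   phases does not matter.  Averaging over the torus keeps the walks of index 0.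
   The resolvent and the logarithm are power series in these traces, and the
   product over classes and det(1 - t H(k)) satisfy the same Newton recursion,
   which also characterizes the exponential of the logarithmic series.

   Convergence only needs entries of H(k)^n to be O(rho^n) for every rho above the
   operator norm.  For the norm of the infinite graph this follows by letting H^n
   act on a Bloch wave cut off to a cube of side O(n).  For the operator with
   weights in absolute value, the same bound dominates the whole family of classes
   at once, which gives absolute convergence over arbitrary finite subfamilies. *)

Set Implicit Arguments.
Unset Strict Implicit.
Unset Printing Implicit Defensive.
Import Order.TTheory GRing.Theory Num.Theory.
Import numFieldNormedType.Exports.
Import Normc.
Local Open Scope classical_set_scope.
Local Open Scope ring_scope.
Local Open Scope complex_scope.

(** * Primitive words *)

(** Sums and products over classes are limits along finite subsets, while traces organize the same
    data by walk length. The two are reconciled by expanding the contribution of each class in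
    orders [n], where a class of length [l] occupies only multiples of [l]: a finite set of classes
    fixes all orders below [N], and one geometric majorant, valid for every finite subfamily,
    controls the rest.

    The identity exp(log) is obtained on a real segment. Absorbing the complex variable into the
    coefficients leaves power series on the interval from 0 to 1, where Newton's recursion becomes a
    linear differential equation for real and imaginary parts. The determinant is a polynomial in
    [t] whose recursion comes from eigenvalues, so comparing coefficients avoids choosing a
    logarithm of it.

    On the infinite graph a nonzero Bloch wave is not square summable, so the operator norm cannot
    be applied to it directly. The polynomial cost of the cutoff is the reason for working with
    rates strictly above the norm. *)

Section Words.
Variable T : eqType.
Implicit Types (c w v : seq T).

Definition wpow m w := flatten (nseq m w).

(** Phrased by rotations rather than by roots: this form makes the rotations of a word pairwise
    distinct, which yields the factor [|X|] of a class. The bound [size w <= j] is allowed because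
    [rot j w = w] for all such [j]. [is_prime_cycleP] compares it with primality. *)
Definition primitive w := w <> [::] /\
  forall j, rot j w = w -> j = 0%N \/ (size w <= j)%N.

Lemma wpowS m w : wpow m.+1 w = w ++ wpow m w. Proof. by []. Qed.

Lemma size_wpow m w : size (wpow m w) = (m * size w)%N.
Proof. by elim: m => // m IH; rewrite wpowS size_cat IH mulSn. Qed.

Lemma cat_wpow_swap m w v : w ++ wpow m (v ++ w) = wpow m (w ++ v) ++ w.
Proof.
elim: m => [|m IH]; first by rewrite /= cats0.
by rewrite !wpowS -!catA IH.
Qed.

Lemma wpowSr m w : wpow m.+1 w = wpow m w ++ w.
Proof. by have := cat_wpow_swap m w [::]; rewrite /= cats0. Qed.

Lemma rot_wpow m j w : (j <= size w)%N -> rot j (wpow m w) = wpow m (rot j w).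
Proof.
case: m => [|m] jw; first by rewrite /wpow /= /rot.
have sa : size (take j w) = j by rewrite size_take_min; apply/minn_idPl.
move: sa; rewrite [rot j w]/rot -{2}(cat_take_drop j w).
move: (take j w) (drop j w) => a b sa.
rewrite wpowSr catA -cat_wpow_swap -catA -sa rot_size_cat.
by rewrite -catA -wpowSr.
Qed.

Lemma iter_rot1 c j : (j <= size c)%N -> iter j (rot 1) c = rot j c.
Proof.
elim: j => [|j IH] jc; first by rewrite rot0.
by rewrite iterS (IH (ltnW jc)) (rotS jc).
Qed.

(** Since [w] is no longer than a nonempty [v], commutation makes it a prefix of [v], and what
    remains of [v] commutes with [w] again. *)
Lemma commuting_wpow m w v :
  size v = (m * size w)%N -> w ++ v = v ++ w -> v = wpow m w.
Proof.
elim: m v => [|m IH] v; first by move/size0nil ->.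
move=> sv E; have lwv : (size w <= size v)%N by rewrite sv leq_pmull.
have Ev : v = w ++ drop (size w) v.
  rewrite -{1}(cat_take_drop (size w) v); congr (_ ++ _).
  have := congr1 (take (size w)) E.
  rewrite take_size_cat // takel_cat //.
move: (drop _ _) Ev => v' Ev; rewrite {}Ev in E sv lwv *.
move: E; rewrite -catA => /eqP; rewrite eqseq_cat // eqxx /= => /eqP E.
by move: sv; rewrite size_cat mulSn => /addnI sv; rewrite wpowS -(IH _ sv E).
Qed.

(** The shifts fixing [c] are closed under addition, so Euclidean division by the least positive one
    leaves remainder 0. Iterates of [rot 1] replace [rot j], which is trivial beyond [size c] and
    hence not additive in [j]. *)
Lemma minimal_period c : c <> [::] -> exists g,
  [/\ (0 < g)%N, (g %| size c)%N, rot g c = c &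
      forall j, (j <= size c)%N -> rot j c = c -> (g %| j)%N].
Proof.
move=> cn0; have sc : (0 < size c)%N by case: c cn0.
have ex : exists j, (0 < j)%N && (iter j (rot 1) c == c).
  by exists (size c); rewrite sc iter_rot1 // rot_size eqxx.
case: (ex_minnP ex) => g /andP[g0 /eqP cg] gmin.
have itm q : iter (q * g) (rot 1) c = c.
  by elim: q => // q IH; rewrite mulSn iterD IH cg.
have gj j : iter j (rot 1) c = c -> (g %| j)%N.
  rewrite {1}(divn_eq j g) addnC iterD itm => cr.
  rewrite /dvdn -leqn0 leqNgt; apply/negP => r0.
  by have := gmin (j %% g)%N; rewrite r0 cr eqxx leqNgt ltn_mod g0 => /(_ isT).
have gs : (g %| size c)%N by apply: gj; rewrite iter_rot1 // rot_size.
exists g; split => //; last by move=> j jc; rewrite -iter_rot1 //; apply: gj.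
by rewrite -iter_rot1 // dvdn_leq.
Qed.

(** Invariance under [rot g] says that the prefix of length [g] commutes with the rest of the
    word. *)
Lemma periodic_wpow c g : (0 < g)%N -> (g %| size c)%N -> rot g c = c ->
  c = wpow (size c %/ g) (take g c).
Proof.
move=> g0 gc cg; case: (posnP (size c)) => [/size0nil ->|sc].
  by rewrite div0n.
have gle : (g <= size c)%N by rewrite dvdn_leq.
have stg : size (take g c) = g by rewrite size_take_min; apply/minn_idPl.
have : (0 < size c %/ g)%N by rewrite divn_gt0.
case E : (size c %/ g)%N => [//|m] _.
rewrite wpowS -{1}(cat_take_drop g c); congr (_ ++ _).
apply: commuting_wpow; last by rewrite cat_take_drop -/(rot g c) cg.
rewrite size_drop stg -{1}(divnK gc) E mulSn addKn //.
Qed.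

(** The root is the prefix whose length is the minimal period [g]. A nontrivial rotation of this
    prefix by fewer than [g] letters that fixed it would also fix [c], against divisibility by
    [g]. *)
Lemma primitive_root c : c <> [::] ->
  exists w m, [/\ primitive w, (0 < m)%N & c = wpow m w].
Proof.
move=> cn0; have sc : (0 < size c)%N by case: c cn0.
have [g [g0 gc cg gmin]] := minimal_period cn0.
have gle : (g <= size c)%N by rewrite dvdn_leq.
have stg : size (take g c) = g by rewrite size_take_min; apply/minn_idPl.
have E := periodic_wpow g0 gc cg.
exists (take g c), (size c %/ g)%N; split => //; last by rewrite divn_gt0.
split; first by move=> E0; move: stg g0; rewrite E0 /= => <-.
move=> j rj; case: (posnP j) => [|j0]; first by left.
right; rewrite leqNgt; apply/negP => jg; rewrite stg in jg.
have jc : (j <= size c)%N by rewrite ltnW // (leq_trans jg).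
have : (g %| j)%N.
  by apply: gmin => //; rewrite E rot_wpow ?rj // stg ltnW.
by move/(dvdn_leq j0); rewrite leqNgt jg.
Qed.

Lemma take_wpow m w : (0 < m)%N -> take (size w) (wpow m w) = w.
Proof. by case: m => // m _; rewrite wpowS take_size_cat. Qed.

Lemma wpow_inj m w v : (0 < m)%N -> size w = size v ->
  wpow m w = wpow m v -> w = v.
Proof. by move=> m0 s E; rewrite -(take_wpow w m0) E s take_wpow. Qed.

Lemma wpow_neq0 m w : (0 < m)%N -> w <> [::] -> wpow m w <> [::].
Proof. by case: m w => // m [|x w]. Qed.

(** The minimal period of a power of [w] divides [size w], and rotation by it fixes [w], so
    primitivity excludes a smaller value. The length of a primitive root is thus read off from the
    word alone, which gives uniqueness. *)
Lemma size_primitive_root m w g : (0 < m)%N -> primitive w ->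
  (0 < g)%N -> rot g (wpow m w) = wpow m w ->
  (forall j, (j <= size (wpow m w))%N -> rot j (wpow m w) = wpow m w -> (g %| j)%N) ->
  size w = g.
Proof.
move=> m0 [wn0 wp] g0 cg gmin.
have sw : (0 < size w)%N by case: w wn0 {wp cg gmin}.
have gw : (g <= size w)%N.
  rewrite dvdn_leq // gmin ?size_wpow ?leq_pmull //.
  by rewrite rot_wpow // rot_size.
have : rot g w = w.
  by apply: (@wpow_inj m) => //; rewrite ?size_rot // -rot_wpow.
case/wp => [g00|wg]; first by rewrite g00 in g0.
by apply/eqP; rewrite eqn_leq gw wg.
Qed.

Lemma primitive_root_uniq m w m' w' : (0 < m)%N -> (0 < m')%N ->
  primitive w -> primitive w' -> wpow m w = wpow m' w' -> w = w'.
Proof.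
move=> m0 m'0 pw pw' E.
have cn0 : wpow m w <> [::] by apply: wpow_neq0 => //; case: pw.
have [g [g0 gc cg gmin]] := minimal_period cn0.
have sw := size_primitive_root m0 pw g0 cg gmin.
have sw' : size w' = g by apply: (@size_primitive_root m'); rewrite // -E.
by rewrite -(take_wpow w m0) E sw -sw' take_wpow.
Qed.

Lemma rot_uniq_primitive w : primitive w ->
  {in gtn (size w) &, injective (fun j => rot j w)}.
Proof.
move=> [_ wp].
have aux i j : (i <= j < size w)%N -> rot i w = rot j w -> i = j.
  move=> /andP[ij js] E.
  have : rot i (rot (j - i) w) = rot i w.
    by rewrite -rotD ?subnKC // ltnW.
  move/rot_inj/wp => [/eqP|]; first by rewrite subn_eq0 => ji; apply/eqP; rewrite eqn_leq ij.
  by rewrite leqNgt (leq_ltn_trans (leq_subr _ _) js).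
move=> i j; rewrite !inE => si sj E; case: (leqP i j) => ij.
  by apply: aux; rewrite ?ij.
by apply/esym; apply: aux; rewrite ?(ltnW ij).
Qed.

Lemma primitive_rot j w : primitive w -> primitive (rot j w).
Proof.
move=> [wn0 wp]; split.
  by move=> E; apply: wn0; apply: size0nil; rewrite -(size_rot j) E.
move=> i; rewrite size_rot; case: (leqP i (size w)) => [iw|/ltnW]; last by right.
by rewrite rot_rot => /rot_inj/wp.
Qed.

End Words.

Lemma prod_wpow (T : eqType) (K : comPzSemiRingType) (a : T -> K) m w :
  \prod_(e <- wpow m w) a e = (\prod_(e <- w) a e) ^+ m.
Proof.
elim: m => [|m IH]; first by rewrite big_nil.
by rewrite wpowS big_cat /= IH exprS.
Qed.

(** * Sorting closed words by their primitive roots *)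

Section WordSums.
Variables (T : finType).
Implicit Types (c w : seq T).

Fixpoint words n : seq (seq T) :=
  if n is n'.+1 then [seq e :: c | e <- enum T, c <- words n'] else [:: [::]].

Lemma mem_words n c : (c \in words n) = (size c == n).
Proof.
elim: n c => [|n IH] c /=; first by rewrite inE; case: c.
apply/allpairsP/idP => [[[e c'] /= [_ + ->]]|]; first by rewrite IH.
by case: c => // e c /=; rewrite eqSS -IH => ?; exists (e, c); rewrite mem_enum.
Qed.

Lemma words_uniq n : uniq (words n).
Proof.
elim: n => //= n IH; apply: allpairs_uniq; rewrite ?enum_uniq //.
by move=> [e c] [e' c'] _ _ /= [-> ->].
Qed.

Variables (cyc : pred (seq T)).
Hypothesis cyc0 : ~~ cyc [::].
Hypothesis cyc_rot : forall j c, cyc (rot j c) = cyc c.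
Hypothesis cyc_wpow : forall m c, (0 < m)%N -> cyc (wpow m c) = cyc c.

Section Reps.
Variables (n : nat) (S : seq (seq T)).
Hypothesis n0 : (0 < n)%N.
Hypothesis S_uniq : uniq S.
Hypothesis S_prim : forall w, w \in S -> primitive w.
Hypothesis S_cyc : forall w, w \in S -> cyc w.
Hypothesis S_dvd : forall w, w \in S -> (size w %| n)%N.
Hypothesis S_rot : forall w w' j, w \in S -> w' \in S -> w' = rot j w -> w = w'.
Hypothesis S_full : forall w, primitive w -> cyc w -> (size w %| n)%N ->
  exists2 w', w' \in S & exists j, w = rot j w'.

(** [S] holds one representative of each rotation class of primitive closed words of length dividing
    [n]. The primitive root of a closed word is a rotation of exactly one [w] in [S], and the
    rotations by [j < size w] are distinct, so the pairs of [w] and [j] list every closed word of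
    length [n] once. *)
Lemma perm_cycles_roots :
  perm_eq [seq c <- words n | cyc c]
    [seq wpow (n %/ size w) (rot j w) | w <- S, j <- iota 0 (size w)].
Proof.
have ndiv w : w \in S -> (0 < n %/ size w)%N.
  by move=> wS; rewrite divn_gt0 ?(dvdn_gt0 n0 (S_dvd wS)) // (dvdn_leq n0 (S_dvd wS)).
apply: uniq_perm; first by rewrite filter_uniq ?words_uniq.
  apply: allpairs_uniq_dep => //; first by move=> w _; apply: iota_uniq.
  move=> p q /allpairsPdep[w1 [j1 [wS jw ->]]].
  move=> /allpairsPdep[w1' [j1' [wS' jw' ->]]] /= E.
  have pw := S_prim wS; have pw' := S_prim wS'.
  have F := primitive_root_uniq (ndiv _ wS) (ndiv _ wS')
              (primitive_rot j1 pw) (primitive_rot j1' pw') E.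
  have E2 : w1' = rot (size w1' - j1')%N (rot j1 w1).
    by rewrite F -[LHS](rotK j1') /rotr size_rot.
  have [k E3] : exists k, w1' = rot k w1.
    by rewrite E2 rot_rot_add; eexists.
  have Ew := S_rot wS wS' E3.
  move: F jw' {E E2 E3}; rewrite -{}Ew => F jw'.
  suff -> : j1 = j1' by [].
  move: jw jw'; rewrite !mem_iota /= !add0n => jw jw'.
  exact: (rot_uniq_primitive pw).
move=> c; rewrite mem_filter mem_words; apply/idP/allpairsPdep.
  move=> /andP[cc /eqP sc].
  have cn0 : c <> [::] by move=> E; move: cyc0; rewrite -E cc.
  have [w [m [pw m0 E]]] := primitive_root cn0.
  have sE : (n = m * size w)%N by rewrite -sc E size_wpow.
  have cw : cyc w by rewrite -(cyc_wpow w m0) -E.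
  have wn : (size w %| n)%N by rewrite sE dvdn_mull.
  have [w' w'S [j Ej]] := S_full pw cw wn.
  have sw : size w = size w' by rewrite Ej size_rot.
  have w0 : (0 < size w)%N by apply: dvdn_gt0 wn.
  (* A shift at or beyond the size acts trivially, so it is replaced by 0 to stay in the range of
     [iota]. *)
  exists w', (if (j < size w')%N then j else 0%N); split => //.
    by rewrite mem_iota add0n; case: ifP => // _; rewrite -sw.
  rewrite E -sw sE mulnK // Ej; case: ltnP => // h.
  by move: h; rewrite size_rot => h; rewrite rot0 rot_oversize.
move=> [w [j [wS jw ->]]]; rewrite cyc_wpow ?ndiv // cyc_rot S_cyc //=.
by rewrite size_wpow size_rot divnK ?S_dvd.
Qed.

Lemma sum_cycles_roots (K : comPzSemiRingType) (a : T -> K) :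
  \sum_(c <- words n | cyc c) \prod_(e <- c) a e =
  \sum_(w <- S) (size w)%:R * (\prod_(e <- w) a e) ^+ (n %/ size w).
Proof.
rewrite -big_filter (perm_big _ perm_cycles_roots) big_allpairs_dep /=.
apply: eq_bigr => w _.
under eq_bigr => j _ do rewrite prod_wpow (perm_big w) ?perm_rot //.
by rewrite big_const_seq count_predT size_iota iter_addr_0 mulr_natl.
Qed.
End Reps.
End WordSums.

(** * Newton's identities *)

Section Newton.
Variables (F : fieldType) (I : eqType) (l : I -> nat) (u : I -> F).
Implicit Type S : seq I.

Definition euler_prod S : {poly F} := \prod_(i <- S) (1 - (u i)%:P * 'X^(l i)).

Definition power_sum S n : F :=
  \sum_(i <- S | (l i %| n)%N) (l i)%:R * u i ^+ (n %/ l i).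

(** For [Q = euler_prod S], the truncation at order [N] of the logarithmic derivative
    [- X Q' / Q]. *)
Definition power_sum_poly N S : {poly F} :=
  \sum_(1 <= j < N.+1) (power_sum S j)%:P * 'X^j.

Hypothesis l_gt0 : forall i, (0 < l i)%N.

Lemma power_sum_poly_cons N i S :
  power_sum_poly N (i :: S) = power_sum_poly N [:: i] + power_sum_poly N S.
Proof.
rewrite /power_sum_poly -big_split /=; apply: eq_bigr => j _.
rewrite -mulrDl -polyCD; congr (_%:P * _).
by rewrite /power_sum !big_cons big_nil; case: ifP; rewrite ?add0r // addr0.
Qed.

(** With [q = u X^l], the series [- X Q' / Q] of [Q = 1 - q] is [l q / (1 - q)]; its truncation is
    [l] times a geometric sum of [M = N %/ l] terms. Multiplying back by [1 - q] leaves only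
    [- l q^(M+1)], of order above [N]. *)
Lemma newton_one N i : 'X^(N.+1) %|
  'X * (1 - (u i)%:P * 'X^(l i))^`() + power_sum_poly N [:: i] * (1 - (u i)%:P * 'X^(l i)).
Proof.
have l0 := l_gt0 i.
have E M : \sum_(1 <= j < M.+1) (power_sum [:: i] j)%:P * 'X^j =
   \sum_(1 <= m < (M %/ l i).+1) (l i)%:R *: ((u i) ^+ m *: 'X^(m * l i)) :> {poly F}.
  elim: M => [|M IH]; first by rewrite div0n !big_geq.
  rewrite big_nat_recr //= IH /power_sum big_cons big_nil.
  case: ifP => [dM|ndM]; last first.
    rewrite polyC0 mul0r addr0; congr (\sum_(_ <= _ < _.+1) _).
    by rewrite divnS // ndM.
  rewrite [in RHS]divnS // dM add1n [RHS]big_nat_recr //=; congr (_ + _).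
  have -> : (M %/ l i).+1 = (M.+1 %/ l i)%N by rewrite divnS // dM.
  by rewrite divnK // addr0 mul_polyC scalerA.
rewrite /power_sum_poly E.
set q := (u i)%:P * 'X^(l i).
have Es : \sum_(1 <= m < (N %/ l i).+1) (l i)%:R *: ((u i) ^+ m *: 'X^(m * l i)) =
   (l i)%:R *: \sum_(1 <= m < (N %/ l i).+1) q ^+ m.
  rewrite scaler_sumr; apply: eq_bigr => m _.
  by rewrite /q exprMn -rmorphXn /= mul_polyC -exprM mulnC.
rewrite Es.
have G M : (\sum_(1 <= m < M.+1) q ^+ m) * (1 - q) = q - q ^+ M.+1.
  elim: M => [|M IH]; first by rewrite big_geq // mul0r expr1 subrr.
  rewrite big_nat_recr //= mulrDl IH (exprSr q M.+1); ring.
rewrite -scalerAl G derivB derivC sub0r.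
have -> : q^`() = (l i)%:R *: ((u i)%:P * 'X^((l i).-1)).
  by rewrite /q derivM derivC mul0r add0r derivXn mulrnAr scaler_nat.
have -> : 'X * - ((l i)%:R *: ((u i)%:P * 'X^((l i).-1))) = - ((l i)%:R *: q).
  rewrite mulrN -scalerAr; congr (- (_ *: _)); rewrite mulrCA; congr (_ * _).
  by rewrite -exprS prednK.
rewrite scalerBr addKr dvdpNr -mul_polyC dvdp_mull //.
rewrite /q exprMn -exprM dvdp_mull // dvdp_exp2l //.
by rewrite mulnC -ltn_divLR.
Qed.

(** A division-free form of the additivity of the logarithmic derivative: by Leibniz' rule the
    expression for a product is a combination of those for its factors. *)
Lemma newton_dvdp N S :
  'X^(N.+1) %| 'X * (euler_prod S)^`() + power_sum_poly N S * euler_prod S.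
Proof.
elim: S => [|i S IH].
  rewrite /euler_prod big_nil derivC mulr0 add0r mulr1 /power_sum_poly.
  by rewrite big1 ?dvdp0 // => j _; rewrite /power_sum big_nil mul0r.
rewrite power_sum_poly_cons /euler_prod big_cons -/(euler_prod S).
set p := 1 - _; set Q := euler_prod S in IH *.
have -> : 'X * (p * Q)^`() + (power_sum_poly N [:: i] + power_sum_poly N S) * (p * Q)
  = Q * ('X * p^`() + power_sum_poly N [:: i] * p) +
    p * ('X * Q^`() + power_sum_poly N S * Q).
  by rewrite derivM; ring.
by rewrite dvdp_add // dvdp_mull // newton_one.
Qed.

Lemma newton_recursion S n : (euler_prod S)`_n *+ n =
  - \sum_(1 <= j < n.+1) power_sum S j * (euler_prod S)`_(n - j).
Proof.
have /Pdiv.Field.dvdpP[q E] := newton_dvdp n S.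
have := congr1 (fun p : {poly F} => p`_n) E.
rewrite coefMXn ltnSn coefD coefXM => /eqP; rewrite addr_eq0 => /eqP E1.
have -> : (euler_prod S)`_n *+ n = if n == 0%N then 0 else ((euler_prod S)^`())`_n.-1.
  by case: n {E E1 q} => [|n] //=; rewrite coef_deriv.
rewrite E1; congr (- _).
rewrite /power_sum_poly big_distrl /= coef_sum; apply: eq_big_nat => j /andP[_ jn].
by rewrite -mulrA coefCM coefXnM ltnNge -ltnS jn.
Qed.

Lemma euler_prod_coef0 S : (euler_prod S)`_0 = 1.
Proof.
rewrite /euler_prod -horner_coef0; elim: S => [|i S IH].
  by rewrite big_nil hornerC.
rewrite big_cons hornerM IH mulr1 !hornerE; have := l_gt0 i.
by case: (l i) => // k _; rewrite expr0n /= mulr0 subr0.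
Qed.

(** A factor with [l i > n] is 1 modulo [X^(n+1)]. This matters because the coefficients of a
    product over an infinite set are read off from different finite products. *)
Lemma coef_euler_prod_filter S n :
  (euler_prod [seq i <- S | (l i <= n)%N])`_n = (euler_prod S)`_n.
Proof.
have H : 'X^(n.+1) %| euler_prod [seq i <- S | (l i <= n)%N] - euler_prod S.
  elim: S => [|i S IH]; first by rewrite subrr dvdp0.
  rewrite /=; case: leqP => ln; rewrite /euler_prod !big_cons -!/(euler_prod _).
    by rewrite -mulrBr dvdp_mull.
  rewrite mulrBl mul1r opprB addrCA addrC dvdp_add //.
  by rewrite -mulrA mulrCA dvdp_mulr // dvdp_exp2l.
have /Pdiv.Field.dvdpP[q E] := H.
have := congr1 (fun p : {poly F} => p`_n) E.
by rewrite coefMXn ltnSn coefB => /eqP; rewrite subr_eq0 => /eqP.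
Qed.

End Newton.

Lemma recursion_uniq (F : numFieldType) (p c c' : nat -> F) :
  c 0%N = c' 0%N ->
  (forall n, c n *+ n = - \sum_(1 <= j < n.+1) p j * c (n - j)%N) ->
  (forall n, c' n *+ n = - \sum_(1 <= j < n.+1) p j * c' (n - j)%N) ->
  c =1 c'.
Proof.
move=> c0 H H' n; elim/ltn_ind: n => n IH.
case: (posnP n) => [->//|n0].
have : c n *+ n = c' n *+ n.
  rewrite H H'; congr (- _); apply: eq_big_nat => j /andP[j1 _].
  by rewrite IH // ltn_subrL j1.
by rewrite -[c n *+ n]mulr_natr -[c' n *+ n]mulr_natr; apply: mulIf; rewrite pnatr_eq0 -lt0n.
Qed.

Lemma similar_powers (F : fieldType) n (A B P : 'M[F]_n) m :
  P \in unitmx -> A = invmx P *m B *m P -> A ^+ m = invmx P *m (B ^+ m) *m P.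
Proof.
move=> Pu ->; elim: m => [|m IH]; first by rewrite !expr0 mulmx1 mulVmx.
by rewrite exprS IH exprS -!mulmxE !mulmxA mulmxK.
Qed.

Lemma trig_mx_mul (F : pzRingType) n (A B : 'M[F]_n) :
  is_trig_mx A -> is_trig_mx B -> is_trig_mx (A *m B) /\
   forall i, (A *m B) i i = A i i * B i i.
Proof.
move=> /is_trig_mxP tA /is_trig_mxP tB; split.
  apply/is_trig_mxP => i j ij; rewrite mxE big1 // => k _.
  case: (ltnP i k) => ik; first by rewrite tA // mul0r.
  by rewrite tB ?mulr0 // (leq_ltn_trans ik).
move=> i; rewrite mxE (bigD1 i) //= big1 ?addr0 // => k ki.
case: (ltngtP i k) => ik; first by rewrite tA // mul0r.
  by rewrite tB ?mulr0.
by move: ki; rewrite (_ : k = i) ?eqxx //; apply: val_inj.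
Qed.

Lemma trig_mx_exp (F : pzRingType) n (A : 'M[F]_n) m :
  is_trig_mx A -> is_trig_mx (A ^+ m) /\ forall i, (A ^+ m) i i = A i i ^+ m.
Proof.
move=> tA; elim: m => [|m [tm IH]].
  split; first by apply/is_trig_mxP => i j ij; rewrite expr0 mxE; case: eqP ij => // ->; rewrite ltnn.
  by move=> i; rewrite !expr0 mxE eqxx.
rewrite exprS -mulmxE; have [t E] := trig_mx_mul tA tm; split => // i.
by rewrite E IH exprS.
Qed.

(* Triangularizing M reduces Newton's identities for the coefficients of det(1 - tM)
   to those for a product of linear factors. *)
Lemma det1B_newton (F : numClosedFieldType) n (M : 'M[F]_n) :
  exists Q : {poly F}, [/\ forall t, \det (1%:M - t *: M) = Q.[t], Q`_0 = 1 &
    forall m, Q`_m *+ m = - \sum_(1 <= j < m.+1) \tr (M ^+ j) * Q`_(m - j)].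
Proof.
case: n M => [|n] M.
  exists 1; split; first by move=> t; rewrite det_mx00 hornerC.
    by rewrite coef1.
  move=> m; rewrite coef1; rewrite big1 ?oppr0; last first.
    by move=> j _; rewrite /mxtrace big_ord0 mul0r.
  by case: m => //= m; rewrite mul0rn.
have [P Pu tr] := Schur M (ltn0Sn n).
have {}Pu := unitarymx_unit Pu.
set B := conjmx P M in tr.
have E : M = invmx P *m B *m P.
  by rewrite /B conjumx // !mulmxA mulVmx // mul1mx mulmxKV.
have {}tr : is_trig_mx B by exact: tr.
clearbody B.
(* The diagonal of [B] lists the eigenvalues; with all lengths equal to 1, [euler_prod] is the
   reversed characteristic polynomial and [power_sum] the trace of the powers. *)
pose Q := euler_prod (fun=> 1%N) (fun i : 'I_n.+1 => B i i) (index_enum 'I_n.+1).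
have trM j : \tr (M ^+ j) = power_sum (fun=> 1%N) (fun i : 'I_n.+1 => B i i) (index_enum 'I_n.+1) j.
  rewrite (similar_powers j Pu E) mxtrace_mulC mulmxA mulmxV // mul1mx.
  rewrite /mxtrace /power_sum; under [RHS]eq_bigl do rewrite dvd1n.
  by apply: eq_bigr => i _; rewrite mul1r divn1 (trig_mx_exp j tr).2.
exists Q; split; last 2 first.
- exact: euler_prod_coef0.
- by move=> m; rewrite newton_recursion //; under eq_bigr do rewrite -trM.
move=> t.
have -> : 1%:M - t *: M = invmx P *m (1%:M - t *: B) *m P.
  rewrite mulmxBr mulmxBl mulmx1 mulVmx // -scalemxAr -scalemxAl -E //.
rewrite !det_mulmx mulrAC -det_mulmx mulVmx // det1 mul1r.
rewrite det_trig; last first.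
  apply/is_trig_mxP => i j ij; rewrite !mxE (is_trig_mxP tr) //.
  by rewrite mulr0 subr0; case: eqP ij => // ->; rewrite ltnn.
rewrite /Q /euler_prod horner_prod; apply: eq_bigr => i _.
by rewrite !mxE eqxx !hornerE mulrC.
Qed.

(** * Complex series with geometric bounds *)

Section ComplexSequences.
Variable R : realType.
Implicit Types (z s : R[i]) (u v : nat -> R[i]).

Lemma normcE2 z : normc z = Num.sqrt (complex.Re z ^+ 2 + complex.Im z ^+ 2).
Proof. by case: z. Qed.

Lemma normc_ge0 z : 0 <= normc z.
Proof. by rewrite normcE2 sqrtr_ge0. Qed.

Lemma normc_zero : normc (0 : R[i]) = 0. Proof. exact: normc0. Qed.

Lemma normc_sqr z : normc z ^+ 2 = complex.Re z ^+ 2 + complex.Im z ^+ 2.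
Proof. by rewrite normcE2 sqr_sqrtr // addr_ge0 // sqr_ge0. Qed.

Lemma normc_real (x : R) : normc x%:C = `|x|.
Proof. by rewrite normcE2 /= expr0n addr0 sqrtr_sqr. Qed.

Lemma normc_natr n : normc (n%:R : R[i]) = n%:R.
Proof. by rewrite -(rmorph_nat (real_complex R)) normc_real normr_nat. Qed.

Lemma normcX z n : normc (z ^+ n) = normc z ^+ n.
Proof.
by elim: n => [|n IH]; rewrite ?expr0 ?normc1 // !exprS normcM IH.
Qed.

Lemma normc_eq0 z : (normc z == 0) = (z == 0).
Proof.
by apply/eqP/eqP => [/eq0_normc //|->]; rewrite normc_zero.
Qed.

Lemma le_normc_sum (I : Type) (r : seq I) (P : pred I) (F : I -> R[i]) :
  normc (\sum_(i <- r | P i) F i) <= \sum_(i <- r | P i) normc (F i).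
Proof.
elim/big_rec2: _ => [|i y x _ IH]; first by rewrite normc_zero.
by apply: le_trans (le_normcD _ _) _; rewrite lerD2l.
Qed.

Lemma normc_prod (I : Type) (r : seq I) (F : I -> R[i]) :
  normc (\prod_(i <- r) F i) = \prod_(i <- r) normc (F i).
Proof. by elim/big_rec2: _ => [|i y x _ <-]; rewrite ?normc1 ?normcM. Qed.

Lemma le_Re_normc z : `|complex.Re z| <= normc z.
Proof.
by rewrite normcE2 -sqrtr_sqr ler_wsqrtr // lerDl sqr_ge0.
Qed.

Lemma le_Im_normc z : `|complex.Im z| <= normc z.
Proof.
by rewrite normcE2 -sqrtr_sqr ler_wsqrtr // lerDr sqr_ge0.
Qed.

Lemma normc_le_ReIm z : normc z <= `|complex.Re z| + `|complex.Im z|.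
Proof.
rewrite -ler_sqr ?nnegrE ?normc_ge0 ?addr_ge0 // normc_sqr sqrrD !real_normK ?num_real //.
by rewrite -addrA lerD2l lerDr mulrn_wge0 // mulr_ge0.
Qed.

Lemma normc_cis (x : R) : normc (cis x) = 1.
Proof. by rewrite normcE2 /= cos2Dsin2 sqrtr1. Qed.

Lemma ReD z s : complex.Re (z + s) = complex.Re z + complex.Re s.
Proof. by case: z; case: s. Qed.
Lemma ImD z s : complex.Im (z + s) = complex.Im z + complex.Im s.
Proof. by case: z; case: s. Qed.
Lemma ReN z : complex.Re (- z) = - complex.Re z. Proof. by case: z. Qed.
Lemma ImN z : complex.Im (- z) = - complex.Im z. Proof. by case: z. Qed.

Lemma Re_sum (I : Type) (r : seq I) (P : pred I) (F : I -> R[i]) :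
  complex.Re (\sum_(i <- r | P i) F i) = \sum_(i <- r | P i) complex.Re (F i).
Proof. by elim/big_rec2: _ => [|i y x _ <-]; rewrite ?ReD. Qed.

Lemma Im_sum (I : Type) (r : seq I) (P : pred I) (F : I -> R[i]) :
  complex.Im (\sum_(i <- r | P i) F i) = \sum_(i <- r | P i) complex.Im (F i).
Proof. by elim/big_rec2: _ => [|i y x _ <-]; rewrite ?ImD. Qed.

Lemma eqc z s : complex.Re z = complex.Re s -> complex.Im z = complex.Im s -> z = s.
Proof. by case: z; case: s => /= ? ? ? ? -> ->. Qed.

Lemma cvg_dist0 (w : nat -> R) l : w @ \oo --> l ->
  (fun n => `|w n - l|) @ \oo --> (0 : R).
Proof.
move=> wl; rewrite -[X in _ --> X](@normr0 _ R).
by apply: cvg_norm; rewrite -(subrr l); apply: cvgB => //; apply: cvg_cst.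
Qed.

Lemma cvg_le_bound (w : nat -> R) l B : w @ \oo --> l -> (forall n, w n <= B) -> l <= B.
Proof.
move=> wl H; rewrite -(cvg_lim _ wl) //; apply: limr_le.
  by apply/cvg_ex; exists l.
exact: nearW.
Qed.

Lemma normc_distB z s : `|normc z - normc s| <= normc (z - s).
Proof.
have tri a b : normc a - normc b <= normc (a - b).
  by rewrite lerBlDr -{1}[a](subrK b) le_normcD.
by rewrite ler_norml tri andbT lerNl opprB -[z - s]opprB normcN tri.
Qed.

Lemma cvg_sum_in (I : eqType) (r : seq I) (w : I -> nat -> R) (l : I -> R) :
  (forall i, i \in r -> w i @ \oo --> l i) ->
  (fun n => \sum_(i <- r) w i n) @ \oo --> \sum_(i <- r) l i.
Proof.
elim: r => [|i r IH] H.
  rewrite big_nil (_ : (fun _ => _) = fun=> 0); first exact: cvg_cst.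
  by apply/funext => n; rewrite big_nil.
rewrite big_cons.
rewrite (_ : (fun _ => _) = fun n => w i n + \sum_(j <- r) w j n); last first.
  by apply/funext => n; rewrite big_cons.
apply: cvgD; first by apply: H; rewrite mem_head.
by apply: IH => j jr; apply: H; rewrite in_cons jr orbT.
Qed.

(** Convergence in modulus keeps estimates about real sequences; [cto_ReIm] and [cto_clim] return to
    the componentwise limit used by [clim]. *)
Definition cto u s := (fun n => normc (u n - s)) @ \oo --> (0 : R).

Lemma ctoP u s : cto u s <-> forall eps, 0 < eps ->
  exists N, forall n, (N <= n)%N -> normc (u n - s) < eps.
Proof.
split=> [H eps e0|H].
  have /cvgrPdist_lt/(_ _ e0) [N _ HN] := H.
  exists N => n Nn; have := HN n Nn.
  by rewrite /= sub0r normrN ger0_norm ?normc_ge0.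
apply/cvgrPdist_lt => eps e0; have [N HN] := H _ e0.
exists N => // n /= Nn.
by rewrite sub0r normrN ger0_norm ?normc_ge0 // HN.
Qed.

Lemma cto_le u s (w : nat -> R) : w @ \oo --> (0 : R) ->
  (forall n, normc (u n - s) <= w n) -> cto u s.
Proof.
move=> w0 H; apply: (squeeze_cvgr _ (cvg_cst 0) w0).
by apply: nearW => n; rewrite normc_ge0 H.
Qed.

Lemma cto_ReIm u s : cto u s <->
  (fun n => complex.Re (u n)) @ \oo --> complex.Re s /\
  (fun n => complex.Im (u n)) @ \oo --> complex.Im s.
Proof.
split=> [/ctoP H|[HR HI]].
  split; apply/cvgrPdist_lt => eps e0; have [N HN] := H _ e0; exists N => // n /= Nn.
    by rewrite distrC -ReN -ReD (le_lt_trans (le_Re_normc _)) ?HN.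
  by rewrite distrC -ImN -ImD (le_lt_trans (le_Im_normc _)) ?HN.
apply: (@cto_le _ _ (fun n => `|complex.Re (u n) - complex.Re s| +
    `|complex.Im (u n) - complex.Im s|)).
  rewrite -[X in _ --> X]addr0.
  by apply: cvgD; apply: cvg_dist0.
by move=> n; rewrite -!ReN -!ImN -ReD -ImD normc_le_ReIm.
Qed.

Lemma cto_clim u s : cto u s -> clim u = s.
Proof.
move=> /cto_ReIm[HR HI]; rewrite /clim.
by apply: eqc => /=; apply: cvg_lim.
Qed.

Lemma cto_uniq u s s' : cto u s -> cto u s' -> s = s'.
Proof. by move=> /cto_clim <- /cto_clim. Qed.

Lemma cto_cst s : cto (fun=> s) s.
Proof. by apply/ctoP => eps e0; exists 0%N => n _; rewrite subrr normc_zero. Qed.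

Lemma eq_cto u v s : u =1 v -> cto u s -> cto v s.
Proof. by move=> /funext ->. Qed.

Lemma ctoD u v s s' : cto u s -> cto v s' -> cto (fun n => u n + v n) (s + s').
Proof.
move=> H H'; apply: (@cto_le _ _ (fun n => normc (u n - s) + normc (v n - s'))).
  by rewrite -[X in _ --> X]addr0; apply: cvgD.
by move=> n; rewrite opprD addrACA le_normcD.
Qed.

Lemma ctoM u s a : cto u s -> cto (fun n => a * u n) (a * s).
Proof.
move=> H; apply: (@cto_le _ _ (fun n => normc a * normc (u n - s))).
  by rewrite -[X in _ --> X](mulr0 (normc a)); apply: cvgM => //; apply: cvg_cst.
by move=> n; rewrite -mulrBr normcM.
Qed.

Lemma ctoN u s : cto u s -> cto (fun n => - u n) (- s).
Proof.
move=> H; apply: (@cto_le _ _ (fun n => normc (u n - s))) => // n.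
by rewrite -opprD normcN.
Qed.

Lemma ctoB u v s s' : cto u s -> cto v s' -> cto (fun n => u n - v n) (s - s').
Proof. by move=> H /ctoN H'; apply: ctoD. Qed.

Lemma cto_sum (I : Type) (r : seq I) (P : pred I) (u : I -> nat -> R[i]) (s : I -> R[i]) :
  (forall i, cto (u i) (s i)) ->
  cto (fun n => \sum_(i <- r | P i) u i n) (\sum_(i <- r | P i) s i).
Proof.
move=> H; elim: r => [|i r IH].
  by rewrite big_nil; apply: eq_cto (cto_cst 0) => n; rewrite big_nil.
rewrite big_cons; case: ifP => Pi.
  by apply: eq_cto (ctoD (H i) IH) => n; rewrite big_cons Pi.
by apply: eq_cto IH => n; rewrite big_cons Pi.
Qed.

Lemma cto_sum_in (I : eqType) (r : seq I) (u : I -> nat -> R[i]) (s : I -> R[i]) :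
  (forall i, i \in r -> cto (u i) (s i)) ->
  cto (fun n => \sum_(i <- r) u i n) (\sum_(i <- r) s i).
Proof.
elim: r => [|i r IH] H.
  by rewrite big_nil; apply: eq_cto (cto_cst 0) => n; rewrite big_nil.
rewrite big_cons.
have H1 : cto (u i) (s i) by apply: H; rewrite mem_head.
have H2 := IH (fun j jr => H j (mem_behead (s := i :: r) jr)).
by apply: eq_cto (ctoD H1 H2) => n; rewrite big_cons.
Qed.

Lemma cto_normc u s : cto u s -> (fun n => normc (u n)) @ \oo --> normc s.
Proof.
move=> /ctoP h; apply/cvgrPdist_lt => e e0; have [N HN] := h _ e0; exists N => // n /= Nn.
by rewrite (le_lt_trans _ (HN n Nn)) // distrC normc_distB.
Qed.

Lemma cto_normc_le u s N B : cto u s ->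
  (forall n, (N <= n)%N -> normc (u n) <= B) -> normc s <= B.
Proof.
move=> /ctoP H HB; apply/ler_addgt0Pr => e e0; have [M HM] := H _ e0.
have -> : s = u (maxn N M) - (u (maxn N M) - s) by rewrite opprB addrC subrK.
apply: le_trans (le_normcD _ _) _; rewrite normcN lerD ?HB ?leq_maxl //.
by rewrite ltW // HM // leq_maxr.
Qed.

Lemma sum_geometric_le (A r : R) M N : 0 <= A -> 0 <= r -> r < 1 ->
  \sum_(M <= n < N) A * r ^+ n <= A * r ^+ M / (1 - r).
Proof.
move=> A0 r0 r1; have r1' : 0 < 1 - r by rewrite subr_gt0.
have base : 0 <= A * r ^+ M / (1 - r).
  by rewrite divr_ge0 ?mulr_ge0 ?exprn_ge0 // ltW.
case: (leqP N M) => [NM|MN]; first by rewrite big_geq.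
rewrite -(subnKC (ltnW MN)); elim: (N - M)%N => [|k IH]; first by rewrite addn0 big_geq.
suff -> : \sum_(M <= n < M + k.+1) A * r ^+ n =
    A * r ^+ M + r * \sum_(M <= n < M + k) A * r ^+ n.
  apply: le_trans (_ : A * r ^+ M + r * (A * r ^+ M / (1 - r)) <= _).
    by rewrite lerD2l ler_wpM2l.
  rewrite le_eqVlt; apply/orP; left; apply/eqP.
  by field; rewrite gt_eqF.
rewrite addnS big_nat_recl ?leq_addr //; congr (_ + _).
by rewrite mulr_sumr; apply: eq_bigr => i _; rewrite exprS mulrCA.
Qed.

(** The rate is existential, so that polynomial factors can be absorbed by enlarging it. *)
Definition geo v := exists A r, [/\ 0 <= A, 0 <= r, r < 1 &
  forall n, normc (v n) <= A * r ^+ n].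

Definition psum v N := \sum_(0 <= n < N) v n.

Lemma geo_tail v A r N M : 0 <= A -> 0 <= r -> r < 1 ->
  (forall n, normc (v n) <= A * r ^+ n) ->
  normc (\sum_(N <= n < M) v n) <= A * r ^+ N / (1 - r).
Proof.
move=> A0 r0 r1 H; apply: le_trans (le_normc_sum _ _ _) _.
by apply: le_trans (sum_geometric_le N M A0 r0 r1); apply: ler_sum.
Qed.

Lemma cvg_geo_tail A r : 0 <= r -> r < 1 ->
  (fun N => A * r ^+ N / (1 - r)) @ \oo --> (0 : R).
Proof.
move=> r0 r1; rewrite -[X in _ --> X](mul0r (1 - r)^-1).
apply: cvgM; last exact: cvg_cst.
by apply: cvg_geometric; rewrite ger0_norm.
Qed.

Lemma geo_cvg v : geo v -> exists s, cto (psum v) s.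
Proof.
move=> [A [r [A0 r0 r1 H]]].
have gc : cvgn (series (geometric A r)) by apply: is_cvg_geometric_series; rewrite ger0_norm.
have aux (w : nat -> R) : (forall n, `|w n| <= A * r ^+ n) -> cvgn (series w).
  move=> Hw; apply: normed_cvg; apply: (series_le_cvg _ _ _ gc) => n //=.
  by rewrite mulr_ge0 // exprn_ge0.
have cR : cvgn (series (fun n => complex.Re (v n))).
  by apply: aux => n; apply: le_trans (le_Re_normc _) (H n).
have cI : cvgn (series (fun n => complex.Im (v n))).
  by apply: aux => n; apply: le_trans (le_Im_normc _) (H n).
exists (lim (series (fun n => complex.Re (v n)) @ \oo) +i*
        lim (series (fun n => complex.Im (v n)) @ \oo)).
apply/cto_ReIm; split => /=.
  by have -> : (fun n => complex.Re (psum v n)) = series (fun n => complex.Re (v n))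
    by apply/funext => n; rewrite /psum Re_sum.
by have -> : (fun n => complex.Im (psum v n)) = series (fun n => complex.Im (v n))
  by apply/funext => n; rewrite /psum Im_sum.
Qed.

Lemma psum_cat v N M : (N <= M)%N -> psum v M - psum v N = \sum_(N <= n < M) v n.
Proof.
by move=> NM; rewrite /psum (big_cat_nat _ NM) //= addrAC subrr add0r.
Qed.

(** * Unordered sums of terms expanded in orders *)

Section Family.
Variables (I : choiceType) (D : set I) (a : I -> nat -> R[i]) (T : I -> R[i]) (A r : R).
Hypotheses (A0 : 0 <= A) (r0 : 0 <= r) (r1 : r < 1).
Hypothesis a_bound : forall (F : {fset I}) n, [set` F] `<=` D ->
  \sum_(i <- F) normc (a i n) <= A * r ^+ n.
Hypothesis T_sum : forall i, D i -> cto (psum (a i)) (T i).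

(** Exchanging the finite sums over [F] and over orders below [N] gives the bound [A / (1 - r)],
    uniform in both; it survives the limit in [N] and then the supremum over [F]. *)
Lemma family_summable : abs_summable D T.
Proof.
have fin (F : {fset I}) : [set` F] `<=` D -> \sum_(i <- F) normc (T i) <= A / (1 - r).
  move=> FD.
  have H : (fun N => \sum_(i <- F) normc (psum (a i) N)) @ \oo --> \sum_(i <- F) normc (T i).
    apply: cvg_sum_in => i iF.
    exact: cto_normc (T_sum (FD i iF)).
  apply: cvg_le_bound H _ => N.
  apply: le_trans (_ : \sum_(i <- F) \sum_(0 <= n < N) normc (a i n) <= _).
    by apply: ler_sum => i _; apply: le_normc_sum.
  rewrite exchange_big /= (le_trans (ler_sum _ (fun n _ => a_bound n FD))) //.
  by rewrite (le_trans (sum_geometric_le _ _ _ _ _)) // expr0 mulr1.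
rewrite /abs_summable.
apply: (@le_lt_trans _ _ (A / (1 - r))%:E); last exact: ltry.
apply: ge_ereal_sup => _ [X [fX XD] <-].
rewrite fsbig_finite //= sumEFin lee_fin fin //.
by move=> x /=; rewrite in_fset_set // inE => /XD.
Qed.

(* Beyond F0 only the orders n >= N change, so a uniform geometric bound replaces Fubini. *)
Lemma family_sum (v : nat -> R[i]) s :
  (forall N, exists2 F0 : {fset I}, [set` F0] `<=` D &
     forall F : {fset I}, [set` F] `<=` D -> (F0 `<=` F)%fset ->
       forall n, (n < N)%N -> \sum_(i <- F) a i n = v n) ->
  cto (psum v) s -> abs_sum_to D T s.
Proof.
move=> full vs; split; first exact: family_summable.
move=> eps eps0.
have vb n : normc (v n) <= A * r ^+ n.
  have [F0 F0D HF] := full n.+1.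
  rewrite -(HF F0 F0D) ?fsubset_refl //.
  by apply: le_trans (le_normc_sum _ _ _) (a_bound n F0D).
have e0 : 0 < eps / 3 by rewrite divr_gt0.
have [N HN] : exists N, forall n, (N <= n)%N -> `|0 - A * r ^+ n / (1 - r)| < eps / 3.
  have /cvgrPdist_lt/(_ _ e0) [N _ HN] := cvg_geo_tail A r0 r1.
  by exists N => n Nn; apply: HN.
have [F0 F0D HF] := full N; exists F0 => // F FD F0F.
have tl : A * r ^+ N / (1 - r) < eps / 3.
  by apply: le_lt_trans (HN N (leqnn N)); rewrite sub0r normrN ler_norm.
have H : cto (fun M => \sum_(i <- F) psum (a i) M - psum v M) (\sum_(i <- F) T i - s).
  by apply: ctoB => //; apply: cto_sum_in => i iF; apply: T_sum; apply: FD.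
apply: le_lt_trans (_ : eps / 3 + eps / 3 < eps); last by lra.
apply: (cto_normc_le (N := N) H) => M NM.
have -> : \sum_(i <- F) psum (a i) M - psum v M =
   \sum_(N <= n < M) \sum_(i <- F) a i n - \sum_(N <= n < M) v n.
  have cat (G : nat -> R[i]) : \sum_(0 <= n < M) G n =
      \sum_(0 <= n < N) G n + \sum_(N <= n < M) G n by rewrite -big_cat_nat.
  rewrite /psum exchange_big /= !cat.
  have -> : \sum_(0 <= n < N) \sum_(i <- F) a i n = \sum_(0 <= n < N) v n.
    by apply: eq_big_nat => n /andP[_ nN]; apply: (HF F FD F0F).
  by rewrite opprD addrACA subrr add0r.
apply: le_trans (le_normcD _ _) _; rewrite normcN.
apply: lerD; apply: le_trans (ltW tl).
  apply: geo_tail => // n; apply: le_trans (le_normc_sum _ _ _) (a_bound n FD).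
exact: geo_tail.
Qed.

End Family.

(** The case of [family_sum] where term [i] lives in the single order [i]. *)
Lemma geo_abs_sum_to v s : geo v -> cto (psum v) s -> abs_sum_to [set: nat] v s.
Proof.
move=> [A [r [A0 r0 r1 H]]] vs.
pose a (i n : nat) := if n == i then v n else 0.
have sumE (F : {fset nat}) n (G : nat -> R[i] -> R) : (forall n, G n 0 = 0) ->
    \sum_(i <- F) G n (a i n) = if n \in F then G n (v n) else 0.
  move=> G0; case: ifPn => nF.
    rewrite (big_fsetD1 n) //= {1}/a eqxx big_seq big1 ?addr0 // => i.
    by rewrite !inE eq_sym => /andP[/negPf ni _]; rewrite /a ni.
  rewrite big_seq big1 // => i iF; rewrite /a; case: eqP => // ni.
  by move: nF; rewrite ni iF.
apply: (@family_sum _ _ a v A r A0 r0 r1 _ _ v) => //.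
- move=> F n _; rewrite (sumE F n (fun _ => @normc R) (fun _ => normc_zero)).
  case: ifP => // _; by rewrite mulr_ge0 ?exprn_ge0.
- move=> i _; apply/ctoP => e e0; exists i.+1 => n ni.
  rewrite /psum (big_cat_nat (n := i.+1)) //= big_nat_recr //= big_nat big1; last first.
    by move=> j /andP[_ ji]; rewrite /a ltn_eqF.
  rewrite big_nat big1; last by move=> j /andP[ij _]; rewrite /a gtn_eqF.
  by rewrite add0r addr0 /a eqxx subrr normc_zero.
- move=> N; exists [fset i | i in iota 0 N]%fset => // F _ /fsubsetP NF n nN.
  have nF : n \in F by apply: NF; rewrite !inE mem_iota.
  rewrite (big_fsetD1 n) //= {1}/a eqxx big_seq big1 ?addr0 // => i.
  by rewrite !inE eq_sym => /andP[/negPf ni _]; rewrite /a ni.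
Qed.

End ComplexSequences.

(** * Exponentials of power series *)

Section RealPowerSeries.
Variable R : realType.
Implicit Types (w : nat -> R) (q x : R).

(** Each of the [n + 1] terms [q^i] with [i <= n] is at least [q^n]. *)
Lemma natr_geometric_le q n : 0 <= q -> q < 1 -> n.+1%:R * q ^+ n <= (1 - q)^-1.
Proof.
move=> q0 q1; have := sum_geometric_le 0 n.+1 ler01 q0 q1.
rewrite expr0 mulr1 mul1r; apply: le_trans.
rewrite -[n.+1]subn0 mulr_natl -sumr_const_nat; apply: ler_sum_nat => i /andP[_ i_n].
by rewrite mul1r; apply: ler_wiXn2l => //; exact: ltW.
Qed.

Definition rgeo q w := exists C, forall n, `|w n| <= C * q ^+ n.

Lemma rgeo_cvg q w x : 0 <= q -> q * `|x| < 1 -> rgeo q w -> cvgn (pseries w x).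
Proof.
move=> q0 qx [C H]; apply: normed_cvg.
apply: (series_le_cvg _ _ _ (_ : cvgn (series (geometric C (q * `|x|))))) => [n|n|n|] /=.
- by [].
- rewrite mulr_ge0 ?exprn_ge0 ?mulr_ge0 //.
  by have := H 0%N; rewrite expr0 mulr1; apply: le_trans.
- by rewrite normrM normrX exprMn mulrA ler_wpM2r ?exprn_ge0.
- by apply: is_cvg_geometric_series; rewrite ger0_norm ?mulr_ge0.
Qed.

Lemma rgeo_diffs q q' w : 0 <= q -> q < q' -> rgeo q w -> rgeo q' (pseries_diffs w).
Proof.
move=> q0 qq' [C H]; have q'0 : 0 < q' by apply: le_lt_trans qq'.
have C0 : 0 <= C by have := H 0%N; rewrite expr0 mulr1; apply: le_trans.
exists (C * q * (1 - q / q')^-1) => n.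
have b := natr_geometric_le n (divr_ge0 q0 (ltW q'0)) (_ : q / q' < 1).
rewrite /pseries_diffs normrM normr_nat.
apply: le_trans (_ : n.+1%:R * (C * q ^+ n.+1) <= _); first by rewrite ler_wpM2l.
have -> : n.+1%:R * (C * q ^+ n.+1) = C * q * (n.+1%:R * (q / q') ^+ n) * q' ^+ n.
  rewrite exprS expr_div_n; field; by rewrite expf_neq0 // gt_eqF.
rewrite ler_wpM2r ?exprn_ge0 //; first exact: ltW.
rewrite ler_wpM2l ?mulr_ge0 //.
by apply: b; rewrite ltr_pdivrMr // mul1r.
Qed.

Lemma rgeo_derive q w x : 0 <= q -> q < 1 -> `|x| <= 1 -> rgeo q w ->
  is_derive x 1 (fun x => limn (pseries w x)) (limn (pseries (pseries_diffs w) x)).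
Proof.
move=> q0 q1 x1 H.
(* Termwise differentiation asks the series and its first two derived series to converge at some [K]
   beyond [|x|]. The rates [q], [q'] and [q''] serve these three series, and [K = 2 / (q'' + 1)]
   exceeds 1 while [q'' K < 1]. *)
pose q' := (q + 1) / 2; pose q'' := (q' + 1) / 2; pose K := 2 / (q'' + 1).
have [e1 e2 e3] : [/\ q < q', q' < q'' & q'' < 1].
  by rewrite /q'' /q'; split; lra.
have K1 : 1 < K by rewrite /K ltr_pdivlMr ?mul1r; lra.
have K0 : 0 < K by lra.
have qK : q'' * `|K| < 1.
  rewrite gtr0_norm // /K mulrA ltr_pdivrMr; lra.
have lt_qK r : 0 <= r -> r <= q'' -> r * `|K| < 1.
  by move=> r0 rq; apply: le_lt_trans qK; rewrite ler_wpM2r.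
apply: (@pseries_snd_diffs _ w K).
- by apply: rgeo_cvg H => //; apply: lt_qK => //; lra.
- apply: (@rgeo_cvg q'); [lra|by apply: lt_qK; lra|exact: rgeo_diffs H].
- apply: (@rgeo_cvg q''); [lra|by apply: lt_qK; lra|].
  by apply: (@rgeo_diffs q') => //; [lra|exact: rgeo_diffs H].
- by apply: le_lt_trans x1 _; rewrite gtr0_norm.
Qed.

Lemma derive0_eq01 (f : R -> R) :
  (forall x, `|x| <= 1 -> is_derive x 1 f 0) -> f 1 = f 0.
Proof.
move=> H.
have in01 x : x \in `[0, 1]%R -> `|x| <= 1.
  by rewrite in_itv /= => /andP[x0 x1]; rewrite ger0_norm.
have [x|//|c _] := @MVT_segment R f (fun=> 0) 0 1 ler01.
  by move=> /subset_itv_oo_cc x01; apply: H; apply: in01.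
- by apply: derivable_within_continuous => x /in01/H[].
by rewrite mul0r => /eqP; rewrite subr_eq0 => /eqP.
Qed.

(* exp(-(u + iv)) (a + ib) is constant *)
Lemma complex_linear_ode (a b u v da db du dv : R -> R) :
  (forall x, `|x| <= 1 -> is_derive x 1 a (da x)) ->
  (forall x, `|x| <= 1 -> is_derive x 1 b (db x)) ->
  (forall x, `|x| <= 1 -> is_derive x 1 u (du x)) ->
  (forall x, `|x| <= 1 -> is_derive x 1 v (dv x)) ->
  (forall x, `|x| <= 1 -> da x = du x * a x - dv x * b x) ->
  (forall x, `|x| <= 1 -> db x = dv x * a x + du x * b x) ->
  a 0 = 1 -> b 0 = 0 -> u 0 = 0 -> v 0 = 0 ->
  a 1 +i* b 1 = cexp (u 1 +i* v 1).
Proof.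
move=> Da Db Du Dv Ea Eb a0 b0 u0 v0.
pose E := expR \o (- u); pose cv := cos \o v; pose sv := sin \o v.
have DE x : `|x| <= 1 -> is_derive x 1 E (- du x * E x).
  move=> /Du h; apply: is_derive_eq; rewrite /E /=; ring.
have Dc x : `|x| <= 1 -> is_derive x 1 cv (- sv x * dv x).
  by move=> /Dv h; apply: is_derive_eq.
have Ds x : `|x| <= 1 -> is_derive x 1 sv (cv x * dv x).
  by move=> /Dv h; apply: is_derive_eq.
(* The real part of [exp(-(u + iv)) (a + ib)]; [H2] treats the imaginary part. *)
have H1 : (E * (a * cv + b * sv)) 1 = (E * (a * cv + b * sv)) 0.
  apply: derive0_eq01 => x x1.
  have h1 := Da x x1; have h2 := Db x x1; have h3 := DE x x1.
  have h4 := Dc x x1; have h5 := Ds x x1.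
  apply: is_derive_eq; rewrite /GRing.scale /= !fctE Ea // Eb //.
  move: (E x) (a x) (b x) (cv x) (sv x) (du x) (dv x) => *.
  ring.
have H2 : (E * (b * cv - a * sv)) 1 = (E * (b * cv - a * sv)) 0.
  apply: derive0_eq01 => x x1.
  have h1 := Da x x1; have h2 := Db x x1; have h3 := DE x x1.
  have h4 := Dc x x1; have h5 := Ds x x1.
  apply: is_derive_eq; rewrite /GRing.scale /= !fctE Ea // Eb //.
  move: (E x) (a x) (b x) (cv x) (sv x) (du x) (dv x) => *.
  ring.
move: H1 H2; rewrite /E /cv /sv !fctE /= a0 b0 u0 v0 oppr0 expR0 cos0 sin0.
rewrite !(mul1r, mul0r, mulr0, mulr1, subr0, addr0) expRN => H1 H2.
have Eu := lt0r_neq0 (expR_gt0 (u 1)).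
set e := expR (u 1) in Eu H1 H2.
set c := cos (v 1) in H1 H2; set s := sin (v 1) in H1 H2.
have cs : c ^+ 2 + s ^+ 2 = 1 by rewrite cos2Dsin2.
have K1 : a 1 * c + b 1 * s = e.
  by rewrite -[LHS](mulVKf Eu) H1 mulr1.
have K2 : b 1 * c - a 1 * s = 0.
  by rewrite -[LHS](mulVKf Eu) H2 mulr0.
rewrite /cexp /cis; apply: eqc => /=; rewrite -/e -/c -/s;
  move: (a 1) (b 1) K1 K2 => x y K1 K2 {H1 H2}.
  (* From [c^2 + s^2 = 1] one has [a = c (a c + b s) - s (b c - a s)], and the last bracket vanishes
     by [K2]. The imaginary part is recovered in the same way. *)
  rewrite mul0r subr0 -K1 -[LHS]mulr1 -cs.
  by rewrite -[LHS]addr0 -[X in _ + X](mulr0 s) -K2; ring.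
rewrite mul0r addr0 -K1 -[LHS]mulr1 -cs.
by rewrite -[LHS]addr0 -[X in _ + X](mulr0 (- c)) -K2; ring.
Qed.

End RealPowerSeries.

(** * Complex power series on a real segment *)

Section ComplexPowerSeries.
Variable R : realType.
Implicit Types (c l f g v : nat -> R[i]).

(** Only real arguments occur: the complex variable of the original series is absorbed in the
    coefficients [v]. *)
Definition evalR v (x : R) : R[i] :=
  limn (pseries (fun n => complex.Re (v n)) x) +i*
  limn (pseries (fun n => complex.Im (v n)) x).

Definition cdiffs v n : R[i] := n.+1%:R * v n.+1.

Lemma Re_mulR (x : R) (z : R[i]) : complex.Re (z * x%:C) = complex.Re z * x.
Proof. by case: z => a b /=; rewrite mulr0 subr0. Qed.
Lemma Im_mulR (x : R) (z : R[i]) : complex.Im (z * x%:C) = complex.Im z * x.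
Proof. by case: z => a b /=; rewrite mulr0 add0r. Qed.

Lemma Re_cdiffs v : (fun n => complex.Re (cdiffs v n)) =
  pseries_diffs (fun n => complex.Re (v n)).
Proof.
apply/funext => n; rewrite /cdiffs /pseries_diffs mulrC -(rmorph_nat (real_complex R)).
by rewrite Re_mulR mulrC.
Qed.

Lemma Im_cdiffs v : (fun n => complex.Im (cdiffs v n)) =
  pseries_diffs (fun n => complex.Im (v n)).
Proof.
apply/funext => n; rewrite /cdiffs /pseries_diffs mulrC -(rmorph_nat (real_complex R)).
by rewrite Im_mulR mulrC.
Qed.

Lemma geo_cdiffs v : geo v -> geo (cdiffs v).
Proof.
move=> [A [r [A0 r0 r1 H]]].
have rr : r < (r + 1) / 2 by lra.
have [|C HC] := rgeo_diffs (w := fun n => normc (v n)) r0 rr.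
  by exists A => n; rewrite ger0_norm ?normc_ge0.
have C0 : 0 <= C by have := HC 0%N; rewrite expr0 mulr1; apply: le_trans.
exists C, ((r + 1) / 2); split => //; try lra.
move=> n; apply: le_trans (HC n); rewrite /pseries_diffs normcM normc_natr.
exact: ler_norm.
Qed.

Lemma geo_evalR v x : `|x| <= 1 -> geo v ->
  cto (psum (fun n => v n * (x%:C) ^+ n)) (evalR v x).
Proof.
move=> x1 [A [r [A0 r0 r1 H]]].
have rx : r * `|x| < 1 by apply: le_lt_trans r1; rewrite ler_piMr.
apply/cto_ReIm; split => /=.
  have -> : (fun n => complex.Re (psum (fun n => v n * x%:C ^+ n) n)) =
     pseries (fun n => complex.Re (v n)) x.
    apply/funext => N; rewrite /psum Re_sum; apply: eq_bigr => i _.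
    by rewrite -rmorphXn Re_mulR.
  by apply: (rgeo_cvg r0 rx); exists A => n; apply: le_trans (le_Re_normc _) (H n).
have -> : (fun n => complex.Im (psum (fun n => v n * x%:C ^+ n) n)) =
   pseries (fun n => complex.Im (v n)) x.
  apply/funext => N; rewrite /psum Im_sum; apply: eq_bigr => i _.
  by rewrite -rmorphXn Im_mulR.
by apply: (rgeo_cvg r0 rx); exists A => n; apply: le_trans (le_Im_normc _) (H n).
Qed.

Lemma geo_evalR1 v s : geo v -> cto (psum v) s -> evalR v 1 = s.
Proof.
move=> gv vs; have h1 : `|1 : R| <= 1 by rewrite normr1.
apply: (cto_uniq (geo_evalR h1 gv)).
by apply: eq_cto vs => N; apply: eq_bigr => n _; rewrite expr1n mulr1.
Qed.

Lemma evalR0 v : geo v -> evalR v 0 = v 0%N.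
Proof.
move=> gv; have h0 : `|0 : R| <= 1 by rewrite normr0 ler01.
apply: (cto_uniq (geo_evalR h0 gv)); apply/ctoP => e e0; exists 1%N => n n0.
rewrite /psum (big_cat_nat (n := 1)) //= big_nat1 expr0 mulr1 big_nat big1.
  by rewrite addr0 subrr normc_zero.
by move=> i /andP[i0 _]; rewrite expr0n gtn_eqF // mulr0.
Qed.

Lemma geo_derive v (x : R) : `|x| <= 1 -> geo v ->
  is_derive x 1 (fun x : R => complex.Re (evalR v x)) (complex.Re (evalR (cdiffs v) x)) /\
  is_derive x 1 (fun x : R => complex.Im (evalR v x)) (complex.Im (evalR (cdiffs v) x)).
Proof.
move=> x1 [A [r [A0 r0 r1 H]]]; rewrite /evalR Re_cdiffs Im_cdiffs /=; split.
  by apply: (rgeo_derive r0) => //; exists A => n; apply: le_trans (le_Re_normc _) (H n).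
by apply: (rgeo_derive r0) => //; exists A => n; apply: le_trans (le_Im_normc _) (H n).
Qed.

Lemma psum_convolution f g N :
  psum (fun n => \sum_(0 <= i < n.+1) f i * g (n - i)%N) N =
  \sum_(0 <= i < N) f i * psum g (N - i).
Proof.
elim: N => [|N IH]; first by rewrite /psum !big_geq.
rewrite /psum big_nat_recr //= -/(psum _ N) IH.
rewrite [X in _ + X]big_nat_recr //= [RHS]big_nat_recr //= subnn subSnn.
rewrite addrA -big_split /=; congr (_ + _).
  apply: eq_big_nat => i /andP[_ iN].
  by rewrite subSn ?(ltnW iN) // [in RHS]big_nat_recr //= mulrDr.
by rewrite big_nat1.
Qed.

(** Mertens' argument with explicit rates: by [psum_convolution] the truncated Cauchy product
    differs from the product of partial sums by tails of [g] weighted by [f], at most a constant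
    times [N m^N]. *)
Lemma geo_convolution f g F G : geo f -> geo g -> cto (psum f) F -> cto (psum g) G ->
  cto (psum (fun n => \sum_(0 <= i < n.+1) f i * g (n - i)%N)) (F * G).
Proof.
move=> [A [r [A0 r0 r1 Hf]]] [B [q [B0 q0 q1 Hg]]] fF gG.
pose m := Num.max r q; have m0 : 0 <= m by rewrite le_max r0.
have m1 : m < 1 by rewrite gt_max r1.
(* Since [s^2 >= m], one factor [s^N] absorbs [N] through [natr_geometric_le] and the other still
   tends to 0. *)
pose s := (1 + m) / 2; have s0 : 0 <= s by rewrite /s; lra.
have s1 : s < 1 by rewrite /s; lra.
have ms : m <= s ^+ 2.
  by rewrite -subr_ge0 (_ : _ - _ = ((1 - m) / 2) ^+ 2) ?sqr_ge0 // /s; field.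
pose W N := A * B / (1 - m) / (1 - s) * s ^+ N.
have W0 : W @ \oo --> (0 : R).
  by apply: cvg_geometric; rewrite ger0_norm.
have H1 N : normc (psum f N * psum g N -
    psum (fun n => \sum_(0 <= i < n.+1) f i * g (n - i)%N) N) <= W N.
  rewrite psum_convolution {1}/psum mulr_suml -sumrB.
  apply: le_trans (le_normc_sum _ _ _) _.
  apply: le_trans (_ : \sum_(0 <= i < N) A * B / (1 - m) * m ^+ N <= _).
    apply: ler_sum_nat => i /andP[_ iN].
    rewrite -mulrBr normcM psum_cat ?leq_subr //.
    have h1 : normc (f i) <= A * m ^+ i.
      by apply: le_trans (Hf i) _; rewrite ler_wpM2l // lerXn2r ?nnegrE // le_max lexx.
    have h2 : normc (\sum_(N - i <= j < N) g j) <= B * m ^+ (N - i) / (1 - m).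
      apply: geo_tail => // j.
      by apply: le_trans (Hg j) _; rewrite ler_wpM2l // lerXn2r ?nnegrE // le_max lexx orbT.
    apply: le_trans (ler_pM (normc_ge0 _) (normc_ge0 _) h1 h2) _.
    rewrite -{2}(subnKC (ltnW iN)) exprD le_eqVlt; apply/orP; left; apply/eqP.
    by move: (m ^+ i) (m ^+ (N - i)) ((1 - m)^-1) => *; ring.
  rewrite sumr_const_nat subn0 /W -mulr_natl.
  have K0 : 0 <= A * B / (1 - m) by rewrite divr_ge0 ?mulr_ge0 // subr_ge0 ltW.
  rewrite mulrCA -[X in _ <= X]mulrA ler_wpM2l //.
  apply: le_trans (_ : N.+1%:R * s ^+ N * s ^+ N <= _); last first.
    by rewrite ler_wpM2r ?exprn_ge0 // natr_geometric_le.
  rewrite -mulrA; apply: ler_pM => //; first by rewrite exprn_ge0.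
    by rewrite ler_nat.
  by rewrite -exprD addnn -mul2n exprM lerXn2r ?nnegrE ?exprn_ge0.
have H2 : cto (fun N => psum f N * psum g N) (F * G).
  have [K HK] : exists K, forall N, normc (psum f N) <= K.
    exists (A / (1 - r)) => N; apply: le_trans (le_normc_sum _ _ _) _.
    apply: le_trans (ler_sum _ (fun n _ => Hf n)) _.
    by apply: le_trans (sum_geometric_le _ _ A0 r0 r1) _; rewrite expr0 mulr1.
  apply: (@cto_le _ _ _ (fun N => K * normc (psum g N - G) + normc G * normc (psum f N - F))).
    rewrite -[X in _ --> X](_ : K * 0 + normc G * 0 = 0); last by rewrite !mulr0 addr0.
    by apply: cvgD; apply: cvgM => //; apply: cvg_cst.
  move=> N; have -> : psum f N * psum g N - F * G =
    psum f N * (psum g N - G) + G * (psum f N - F) by ring.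
  apply: le_trans (le_normcD _ _) _; rewrite !normcM lerD2r ler_wpM2r //.
  exact: normc_ge0.
have H3 : cto (fun N => psum f N * psum g N -
    psum (fun n => \sum_(0 <= i < n.+1) f i * g (n - i)%N) N) 0.
  by apply: (cto_le W0) => N; rewrite subr0.
rewrite -[F * G]subr0; apply: eq_cto (ctoB H2 H3) => N.
by rewrite opprB addrC subrK.
Qed.

(** Strong induction on [|c n| <= C q^n] with [r < q < 1]: the recursion gives
    [n |c n| <= A D C q^n], where [D = (1 - r / q)^-1] sums the ratios, and this closes as soon as
    [n >= A D]. The finitely many earlier coefficients are built into [C]. *)
Lemma newton_geo (p c : nat -> R[i]) :
  (forall n, c n *+ n = - \sum_(1 <= j < n.+1) p j * c (n - j)%N) ->
  geo p -> geo c.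
Proof.
move=> rec [A [r [A0 r0 r1 H]]].
pose q := (1 + r) / 2; have q0 : 0 < q by rewrite /q; lra.
have q1 : q < 1 by rewrite /q; lra.
have rq : r < q by rewrite /q; lra.
clearbody q.
pose D := (1 - r / q)^-1.
have D0 : 0 < D by rewrite invr_gt0 subr_gt0 ltr_pdivrMr // mul1r.
pose N0 := (Num.truncn (A * D)).+1.
pose C := \sum_(0 <= m < N0) normc (c m) / q ^+ m.
have C0 : 0 <= C by rewrite sumr_ge0 // => i _; rewrite divr_ge0 ?normc_ge0 ?exprn_ge0 // ltW.
exists C, q; split => //; first exact: ltW.
elim/ltn_ind => n IH.
case: (ltnP n N0) => nN.
  rewrite -ler_pdivrMr ?exprn_gt0 // /C (bigD1_seq n) ?iota_uniq ?mem_index_iota //=.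
  by rewrite lerDl sumr_ge0 // => i _; rewrite divr_ge0 ?normc_ge0 ?exprn_ge0 // ltW.
have n0 : (0 < n)%N by apply: leq_trans nN.
have bn : A * D <= n%:R.
  by apply: le_trans (ltW (truncnS_gt _)) _; rewrite ler_nat.
have n0' : 0 < n%:R :> R by rewrite ltr0n.
rewrite -(ler_pM2l n0') -{1}normc_natr -normcM mulr_natl rec normcN.
apply: le_trans (le_normc_sum _ _ _) _.
apply: le_trans (_ : \sum_(1 <= j < n.+1) A * C * q ^+ n * (r / q) ^+ j <= _).
  apply: ler_sum_nat => j /andP[j1 jn]; rewrite normcM.
  have h2 := IH (n - j)%N; rewrite ltn_subrL n0 j1 in h2.
  apply: le_trans (ler_pM (normc_ge0 _) (normc_ge0 _) (H j) (h2 isT)) _.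
  rewrite -{2}(subnK (_ : j <= n)%N) // exprD expr_div_n le_eqVlt; apply/orP; left; apply/eqP.
  by field; rewrite expf_neq0 // gt_eqF.
have K0 : 0 <= A * C * q ^+ n by rewrite !mulr_ge0 ?exprn_ge0 // ltW.
apply: le_trans (sum_geometric_le 1 n.+1 K0 (divr_ge0 r0 (ltW q0)) _) _.
  by rewrite ltr_pdivrMr // mul1r.
rewrite -/D expr1 -mulrA.
apply: le_trans (_ : A * C * q ^+ n * D <= _).
  by rewrite ler_wpM2l // ler_piMl ?(ltW D0) // ler_pdivrMr // mul1r ltW.
have -> : A * C * q ^+ n * D = (A * D) * (C * q ^+ n) by ring.
by rewrite ler_wpM2r // mulr_ge0 ?exprn_ge0 // ltW.
Qed.

(* Newton's recursion says that C' = L' C for C = \sum c_n x^n and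
   L = - \sum p_n x^n / n. *)
Lemma newton_exp (p c : nat -> R[i]) s : c 0%N = 1 ->
  (forall n, c n *+ n = - \sum_(1 <= j < n.+1) p j * c (n - j)%N) ->
  geo p -> cto (psum (fun n => - (p n / n%:R))) s -> cto (psum c) (cexp s).
Proof.
move=> c0 rec gp ls.
have gc := newton_geo rec gp.
pose l n := - (p n / n%:R) : R[i].
have gl : geo l.
  case: gp => A [r [A0 r0 r1 H]]; exists A, r; split => // n.
  apply: le_trans (H n); rewrite normcN normcM normcV normc_natr.
  case: n => [|n]; first by rewrite invr0 mulr0 normc_ge0.
  by rewrite ler_piMr ?normc_ge0 // invf_le1 ?ltr0n // ler1n.
have [C cC] := geo_cvg gc.
suff -> : cexp s = C by [].
rewrite -(geo_evalR1 gc cC) -(geo_evalR1 gl ls).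
have ode x : `|x| <= 1 -> evalR (cdiffs c) x = evalR (cdiffs l) x * evalR c x.
  move=> x1.
  have H1 := geo_evalR x1 (geo_cdiffs gc).
  apply: (cto_uniq H1).
  have gx v : geo v -> geo (fun n => v n * x%:C ^+ n).
    move=> [A [r [A0 r0 r1 H]]]; exists A, r; split => // n.
    apply: le_trans (H n); rewrite normcM normcX normc_real ler_piMr ?normc_ge0 //.
    exact: exprn_ile1.
  have := geo_convolution (gx _ (geo_cdiffs gl)) (gx _ gc)
     (geo_evalR x1 (geo_cdiffs gl)) (geo_evalR x1 gc).
  apply: eq_cto => N; apply: eq_bigr => n _.
  rewrite /cdiffs mulr_natl rec big_add1 /= -sumrN mulr_suml.
  apply: eq_big_nat => i /andP[_ iN]; rewrite subSS.
  have En : x%:C ^+ n = x%:C ^+ i * x%:C ^+ (n - i) by rewrite -exprD subnKC.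
  have -> : i.+1%:R * l i.+1 = - p i.+1.
    by rewrite /l mulrN mulrC divfK // pnatr_eq0.
  rewrite En !mulNr; congr (- _).
  by move: (c _) (x%:C ^+ i) (x%:C ^+ (n - i)) => *; ring.
have ReM z w : complex.Re (z * w) = complex.Re z * complex.Re w - complex.Im z * complex.Im w :> R.
  by case: z; case: w.
have ImM z w : complex.Im (z * w) = complex.Im z * complex.Re w + complex.Re z * complex.Im w :> R.
  by case: z => ? ?; case: w => ? ? /=; rewrite addrC.
have eta (z : R[i]) : z = complex.Re z +i* complex.Im z by case: z.
rewrite [evalR c 1]eta [evalR l 1]eta; apply/esym.
apply: (@complex_linear_ode R (fun x => complex.Re (evalR c x)) (fun x => complex.Im (evalR c x))
  (fun x => complex.Re (evalR l x)) (fun x => complex.Im (evalR l x))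
  (fun x => complex.Re (evalR (cdiffs c) x)) (fun x => complex.Im (evalR (cdiffs c) x))
  (fun x => complex.Re (evalR (cdiffs l) x)) (fun x => complex.Im (evalR (cdiffs l) x))).
- by move=> x x1; case: (geo_derive x1 gc).
- by move=> x x1; case: (geo_derive x1 gc).
- by move=> x x1; case: (geo_derive x1 gl).
- by move=> x x1; case: (geo_derive x1 gl).
- by move=> x x1; rewrite ode // ReM.
- by move=> x x1; rewrite ode // ImM.
- by rewrite evalR0 // c0.
- by rewrite evalR0 // c0.
- by rewrite evalR0 // /l invr0 mulr0 oppr0.
- by rewrite evalR0 // /l invr0 mulr0 oppr0.
Qed.

End ComplexPowerSeries.

(** * Closed walks and prime classes *)

Section WalkMatrix.
Variables (X E : finType) (s t : E -> X).

Definition walk_mx (K : pzSemiRingType) (a : E -> K) : 'M[K]_#|X| :=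
  \matrix_(i, j) \sum_(e | (s e == enum_val i) && (t e == enum_val j)) a e.

Fixpoint walkb x (c : seq E) y :=
  if c is e :: c' then (s e == x) && walkb (t e) c' y else x == y.

Definition cyc (c : seq E) := (c != [::]) && cycle (fun e e' => t e == s e') c.

Lemma walk_mx_exp (K : comPzRingType) (a : E -> K) n i j :
  (walk_mx a ^+ n) i j =
  \sum_(c <- words E n | walkb (enum_val i) c (enum_val j)) \prod_(e <- c) a e.
Proof.
elim: n i j => [|n IH] i j.
  rewrite expr0 mxE big_cons big_nil /= (inj_eq enum_val_inj).
  by case: eqP => _; rewrite !big_nil ?addr0.
rewrite exprS -mulmxE mxE /= [RHS]big_mkcond big_allpairs_dep /= big_enum /=.
transitivity (\sum_(e | s e == enum_val i) a e * (walk_mx a ^+ n) (enum_rank (t e)) j).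
  under eq_bigr => k _ do rewrite mxE mulr_suml.
  rewrite (exchange_big_dep (fun e => s e == enum_val i)) /=; last by move=> k e _ /andP[].
  apply: eq_bigr => e se; rewrite se /= (big_pred1 (enum_rank (t e))) // => k.
  by rewrite /= -(inj_eq enum_val_inj) enum_rankK eq_sym.
rewrite big_mkcond /=; apply: eq_bigr => e _; case: ifP => se; last first.
  by rewrite big1_seq.
rewrite IH enum_rankK mulr_sumr big_mkcond /=; apply: eq_bigr => c _.
by case: ifP => // _; rewrite big_cons.
Qed.

Lemma walkb_path e c y :
  walkb (t e) c y = path (fun e e' => t e == s e') e c && (t (last e c) == y).
Proof. by elim: c e => //= f c IH e; rewrite IH eq_sym andbA. Qed.

Lemma walkb_cycle e c : walkb (t e) c (s e) = cyc (e :: c).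
Proof. by rewrite walkb_path /cyc /= rcons_path. Qed.

(** The starting vertex of a closed walk selects the diagonal entry. Positivity of [n] excludes the
    empty word, which is not a cycle although the identity has trace [#|X|]. *)
Lemma trace_walk_mx_exp (K : comPzRingType) (a : E -> K) n : (0 < n)%N ->
  \tr (walk_mx a ^+ n) = \sum_(c <- words E n | cyc c) \prod_(e <- c) a e.
Proof.
move=> n0; rewrite /mxtrace; under eq_bigr => i _ do rewrite walk_mx_exp big_mkcond.
rewrite exchange_big /= [RHS]big_mkcond /= big_seq [RHS]big_seq.
apply: eq_bigr => c; rewrite mem_words; case: c => [|e c] sc.
  by move: sc n0 => /= /eqP <-.
rewrite (bigD1 (enum_rank (s e))) //= enum_rankK eqxx /= walkb_cycle [X in _ + X]big1 ?addr0 // => i ie.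
case: ifP => // /andP[/eqP se _]; move: ie; rewrite se.
by rewrite enum_valK eqxx.
Qed.

Lemma cyc_rot j c : cyc (rot j c) = cyc c.
Proof. by rewrite /cyc rot_cycle -!size_eq0 size_rot. Qed.

Lemma cyc_wpow m c : (0 < m)%N -> cyc (wpow m c) = cyc c.
Proof.
case: m => // m _; case: c => [|x c].
  by rewrite /wpow; elim: m => //= m ->.
have aux k : path (fun e e' => t e == s e') x (c ++ rcons (wpow k (x :: c)) x) =
   path (fun e e' => t e == s e') x (rcons c x).
  elim: k => [|k IH]; first by rewrite cats1.
  rewrite wpowS /= rcons_cat -cat_rcons cat_path last_rcons IH andbb //.
by rewrite wpowS /cyc /= rcons_cat aux.
Qed.

End WalkMatrix.

(** * Prime classes and their representatives *)

Section PrimeClasses.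
Variables (R : realType) (d : nat) (G : periodic_graph R d).
Implicit Types (c : seq (medge G)) (X : set (seq (medge G))).

Lemma is_cycleE c : is_cycle c = cyc (@msrc _ _ G) (@mtgt _ _ G) c.
Proof. by []. Qed.

(** The primitive root of a cycle is a cycle by [cyc_wpow], so a cycle that is not primitive is a
    proper multiple. Conversely an [m]-multiple with [m >= 2] is fixed by the rotation through the
    length of the repeated cycle. *)
Lemma is_prime_cycleP c : is_prime_cycle c <-> is_cycle c /\ primitive c.
Proof.
split=> [[cc np]|[cc [c0 cp]]]; split=> //.
  have cn0 : c <> [::] by move=> E; move: cc; rewrite E.
  have [w [m [pw m0 E]]] := primitive_root cn0.
  case: m m0 E => [//|[|m]] _ E; first by rewrite E /wpow /= cats0.
  case: np; exists m.+2, w; split => //.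
  by rewrite is_cycleE -(cyc_wpow _ _ w (ltn0Sn m.+1)) -E.
move=> [m [c' [m2 cc' E]]].
have m0 : (0 < m)%N by apply: leq_trans m2.
have c'0 : (0 < size c')%N by case: c' cc' {E}.
have Es : size c = (m * size c')%N by rewrite E size_wpow.
have : rot (size c') c = c by rewrite E rot_wpow // rot_size.
case/cp => [c'00|]; first by rewrite c'00 in c'0.
by rewrite Es leqNgt -{1}[size c']mul1n ltn_pmul2r // m2.
Qed.

Lemma cyclic_class_rot j c : cyclic_class (rot j c) = cyclic_class c.
Proof.
apply/seteqP; split=> [w [i ->]|w [i ->]] /=.
  by rewrite rot_rot_add; eexists.
have [k Ek] : exists k, rot i (rot (size c - j) (rot j c)) = rot k (rot j c).
  by rewrite rot_rot_add; eexists.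
by exists k; rewrite -Ek; congr (rot i _); rewrite -[LHS](rotK j) /rotr size_rot.
Qed.

(** All members of a class are rotations of one another, so the arbitrary choice made by [xget]
    inherits every rotation-invariant property. *)
Lemma prime_classP X : prime_classes X ->
  [/\ is_cycle (class_repr X), primitive (class_repr X) & X = cyclic_class (class_repr X)].
Proof.
move=> [c /is_prime_cycleP[cc pc] ->].
have [j E] : cyclic_class c (class_repr (cyclic_class c)).
  by apply: xgetPex; exists c; exists 0%N; rewrite rot0.
rewrite E cyclic_class_rot; split => //; last exact: primitive_rot.
by rewrite is_cycleE cyc_rot.
Qed.

Lemma class_length_gt0 X : prime_classes X -> (0 < class_length X)%N.
Proof. by move=> /prime_classP[cc _ _]; rewrite /class_length; case: class_repr cc. Qed.

Lemma prime_classes_bounded_finite n :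
  finite_set [set X | @prime_classes _ _ G X /\ (class_length X <= n)%N].
Proof.
have fin := finite_image (@cyclic_class _ _ G)
  (finite_seq (flatten [seq words (medge G) k | k <- iota 0 n.+1])).
apply: sub_finite_set fin => X; move: X.
move=> X [PX Xn]; have [_ _ E] := prime_classP PX.
exists (class_repr X); last by rewrite -E.
suff : class_repr X \in flatten [seq words (medge G) k | k <- iota 0 n.+1] by [].
apply/flattenP; exists (words (medge G) (class_length X)); last by rewrite mem_words.
apply: map_f; rewrite mem_iota /= add0n ltnS //.
Qed.

Section Restricted.
Variables (q : pred (seq (medge G))) (D : set (set (seq (medge G)))).
Hypothesis q_rot : forall j c, q (rot j c) = q c.
Hypothesis q_wpow : forall m c, (0 < m)%N -> q (wpow m c) = q c.
Hypothesis DE : forall X, D X <-> prime_classes X /\ q (class_repr X).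

Definition classes_dvd n : set (set (seq (medge G))) :=
  [set X | [/\ D X, (0 < n)%N & (class_length X %| n)%N]].

Lemma classes_dvd_finite n : finite_set (classes_dvd n).
Proof.
apply: sub_finite_set (prime_classes_bounded_finite n) => X [/DE[PX _] n0 Xn].
by split=> //; apply: dvdn_leq.
Qed.

(** [q] will be either trivially true or the condition of index 0. Invariance under rotations makes
    it a condition on classes; invariance under powers lets it pass between a closed walk and its
    primitive root. *)
Lemma sum_cycles_classes (K : comPzRingType) (a : medge G -> K) n : (0 < n)%N ->
  \sum_(c <- words (medge G) n | is_cycle c && q c) \prod_(e <- c) a e =
  \sum_(X <- fset_set (classes_dvd n))
    (class_length X)%:R * (\prod_(e <- class_repr X) a e) ^+ (n %/ class_length X).
Proof.
move=> n0; have memE X : reflect (classes_dvd n X) (X \in fset_set (classes_dvd n)).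
  by rewrite in_fset_set; [apply: (iffP idP); rewrite in_setE|exact: classes_dvd_finite].
have S_prime w : w \in [seq class_repr X | X <- fset_set (classes_dvd n)] ->
    [/\ is_cycle w, primitive w, q w, (size w %| n)%N & class_repr (cyclic_class w) = w].
  move=> /mapP[X]; move=> /memE[/DE[PX qX] _ Xn] ->.
  by have [? ? E] := prime_classP PX; split => //; rewrite -E.
rewrite (@sum_cycles_roots _ (fun c => is_cycle c && q c) _ _ _ n
  [seq class_repr X | X <- fset_set (classes_dvd n)]) ?big_map //.
- by move=> j c; rewrite q_rot is_cycleE cyc_rot.
- by move=> m c m0; rewrite q_wpow // is_cycleE cyc_wpow.
- rewrite map_inj_in_uniq ?fset_uniq // => X Y /memE[/DE[PX _] _ _] /memE[/DE[PY _] _ _] E.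
  by have [_ _ ->] := prime_classP PX; have [_ _ ->] := prime_classP PY; rewrite E.
- by move=> w /S_prime[].
- by move=> w /S_prime[-> _ -> _ _].
- by move=> w /S_prime[].
- move=> w w' j /S_prime[_ _ _ _ Ew] /S_prime[_ _ _ _ Ew'] E.
  by rewrite -Ew -Ew' E cyclic_class_rot.
- move=> w pw /andP[cw qw] wn.
  have Pw : prime_classes (cyclic_class w) by exists w => //; apply/is_prime_cycleP.
  have [j Ej] : cyclic_class w (class_repr (cyclic_class w)).
    by apply: xgetPex; exists w; exists 0%N; rewrite rot0.
  exists (class_repr (cyclic_class w)).
    apply/mapP; exists (cyclic_class w) => //; apply/memE; split => //.
      by apply/DE; split => //; rewrite Ej q_rot.
    by rewrite /class_length Ej size_rot.
  have [_ _ E] := prime_classP Pw.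
  have : cyclic_class w w by exists 0%N; rewrite rot0.
  by rewrite {1}E => -[i Ei]; exists i.
Qed.

End Restricted.
End PrimeClasses.

(** * Series and products over classes *)

Section ComplexExponential.
Variable R : realType.

Lemma sum_mem_le (I : eqType) (g : I -> R) (s t : seq I) : uniq s -> uniq t ->
  (forall X, 0 <= g X) -> \sum_(X <- s | X \in t) g X <= \sum_(X <- t) g X.
Proof.
move=> us ut g0; rewrite -big_filter.
rewrite (perm_big [seq X <- t | X \in s]) /=; last first.
  by apply: uniq_perm; rewrite ?filter_uniq // => X; rewrite !mem_filter andbC.
rewrite big_filter [X in _ <= X](bigID (fun X => X \in s)) /= lerDl.
exact: sumr_ge0.
Qed.

Lemma sum_mem_eq (I : eqType) (g : I -> R[i]) (s t : seq I) : uniq s -> uniq t ->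
  {subset t <= s} -> \sum_(X <- s | X \in t) g X = \sum_(X <- t) g X.
Proof.
move=> us ut ts; rewrite -big_filter.
apply: perm_big; apply: uniq_perm; rewrite ?filter_uniq // => X.
by rewrite mem_filter; case Xt: (X \in t) => //=; rewrite ts.
Qed.

(** In the expansion by walk length, the [m]-th power of a class of length [k] sits at order [m k];
    inserting zeros keeps the sum. The slot of order 0 stays empty, whence [w 0 = 0]. *)
Lemma cto_spaced (k : nat) (w : nat -> R[i]) s : (0 < k)%N -> w 0%N = 0 ->
  cto (psum w) s ->
  cto (psum (fun n => if (0 < n)%N && (k %| n)%N then w (n %/ k)%N else 0)) s.
Proof.
move=> k0 w0 ws.
have E N : psum (fun n => if (0 < n)%N && (k %| n)%N then w (n %/ k)%N else 0) N.+1
    = psum w (N %/ k).+1.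
  elim: N => [|N IH]; first by rewrite div0n /psum !big_nat1.
  rewrite /psum big_nat_recr //= -/(psum _ N.+1) IH divnS //.
  case: ifP => dN; last by rewrite addr0 add0n.
  by rewrite dN add1n /psum [RHS]big_nat_recr.
apply/ctoP => e e0; have /ctoP/(_ _ e0)[M HM] := ws.
exists (M * k).+1 => -[//|N] Nk; rewrite E HM // ltnW // ltnS leq_divRL //.
Qed.

Lemma cto_geometric (x : R[i]) : normc x < 1 ->
  cto (psum (fun n => if (0 < n)%N then x ^+ n else 0)) (x / (1 - x)).
Proof.
move=> x1; have xn1 : 1 - x != 0.
  by apply: contraTneq x1 => /eqP; rewrite subr_eq0 => /eqP <-; rewrite normc1 ltxx.
have E N : psum (fun n => if (0 < n)%N then x ^+ n else 0) N.+1 = (x - x ^+ N.+1) / (1 - x).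
  elim: N => [|N IH]; first by rewrite /psum big_nat1 /= subrr mul0r.
  rewrite /psum big_nat_recr //= -/(psum _ _) IH !exprS; move: (x ^+ N) => y.
  by field.
apply/ctoP => e e0.
have H : (fun n => normc x ^+ n / normc (1 - x)) @ \oo --> (0 : R).
  rewrite -[X in _ --> X](mul0r (normc (1 - x))^-1).
  apply: cvgM; last exact: cvg_cst.
  by apply: cvg_expr; rewrite ger0_norm ?normc_ge0.
have /cvgrPdist_lt/(_ _ e0)[N _ HN] := H.
exists N.+1 => -[//|n] Nn; rewrite E.
have -> : (x - x ^+ n.+1) / (1 - x) - x / (1 - x) = - (x ^+ n.+1 / (1 - x)).
  by field.
rewrite normcN normcM normcV normcX.
have := HN n.+1 (ltnW Nn); rewrite sub0r normrN ger0_norm //.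
by rewrite divr_ge0 ?exprn_ge0 ?normc_ge0.
Qed.

(** The exponential identity is [newton_exp] for the single factor [1 - x X], whose power sums are
    [x^n] and whose coefficients add up to [1 - x]. *)
Lemma cto_clog1B (x : R[i]) : normc x < 1 ->
  cto (psum (fun n => - (x ^+ n / n%:R))) (clog1B x) /\ cexp (clog1B x) = 1 - x.
Proof.
move=> x1.
have gx : geo (fun n => x ^+ n).
  by exists 1, (normc x); split=> //; [exact: normc_ge0|move=> n; rewrite mul1r normcX].
have [s xs] : exists s, cto (psum (fun n => - (x ^+ n / n%:R))) s.
  apply: geo_cvg; case: gx => B [p [B0 p0 p1 H]]; exists B, p; split => // n.
  apply: le_trans (H n); rewrite normcN normcM normcV normc_natr.
  case: n => [|n]; first by rewrite invr0 mulr0 normc_ge0.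
  by rewrite ler_piMr ?normc_ge0 // invf_le1 ?ltr0n // ler1n.
have -> : clog1B x = s.
  apply: cto_clim; apply: eq_cto xs => N; rewrite /psum -sumrN.
  case: N => [|N]; first by rewrite !big_geq.
  by rewrite big_nat_recl // invr0 mulr0 oppr0 add0r big_add1.
split => //.
pose c n := (euler_prod (fun _ : unit => 1%N) (fun=> x) [:: tt])`_n.
have cE n : c n = (1 - x%:P * 'X : {poly R[i]})`_n by rewrite /c /euler_prod big_seq1.
have rec n : c n *+ n = - \sum_(1 <= j < n.+1) x ^+ j * c (n - j)%N.
  rewrite /c newton_recursion //; congr (- _); apply: eq_big_nat => j _.
  by rewrite /power_sum big_cons big_nil dvd1n addr0 divn1 mul1r.
have c0 : c 0%N = 1 by rewrite /c euler_prod_coef0.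
apply: cto_uniq (newton_exp c0 rec gx xs) _.
apply/ctoP => e e0; exists 2%N => n n2.
rewrite /psum (big_cat_nat (n := 2)) //= big_nat_recr //= big_nat1 [X in _ + _ + X]big_nat big1.
  rewrite addr0 !cE !coefB !coef1 !coefCM !coefX /= mulr0 mulr1 subr0 sub0r subrr.
  by rewrite normc_zero.
move=> i /andP[i2 _]; rewrite cE coefB coef1 coefCM coefX.
by case: i i2 => [|[|i]] //= _; rewrite mulr0 subrr.
Qed.

Lemma cexpD (x y : R[i]) : cexp (x + y) = cexp x * cexp y.
Proof.
case: x => a b; case: y => a' b'; rewrite /cexp /cis; apply: eqc => /=.
  by rewrite expRD cosD; ring.
by rewrite expRD sinD; ring.
Qed.

Lemma normc_cexp (x : R[i]) : normc (cexp x) = expR (complex.Re x).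
Proof. by rewrite /cexp normcM normc_cis normc_real mulr1 ger0_norm ?expR_ge0. Qed.

Lemma cexp0 : cexp (0 : R[i]) = 1.
Proof. by rewrite /cexp /cis /= expR0 cos0 sin0; apply: eqc => /=; ring. Qed.

Lemma cexp_continuous (s : R[i]) eps : 0 < eps -> exists2 delta, 0 < delta &
  forall x, normc (x - s) < delta -> normc (cexp x - cexp s) < eps.
Proof.
move=> e0.
have Es := expR_gt0 (complex.Re s); set K := expR _ in Es.
have e1 : 0 < eps / K / 3 by rewrite !divr_gt0.
have near (f : R -> R) y0 : continuous f -> f 0 = y0 -> exists2 delta : R, 0 < delta &
    forall y : R, `|y| < delta -> `|f y - y0| < eps / K / 3.
  move=> fc f0; have := fc (0 : R); rewrite /continuous_at f0.
  move=> /cvgrPdist_lt/(_ _ e1)/nbhs_ballP[delta d0 H]; exists delta => // y yd.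
  by rewrite distrC; apply: H; rewrite /ball /= sub0r normrN.
have [d1 d10 H1] := near expR 1 (@continuous_expR R) (expR0 R).
have [d2 d20 H2] := near cos 1 (@continuous_cos R) (cos0 R).
have [d3 d30 H3] := near sin 0 (@continuous_sin R) (sin0 R).
exists (Num.min d1 (Num.min d2 d3)); first by rewrite !lt_min d10 d20 d30.
move=> x; rewrite !lt_min => /and3P[x1 x2 x3].
(* Multiplicativity reduces continuity at [s] to continuity at 0. There [expR], [cos] and [sin] each
   get a third of [eps / K], with [K] the modulus of [cexp s]. *)
have -> : cexp x - cexp s = cexp s * (cexp (x - s) - 1).
  by rewrite mulrBr mulr1 -cexpD [s + _]addrC subrK.
rewrite normcM normc_cexp -/K mulrC -ltr_pdivlMr //.
move: (x - s) x1 x2 x3 => h h1 h2 h3.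
have -> : cexp h - 1 = ((expR (complex.Re h) - 1)%:C) * cis (complex.Im h) +
   ((cos (complex.Im h) - 1) +i* sin (complex.Im h)).
  rewrite /cexp /cis; apply: eqc; case: h {h1 h2 h3} => a b /=; ring.
apply: le_lt_trans (le_normcD _ _) _.
rewrite normcM normc_cis mulr1 normc_real.
apply: le_lt_trans (lerD (lexx _) (normc_le_ReIm _)) _ => /=.
have := H1 _ (le_lt_trans (le_Re_normc h) h1).
have := H2 _ (le_lt_trans (le_Im_normc h) h2).
have := H3 _ (le_lt_trans (le_Im_normc h) h3).
rewrite subr0; lra.
Qed.

Lemma cexp_sum (I : Type) (F : seq I) (f : I -> R[i]) :
  cexp (\sum_(X <- F) f X) = \prod_(X <- F) cexp (f X).
Proof. by elim/big_rec2: _ => [|X y x _ <-]; rewrite ?cexp0 ?cexpD. Qed.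

End ComplexExponential.

(** * Series over an abstract family of lengths and weights *)

Section ClassSeries.
Variables (R : realType) (I : choiceType) (l : I -> nat).
Implicit Types (D : set I) (u : I -> R[i]).

(** The clause [0 < n] removes order 0, which every length divides. *)
Definition dvd_set D n : set I := [set X | [/\ D X, (0 < n)%N & (l X %| n)%N]].

Definition class_power_sum D u n : R[i] :=
  \sum_(X <- fset_set (dvd_set D n)) (l X)%:R * u X ^+ (n %/ l X).

Variable D : set I.
Hypothesis l_gt0 : forall X, D X -> (0 < l X)%N.
Hypothesis D_finite : forall n, finite_set [set X | D X /\ (l X <= n)%N].

Lemma dvd_set_finite n : finite_set (dvd_set D n).
Proof.
by apply: sub_finite_set (D_finite n) => X [DX n0 Xn]; split=> //; apply: dvdn_leq.
Qed.

Lemma mem_dvd_set n X : reflect (dvd_set D n X) (X \in fset_set (dvd_set D n)).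
Proof.
by rewrite in_fset_set; [apply: (iffP idP); rewrite in_setE|exact: dvd_set_finite].
Qed.

Lemma mem_bounded_set n X : reflect (D X /\ (l X <= n)%N)
  (X \in fset_set [set X | D X /\ (l X <= n)%N]).
Proof. by rewrite in_fset_set //; apply: (iffP idP); rewrite in_setE. Qed.

Lemma class_power_sum0 u : class_power_sum D u 0 = 0.
Proof.
rewrite /class_power_sum (_ : dvd_set D 0 = set0) ?fset_set0 ?big_nil //.
by apply/seteqP; split=> // X [].
Qed.

(** Newton's identities ask for positive lengths on the whole type; [l1] provides this and agrees
    with [l] on [D]. *)
Let l1 X := (l X).-1.+1.

(** Each coefficient has its own finite product; by [coef_euler_prod_filter] all those of order at
    most [n] can be read off from the one over [S n], where [newton_recursion] applies. *)
Lemma product_newton u (c : nat -> R[i]) :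
  (forall n, c n = (\prod_(X <- fset_set [set X | D X /\ (l X <= n)%N])
     (1 - (u X)%:P * 'X^(l X)) : {poly R[i]})`_n) ->
  c 0%N = 1 /\
  forall n, c n *+ n = - \sum_(1 <= j < n.+1) class_power_sum D u j * c (n - j)%N.
Proof.
move=> cE; have lE X : D X -> l1 X = l X by move=> /l_gt0 ?; rewrite /l1 prednK.
pose S n := (fset_set [set X | D X /\ (l X <= n)%N] : seq I).
have cE' n m : (m <= n)%N -> c m = (euler_prod l1 u (S n))`_m.
  move=> mn; rewrite cE -coef_euler_prod_filter //.
  rewrite /euler_prod (perm_big [seq i <- S n | (l1 i <= m)%N]) /=.
    congr (nth 0 (polyseq _) m); apply: eq_big_seq => X.
    by rewrite mem_filter => /andP[_ /mem_bounded_set[/lE -> _]].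
  apply: uniq_perm; rewrite ?filter_uniq ?fset_uniq // => X.
  rewrite mem_filter; apply/mem_bounded_set/andP.
    by move=> [DX Xm]; rewrite lE //; split => //; apply/mem_bounded_set; split => //; apply: leq_trans mn.
  by move=> [+ /mem_bounded_set[DX _]]; rewrite lE.
split; first by rewrite (cE' 0%N 0%N) // euler_prod_coef0.
move=> n; rewrite (cE' n n) // newton_recursion //; congr (- _).
apply: eq_big_nat => j /andP[j0 jn]; rewrite -(cE' n) ?leq_subr //; congr (_ * _).
rewrite /power_sum -big_filter /class_power_sum.
rewrite (perm_big (fset_set (dvd_set D j))) /=.
  by apply: eq_big_seq => X /mem_dvd_set[/lE ->].
apply: uniq_perm; rewrite ?filter_uniq ?fset_uniq // => X.
rewrite mem_filter; apply/andP/mem_dvd_set.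
  by move=> [+ /mem_bounded_set[DX _]]; rewrite lE.
move=> [DX _ Xj]; rewrite lE //; split => //; apply/mem_bounded_set; split => //.
by apply: leq_trans (dvdn_leq j0 Xj) _; rewrite -ltnS.
Qed.

Section Bounded.
Variables (u : I -> R[i]) (z : R[i]) (A r : R).
Hypotheses (A0 : 0 <= A) (r0 : 0 <= r) (r1 : r < 1).
Hypothesis bound : forall n, (0 < n)%N ->
  \sum_(X <- fset_set (dvd_set D n)) (l X)%:R * normc (u X) ^+ (n %/ l X) * normc z ^+ n
    <= A * r ^+ n.

Let q X := u X * z ^+ l X.

Lemma normc_factor_pow X n : (l X %| n)%N ->
  normc (q X) ^+ (n %/ l X) = normc (u X) ^+ (n %/ l X) * normc z ^+ n.
Proof. by move=> Xn; rewrite /q normcM normcX exprMn -exprM mulnC divnK. Qed.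

Lemma factor_pow X n : (l X %| n)%N -> q X ^+ (n %/ l X) = u X ^+ (n %/ l X) * z ^+ n.
Proof. by move=> Xn; rewrite /q exprMn -exprM mulnC divnK. Qed.

(** The common majorant of three expansions: of the resolvent term, of the logarithm and of the
    factor itself. In each, order [n] is occupied only if [l X] divides [n], by at most
    [l X |q X|^(n / l X)]. *)
Lemma bounded_sum (g : I -> nat -> R) (F : {fset I}) n :
  (forall X n, D X -> 0 <= g X n) ->
  (forall X, D X -> ~ dvd_set D n X -> g X n = 0) ->
  (forall X, dvd_set D n X -> g X n <= (l X)%:R * normc (q X) ^+ (n %/ l X)) ->
  [set` F] `<=` D -> \sum_(X <- F) g X n <= A * r ^+ n.
Proof.
move=> g0 gn gd FD; case: (posnP n) => [n0|n0].
  rewrite big_seq big1 ?mulr_ge0 ?exprn_ge0 // => X /FD DX.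
  by apply: gn => // -[_]; rewrite n0.
apply: le_trans (bound n0).
have H : \sum_(X <- F) g X n <= \sum_(X <- F | X \in fset_set (dvd_set D n))
    (l X)%:R * normc (u X) ^+ (n %/ l X) * normc z ^+ n.
  rewrite [leRHS]big_mkcond big_seq [leRHS]big_seq; apply: ler_sum => X /FD DX.
  case: (mem_dvd_set n X) => [dX|ndX]; last by rewrite gn.
  by rewrite -mulrA -normc_factor_pow ?gd //; case: dX.
apply: le_trans H (sum_mem_le _ _ _); rewrite ?fset_uniq // => X.
by rewrite !mulr_ge0 ?exprn_ge0 ?normc_ge0.
Qed.

Lemma class_terms_full (a : I -> nat -> R[i]) (v : nat -> R[i]) :
  (forall X n, D X -> ~ dvd_set D n X -> a X n = 0) ->
  (forall n, v n = \sum_(X <- fset_set (dvd_set D n)) a X n) ->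
  forall N, exists2 F0 : {fset I}, [set` F0] `<=` D &
     forall F : {fset I}, [set` F] `<=` D -> (F0 `<=` F)%fset ->
       forall n, (n < N)%N -> \sum_(X <- F) a X n = v n.
Proof.
move=> an vE N; exists (fset_set [set X | D X /\ (l X <= N)%N]).
  by move=> X /= /mem_bounded_set[].
move=> F FD /fsubsetP F0F n nN; rewrite vE -(@sum_mem_eq R I (fun X => a X n) F (fset_set (dvd_set D n))) ?fset_uniq //.
  rewrite [RHS]big_mkcond; apply: eq_big_seq => X /FD DX.
  by case: (mem_dvd_set n X) => // ndX; rewrite an.
move=> X /mem_dvd_set[DX n0 Xn]; apply: F0F; apply/mem_bounded_set; split => //.
by rewrite (leq_trans (dvdn_leq n0 Xn)) // ltnW.
Qed.

(** If [|q X| >= 1], the powers of this one class keep the left side of [bound] at least 1 along the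
    multiples of [l X], whereas [A r^n] tends to 0. *)
Lemma normc_factor_lt1 X : D X -> normc (q X) < 1.
Proof.
move=> DX; rewrite ltNge; apply/negP => q1.
have H n : (0 < n)%N -> 1 <= A * r ^+ n.
  move=> n0; have lX := l_gt0 DX.
  have h := @bounded_sum (fun X n => if `[< dvd_set D n X >] then (l X)%:R * normc (q X) ^+ (n %/ l X) else 0)
     [fset X]%fset (n * l X)%N.
  apply: le_trans (le_trans (h _ _ _ _) _).
  - rewrite big_seq_fset1 asboolT; last by split; rewrite ?muln_gt0 ?n0 ?dvdn_mull.
    by rewrite mulnK // mulr_ege1 ?ler1n ?exprn_ege1.
  - move=> Y m DY; case: ifP => // _; by rewrite mulr_ge0 ?exprn_ge0 ?normc_ge0.
  - by move=> Y DY nY; rewrite asboolF.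
  - by move=> Y dY; rewrite asboolT.
  - by move=> Y /=; rewrite inE => /eqP ->.
  - by rewrite ler_wpM2l //; apply: ler_wiXn2l => //; [exact: ltW|exact: leq_pmulr].
have /cvgrPdist_lt/(_ _ ltr01)[N _ HN] : (fun n => A * r ^+ n) @ \oo --> (0 : R).
  by apply: cvg_geometric; rewrite ger0_norm.
have := HN N.+1 (leqnSn N); rewrite sub0r normrN ger0_norm ?mulr_ge0 ?exprn_ge0 //.
by rewrite ltNge H.
Qed.

(** [q / (1 - q)] is the sum of the [q^m] with [m >= 1]; collecting the classes at order [n] gives
    the power sum times [z^n]. *)
Lemma class_resolvent_sum s :
  cto (psum (fun n => class_power_sum D u n * z ^+ n)) s ->
  abs_sum_to D (fun X => (l X)%:R * (q X / (1 - q X))) s.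
Proof.
move=> vs.
pose a X n := if (0 < n)%N && (l X %| n)%N then (l X)%:R * q X ^+ (n %/ l X) else 0.
apply: (@family_sum _ _ D a _ A r A0 r0 r1 _ _ _ s _ vs).
- move=> F n FD; apply: (bounded_sum (g := fun X n => normc (a X n))) => //.
  + by move=> X m _; apply: normc_ge0.
  + move=> X DX nX; rewrite /a; case: ifP => [/andP[? ?]|_]; last exact: normc_zero.
    by case: nX.
  + by move=> X [_ n0 Xn]; rewrite /a n0 Xn /= normcM normcX normc_natr.
- move=> X DX; have lX := l_gt0 DX.
  have H := ctoM (l X)%:R (cto_spaced lX erefl (cto_geometric (normc_factor_lt1 DX))).
  apply: eq_cto H => N; rewrite /psum mulr_sumr; apply: eq_bigr => n _.
  rewrite /a; case: ifP => [/andP[n0 Xn]|_]; last by rewrite mulr0.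
  by rewrite divn_gt0 // dvdn_leq.
- apply: class_terms_full => [X n DX nX|n].
    rewrite /a; case: ifP => [/andP[? ?]|_] //; by case: nX.
  rewrite /class_power_sum mulr_suml.
  apply: eq_big_seq => X /mem_dvd_set[DX n0 Xn].
  by rewrite /a n0 Xn /= factor_pow // mulrA.
Qed.

Lemma class_log_sum s :
  cto (psum (fun n => - (class_power_sum D u n * z ^+ n / n%:R))) s ->
  abs_sum_to D (fun X => clog1B (q X)) s.
Proof.
move=> vs.
pose a X n := if (0 < n)%N && (l X %| n)%N
  then - (q X ^+ (n %/ l X) / (n %/ l X)%:R) else 0.
apply: (@family_sum _ _ D a _ A r A0 r0 r1 _ _ _ s _ vs).
- move=> F n FD; apply: (bounded_sum (g := fun X n => normc (a X n))) => //.
  + by move=> X m _; apply: normc_ge0.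
  + move=> X DX nX; rewrite /a; case: ifP => [/andP[? ?]|_]; last exact: normc_zero.
    by case: nX.
  + move=> X [DX n0 Xn]; rewrite /a n0 Xn /= normcN normcM normcV normcX normc_natr mulrC.
    have lX := l_gt0 DX; have nl : (0 < n %/ l X)%N by rewrite divn_gt0 // dvdn_leq.
    rewrite ler_wpM2r ?exprn_ge0 ?normc_ge0 //.
    by apply: le_trans (_ : 1 <= _); rewrite ?ler1n // invf_le1 ?ltr0n // ler1n.
- move=> X DX; have lX := l_gt0 DX.
  have w0 : - (q X ^+ 0 / 0%:R) = 0 :> R[i] by rewrite invr0 mulr0 oppr0.
  exact: (cto_spaced lX w0 (cto_clog1B (normc_factor_lt1 DX)).1).
- apply: class_terms_full => [X n DX nX|n].
    rewrite /a; case: ifP => [/andP[? ?]|_] //; by case: nX.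
  rewrite /class_power_sum !mulr_suml -sumrN.
  apply: eq_big_seq => X /mem_dvd_set[DX n0 Xn].
  have lX := l_gt0 DX; have nl : (0 < n %/ l X)%N by rewrite divn_gt0 // dvdn_leq.
  rewrite /a n0 Xn /= factor_pow //; congr (- _).
  (* The factor [l X] of the power sum cancels against that of [n = (n %/ l X) * l X]. *)
  rewrite -{3}(divnK Xn) natrM; field.
  by rewrite !pnatr_eq0 -!lt0n lX nl.
Qed.

(** Only the first power of each class is kept, at order [l X], where [bound] already dominates
    it. *)
Lemma class_factor_summable : abs_summable D q.
Proof.
pose a X n := if n == l X then q X else 0.
apply: (@family_summable _ _ D a _ A r A0 r0 r1).
- move=> F n FD; apply: (bounded_sum (g := fun X n => normc (a X n))) => //.
  + by move=> X m _; apply: normc_ge0.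
  + move=> X DX nX; rewrite /a; case: eqP => [E|_]; last exact: normc_zero.
    by case: nX; rewrite E; split=> //; rewrite l_gt0.
  + move=> X [DX n0 Xn]; rewrite /a; case: eqP => [->|_].
      by rewrite divnn l_gt0 // expr1 ler_peMl ?normc_ge0 // ler1n l_gt0.
    by rewrite normc_zero mulr_ge0 ?exprn_ge0 ?normc_ge0.
- move=> X DX; apply/ctoP => e e0; exists (l X).+1 => n ln.
  rewrite /psum (big_cat_nat (n := (l X).+1)) //= big_nat_recr //= big_nat big1; last first.
    by move=> j /andP[_ ji]; rewrite /a ltn_eqF.
  rewrite big_nat big1; last by move=> j /andP[ij _]; rewrite /a gtn_eqF.
  by rewrite add0r addr0 /a eqxx subrr normc_zero.
Qed.

(** Each factor is the exponential of its logarithm, and continuity of the exponential carries the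
    limit of the sums of logarithms to the products. *)
Lemma class_prod1B s :
  cto (psum (fun n => - (class_power_sum D u n * z ^+ n / n%:R))) s ->
  abs_prod1B_to D q (cexp s).
Proof.
move=> /class_log_sum[_ H]; split; first exact: class_factor_summable.
move=> eps e0; have [delta d0 Hd] := cexp_continuous s e0.
have [F0 F0D HF] := H _ d0; exists F0 => // F FD F0F.
have -> : \prod_(X <- F) (1 - q X) = cexp (\sum_(X <- F) clog1B (q X)).
  rewrite cexp_sum big_seq [RHS]big_seq; apply: eq_bigr => X XF.
  by rewrite (cto_clog1B (normc_factor_lt1 (FD X XF))).2.
by apply: Hd; apply: HF.
Qed.

End Bounded.
End ClassSeries.

(** * Means over the torus *)

Section TorusMean.
Variable R : realType.
Notation mu := (@lebesgue_measure R).
Notation circle := `[0 : R, 2 * pi]%classic.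

(** Frequencies may repeat in the list, so closed walks can be listed without collecting those of
    equal index. *)
Definition trig_poly d (s : seq (R[i] * 'rV[int]_d)) (k : 'rV[R]_d) : R[i] :=
  \sum_(x <- s) x.1 * cis (pairing x.2 k).

Definition trig_mean d (s : seq (R[i] * 'rV[int]_d)) : R[i] :=
  \sum_(x <- s | x.2 == 0) x.1.

Definition trig1 (s : seq (R[i] * int)) (y : R) : R :=
  complex.Re (\sum_(x <- s) x.1 * cis (x.2%:~R * y)).

Lemma twopi_gt0 : 0 < 2 * pi :> R.
Proof. by rewrite mulr_gt0 ?pi_gt0. Qed.

Lemma trig1_cons x s :
  trig1 (x :: s) = (fun y => (complex.Re x.1 * cos (x.2%:~R * y)
    - complex.Im x.1 * sin (x.2%:~R * y)) + trig1 s y).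
Proof.
apply/funext => y; rewrite /trig1 big_cons ReD; congr (_ + _).
by case: x => [[a b] n].
Qed.

Lemma is_derive_cosZ (n y : R) : is_derive y 1 (fun y : R => cos (n * y)) (- sin (n * y) * n).
Proof.
have h : is_derive y 1 (fun y : R => n * y) n.
  by apply: is_derive_eq; rewrite /GRing.scale /= mulr1.
exact: (is_derive1_comp (is_derive_cos _) h).
Qed.

Lemma is_derive_sinZ (n y : R) : is_derive y 1 (fun y : R => sin (n * y)) (cos (n * y) * n).
Proof.
have h : is_derive y 1 (fun y : R => n * y) n.
  by apply: is_derive_eq; rewrite /GRing.scale /= mulr1.
exact: (is_derive1_comp (is_derive_sin _) h).
Qed.

Lemma derive_continuous (f df : R -> R) :
  (forall y : R, is_derive y 1 f (df y)) -> continuous f.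
Proof.
move=> H y; apply/differentiable_continuous/derivable1_diffP.
by case: (H y).
Qed.

Lemma continuous_wave (a b n : R) :
  continuous (fun y : R => a * cos (n * y) - b * sin (n * y)).
Proof.
have hc := derive_continuous (is_derive_cosZ n).
have hs := derive_continuous (is_derive_sinZ n).
by move=> y; apply: cvgB; apply: cvgM; [exact: cvg_cst|exact: hc|exact: cvg_cst|exact: hs].
Qed.

Lemma continuous_trig1 s : continuous (trig1 s).
Proof.
elim: s => [|x s IH].
  have -> : trig1 [::] = cst 0 by apply/funext => y; rewrite /trig1 big_nil.
  by move=> y; apply: cvg_cst.
rewrite trig1_cons => y; apply: cvgD; first exact: continuous_wave.
exact: IH.
Qed.

Lemma continuous_integrable (f : R -> R) : continuous f -> mu.-integrable circle (EFin \o f).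
Proof.
move=> fc; apply: continuous_compact_integrable; first exact: segment_compact.
exact: continuous_subspaceT.
Qed.

Lemma sin_cos_2pi_natmul (m : nat) :
  sin (m%:R * (2 * pi)) = 0 :> R /\ cos (m%:R * (2 * pi)) = 1 :> R.
Proof.
elim: m => [|m [s c]]; first by rewrite !mul0r sin0 cos0.
rewrite -natr1 mulrDl mul1r sinD cosD s c [2 * pi]mulr_natl sin2pi cos2pi.
by split; ring.
Qed.

Lemma sin_int_pi (n : int) : sin (n%:~R * (2 * pi)) = 0 :> R.
Proof.
case: n => m; first by rewrite -pmulrn (sin_cos_2pi_natmul m).1.
by rewrite NegzE mulrNz mulNr sinN -pmulrn (sin_cos_2pi_natmul m.+1).1 oppr0.
Qed.

Lemma cos_int_pi (n : int) : cos (n%:~R * (2 * pi)) = 1 :> R.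
Proof.
case: n => m; first by rewrite -pmulrn (sin_cos_2pi_natmul m).2.
by rewrite NegzE mulrNz mulNr cosN -pmulrn (sin_cos_2pi_natmul m.+1).2.
Qed.

Lemma integral_wave (a b : R) (n : int) : n != 0 ->
  (\int[mu]_(y in circle) (a * cos (n%:~R * y) - b * sin (n%:~R * y)) = 0)%R.
Proof.
move=> n0; have n0' : n%:~R != 0 :> R by rewrite intr_eq0.
pose F (y : R) := a / n%:~R * sin (n%:~R * y) + b / n%:~R * cos (n%:~R * y).
have dF (y : R) : is_derive y 1 F (a * cos (n%:~R * y) - b * sin (n%:~R * y)).
  have hc := is_derive_cosZ n%:~R y; have hs := is_derive_sinZ n%:~R y.
  apply: is_derive_eq; rewrite /GRing.scale /=.
  move: (cos _) (sin _) => c s; by field.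
have cF := derive_continuous dF.
rewrite /Rintegral (@continuous_FTC2 _ _ F) ?twopi_gt0 //.
- have -> : F (2 * pi) = F 0 by rewrite /F sin_int_pi cos_int_pi !mulr0 sin0 cos0 !mulr0.
  by rewrite -EFinB subrr.
- exact/continuous_subspaceT/continuous_wave.
- split.
  + by move=> y _; case: (dF y).
  + exact: cvg_at_right_filter (cF 0).
  + exact: cvg_at_left_filter (cF (2 * pi)).
- by move=> y _; rewrite derive1E; case: (dF y).
Qed.

Lemma integral_cst_circle (c : R) : (\int[mu]_(y in circle) c = 2 * pi * c)%R.
Proof.
rewrite Rintegral_cst //= lebesgue_measure_itv /= lte_fin twopi_gt0 /=.
by rewrite subr0 mulrC.
Qed.

Lemma integral_trig1 s :
  (\int[mu]_(y in circle) trig1 s y = 2 * pi * complex.Re (\sum_(x <- s | x.2 == 0%R) x.1))%R.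
Proof.
elim: s => [|x s IH].
  have -> : trig1 [::] = cst 0 by apply/funext => y; rewrite /trig1 big_nil.
  by rewrite integral_cst_circle big_nil.
rewrite trig1_cons RintegralD //; last 2 first.
- exact/continuous_integrable/continuous_wave.
- exact/continuous_integrable/continuous_trig1.
rewrite IH big_cons; case: eqP => [->|/eqP n0]; last by rewrite integral_wave ?add0r.
have -> : (\int[mu]_(y in circle) (complex.Re x.1 * cos (0%:~R * y)
    - complex.Im x.1 * sin (0%:~R * y)) = 2 * pi * complex.Re x.1)%R.
  under eq_Rintegral do rewrite mul0r cos0 sin0 mulr1 mulr0 subr0.
  exact: integral_cst_circle.
by rewrite -mulrDr -ReD.
Qed.

(** Freezing the first coordinate at [y] moves its phase into the coefficients. *)
Definition trig_slice d (s : seq (R[i] * 'rV[int]_d.+1)) (y : R) : seq (R[i] * 'rV[int]_d) :=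
  [seq (x.1 * cis ((x.2 0 0)%:~R * y), rsubmx (x.2 : 'rV[int]_(1 + d))) |
    x : R[i] * 'rV[int]_d.+1 <- s].

(** The terms that survive averaging over all coordinates but the first, as a trigonometric
    polynomial in that one. *)
Definition trig_axis d (s : seq (R[i] * 'rV[int]_d.+1)) : seq (R[i] * int) :=
  [seq (x.1, x.2 0 0) | x : R[i] * 'rV[int]_d.+1 <- s &
    rsubmx (x.2 : 'rV[int]_(1 + d)) == 0].

Lemma cisD (x y : R) : cis (x + y) = cis x * cis y.
Proof. by rewrite /cis cosD sinD; apply: eqc => /=; ring. Qed.

Lemma trig_poly_slice d (s : seq (R[i] * 'rV[int]_d.+1)) (y : R) (k : 'rV[R]_d) :
  trig_poly s (row_mx (const_mx y : 'rV_1) k) = trig_poly (trig_slice s y) k.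
Proof.
rewrite /trig_poly big_map; apply: eq_bigr => x _ /=.
rewrite -mulrA -cisD; congr (_ * cis _).
rewrite /pairing big_ord_recl; congr (_ + _).
  have -> : ord0 = lshift d (ord0 : 'I_1) by apply: val_inj.
  have -> : row_mx (const_mx y : 'rV_1) k 0 (lshift d ord0) = y.
    by apply: (etrans (row_mxEl _ _ _ _)); rewrite mxE.
  by congr ((x.2 _ _)%:~R * _); apply: val_inj.
apply: eq_bigr => i _; rewrite [rsubmx _ _ _]mxE.
have -> : lift ord0 i = rshift 1 i by apply: val_inj.
by congr (_ * _); apply: (etrans (row_mxEr _ _ _ _)).
Qed.

Lemma trig_mean_slice d (s : seq (R[i] * 'rV[int]_d.+1)) (y : R) :
  complex.Re (trig_mean (trig_slice s y)) =
  trig1 (trig_axis s) y.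
Proof.
by rewrite /trig_mean /trig1 /trig_slice /trig_axis !big_map big_filter.
Qed.

Lemma row_eq0_slice d (a : 'rV[int]_d.+1) :
  (a == 0) = (rsubmx (a : 'rV_(1 + d)) == 0) && (a 0 0 == 0).
Proof.
apply/eqP/andP => [->|[/eqP r0 /eqP a0]].
  by rewrite mxE; split=> //; apply/eqP/rowP => i; rewrite !mxE.
rewrite -(hsubmxK (a : 'rV_(1 + d))) r0; apply/rowP => i; rewrite [RHS]mxE.
case: (splitP (i : 'I_(1 + d))) => j ij.
  have -> : i = lshift d j by apply: val_inj.
  apply: (etrans (row_mxEl _ _ _ _)); rewrite mxE -a0 ord1; congr (a _ _); exact: val_inj.
have -> : i = rshift 1 j by apply: val_inj.
by apply: (etrans (row_mxEr _ _ _ _)); rewrite mxE.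
Qed.

Lemma torus_mean_trig d (s : seq (R[i] * 'rV[int]_d)) :
  torus_mean (fun k => complex.Re (trig_poly s k)) = complex.Re (trig_mean s).
Proof.
elim: d s => [|d IH] s.
  rewrite /= /trig_poly /trig_mean; congr complex.Re.
  rewrite [RHS]big_mkcond; apply: eq_bigr => x _.
  rewrite (_ : x.2 = 0) ?eqxx; last by apply/rowP => -[].
  by rewrite /pairing big_ord0 /cis cos0 sin0 mulr1.
rewrite /=.
under eq_Rintegral => y _.
  under eq_fun do rewrite trig_poly_slice.
  rewrite IH trig_mean_slice; over.
rewrite integral_trig1 mulrA mulVf ?gt_eqF ?twopi_gt0 // mul1r.
congr complex.Re; rewrite /trig_axis big_map big_filter_cond /trig_mean; apply: eq_bigl => x.
by rewrite [RHS]row_eq0_slice.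
Qed.

(** Freezing a coordinate and averaging the others both lead to trigonometric polynomials again, so
    every integrand met in the induction is continuous. *)
Lemma torus_mean_bound d (s : seq (R[i] * 'rV[int]_d)) B :
  (forall k, `|complex.Re (trig_poly s k)| <= B) ->
  `|complex.Re (trig_mean s)| <= B.
Proof.
elim: d s => [|d IH] s H.
  by rewrite -torus_mean_trig /=; apply: H.
rewrite -torus_mean_trig /=.
pose t := trig_axis s.
under eq_Rintegral => y _.
  under eq_fun do rewrite trig_poly_slice.
  rewrite torus_mean_trig trig_mean_slice -/t; over.
have tB y : `|trig1 t y| <= B.
  rewrite -trig_mean_slice; apply: IH => k.
  by rewrite -trig_poly_slice.
rewrite normrM gtr0_norm ?invr_gt0 ?twopi_gt0 // ler_pdivrMl ?twopi_gt0 //.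
have ct := continuous_integrable (@continuous_trig1 t).
apply: le_trans (le_normr_Rintegral _ ct) _ => //.
rewrite -(integral_cst_circle B); apply: le_Rintegral => //.
- exact: integrable_norm ct.
- by apply: continuous_integrable => y; apply: cvg_cst.
Qed.

(** Dominated convergence in one coordinate at a time. The inner mean of [g] is measurable as a
    pointwise limit of trigonometric polynomials, a limit supplied by the induction hypothesis; the
    constant [B] dominates them on a set of finite measure. *)
Lemma torus_mean_cvg d (h : nat -> seq (R[i] * 'rV[int]_d)) (g : 'rV[R]_d -> R) (B : R) :
  (forall N k, `|complex.Re (trig_poly (h N) k)| <= B :> R) ->
  (forall k, (fun N => complex.Re (trig_poly (h N) k)) @ \oo --> g k) ->
  (fun N => complex.Re (trig_mean (h N))) @ \oo --> torus_mean g.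
Proof.
elim: d h g => [|d IH] h g hB hg.
  rewrite (_ : (fun N => _) = (fun N => complex.Re (trig_poly (h N) 0))); first exact: hg.
  by apply/funext => N; rewrite -torus_mean_trig.
rewrite (_ : (fun N => _) = (fun N => torus_mean (fun k => complex.Re (trig_poly (h N) k)))); last first.
  by apply/funext => N; rewrite torus_mean_trig.
rewrite /=; apply: cvgM; first exact: cvg_cst.
pose t N := trig_axis (h N).
rewrite (_ : (fun N => _) = (fun N => \int[mu]_(y in circle) trig1 (t N) y)); last first.
  apply/funext => N; apply: eq_Rintegral => y _.
  by under eq_fun do rewrite trig_poly_slice; rewrite torus_mean_trig trig_mean_slice.
have tB N y : `|trig1 (t N) y| <= B.
  rewrite -trig_mean_slice; apply: torus_mean_bound => k.
  by rewrite -trig_poly_slice.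
have tg y : (fun N => trig1 (t N) y) @ \oo -->
    torus_mean (fun k : 'rV_d => g (row_mx (const_mx y : 'rV_1) k)).
  rewrite (_ : (fun N => _) = (fun N => complex.Re (trig_mean (trig_slice (h N) y)))); last first.
    by apply/funext => N; rewrite trig_mean_slice.
  apply: IH => [N k|k]; first by rewrite -trig_poly_slice.
  rewrite (_ : (fun N => _) = (fun N => complex.Re (trig_poly (h N) (row_mx (const_mx y : 'rV_1) k)))).
    exact: hg.
  by apply/funext => N; rewrite trig_poly_slice.
set G := (fun y : R => torus_mean _).
have mt N := measurable_int mu (continuous_integrable (@continuous_trig1 (t N))).
have tgE y : (fun N => (trig1 (t N) y)%:E) @ \oo --> (G y)%:E.
  by apply: cvg_EFin; [exact: nearW|exact: tg].
have mG := measurable_realfun.emeasurable_fun_cvg (fun N => EFin \o trig1 (t N)) (EFin \o G) mt (fun y _ => tgE y).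
have iB : mu.-integrable circle (EFin \o cst B).
  by apply: continuous_integrable => y; apply: cvg_cst.
have [|||iG _] := @dominated_convergence _ _ _ mu circle _ (fun N => EFin \o trig1 (t N))
  (EFin \o G) (EFin \o cst B) mt mG _ iB _.
- exact: measurable_itv.
- by apply: aeW => y _; apply: tgE.
- by apply: aeW => y N _; rewrite /= lee_fin.
move=> H; rewrite /Rintegral.
apply: fine_cvg; rewrite fineK //.
exact: integrable_fin_num.
Qed.

Lemma ctorus_mean_cvg d (h : nat -> seq (R[i] * 'rV[int]_d)) (g : 'rV[R]_d -> R[i]) B :
  (forall N k, normc (trig_poly (h N) k) <= B) ->
  (forall k, cto (fun N => trig_poly (h N) k) (g k)) ->
  cto (fun N => trig_mean (h N)) (ctorus_mean g).
Proof.
move=> hB hg; apply/cto_ReIm; split => /=.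
  apply: (@torus_mean_cvg _ h _ B) => [N k|k]; first by apply: le_trans (le_Re_normc _) (hB N k).
  by have /cto_ReIm[] := hg k.
(* Multiplication by [-i] turns imaginary parts into real parts of another trigonometric
   polynomial. *)
have ImE (z : R[i]) : complex.Im z = complex.Re (- 'i%C * z).
  by case: z => a b /=; ring.
pose h' N := [seq (- 'i%C * x.1, x.2) | x <- h N].
have E1 N k : trig_poly (h' N) k = - 'i%C * trig_poly (h N) k.
  by rewrite /trig_poly big_map mulr_sumr; apply: eq_bigr => x _; rewrite mulrA.
rewrite (_ : (fun N => _) = (fun N => complex.Re (trig_mean (h' N)))); last first.
  apply/funext => N; rewrite ImE /trig_mean big_map mulr_sumr.
  by congr complex.Re; apply: eq_bigr.
apply: (@torus_mean_cvg _ h' _ B) => [N k|k].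
  by rewrite E1 -ImE; apply: le_trans (le_Im_normc _) (hB N k).
rewrite (_ : (fun N => _) = (fun N => complex.Im (trig_poly (h N) k))); last first.
  by apply/funext => N; rewrite E1 -ImE.
by have /cto_ReIm[] := hg k.
Qed.

End TorusMean.

(** * Operator norms and Bloch waves *)

Section OperatorNorm.
Variables (R : realType) (T : choiceType).
Implicit Types (f : T -> R[i]) (B : (T -> R[i]) -> (T -> R[i])).

Definition sq_bounded f (S : R) := forall F : {fset T},
  \sum_(x <- F) normc (f x) ^+ 2 <= S.

Lemma sq_bounded_esum f S :
  (\esum_(x in [set: T]) (normc (f x) ^+ 2)%:E <= S%:E)%E <-> sq_bounded f S.
Proof.
split=> [H F|H].
  rewrite -lee_fin; apply: le_trans H; apply: ereal_sup_ubound.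
  exists [set` F]; first by split=> //; exact: finite_fset.
  rewrite fsbig_finite ?set_fsetK /=; last exact: finite_fset.
  by rewrite sumEFin.
apply: ge_ereal_sup => _ [X [fX _] <-].
by rewrite fsbig_finite //= sumEFin lee_fin.
Qed.

Lemma l2norm_le f rho : 0 <= rho ->
  (l2norm f <= rho%:E)%E <-> sq_bounded f (rho ^+ 2).
Proof.
move=> rho0; rewrite -sq_bounded_esum /l2norm.
set E := (\esum_(x in _) _)%E.
have E0 : (0 <= E)%E by apply: esum_ge0 => x _; rewrite lee_fin sqr_ge0.
have mem (x : \bar R) : (0 <= x)%E -> x \in `[0%E, +oo%E] by rewrite in_itv /= leey andbT.
have E2 : E = ((E `^ 2^-1) `^ 2)%E by rewrite -poweRrM mulVf // poweRe1.
have rho2 : (rho%:E `^ 2)%E = (rho ^+ 2)%:E by rewrite poweR_EFin powR_mulrn.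
have rhoH : ((rho ^+ 2)%:E `^ 2^-1)%E = rho%:E.
  by rewrite poweR_EFin powR12_sqrt ?sqr_ge0 // sqrtr_sqr ger0_norm.
split=> H.
  rewrite E2 -rho2; apply: gt0_ler_poweR => //; apply: mem; first exact: poweR_ge0.
  by rewrite lee_fin.
rewrite -rhoH; apply: gt0_ler_poweR; rewrite ?invr_ge0 //; apply: mem => //.
by rewrite lee_fin sqr_ge0.
Qed.

Lemma opnorm_ge0 B : (0 <= opnorm B)%E.
Proof.
apply: (@le_trans _ _ (l2norm (B (fun=> 0)))); first exact: poweR_ge0.
apply: ereal_sup_ubound; exists (fun=> 0) => //=.
apply/l2norm_le => // F; rewrite big1 ?expr1n ?ler01 // => x _.
by rewrite normc_zero expr0n.
Qed.

(** [f] is rescaled by [1 / sqrt S] into the unit ball over which [opnorm] takes its supremum. *)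
Lemma opnorm_sq_bounded B rho f S : (forall (c : R) g x, B (fun y => c%:C * g y) x = c%:C * B g x) ->
  0 <= rho -> (opnorm B <= rho%:E)%E -> 0 < S -> sq_bounded f S ->
  sq_bounded (B f) (rho ^+ 2 * S).
Proof.
move=> hom rho0 oB S0 fS F.
pose c := (Num.sqrt S)^-1.
have c0 : 0 < c by rewrite invr_gt0 sqrtr_gt0.
have c2 : c ^+ 2 = S^-1 by rewrite exprVn sqr_sqrtr // ltW.
have sc (g : T -> R[i]) : \sum_(x <- F) normc (c%:C * g x) ^+ 2 = S^-1 * \sum_(x <- F) normc (g x) ^+ 2.
  rewrite mulr_sumr; apply: eq_bigr => x _.
  by rewrite normcM normc_real exprMn real_normK ?num_real // c2.
have : sq_bounded (B (fun y => c%:C * f y)) (rho ^+ 2).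
  apply/l2norm_le => //; apply: le_trans oB; apply: ereal_sup_ubound.
  exists (fun y => c%:C * f y) => //=; apply/l2norm_le => // F'.
  rewrite expr1n (_ : \sum_(x <- F') _ = S^-1 * \sum_(x <- F') normc (f x) ^+ 2).
    by rewrite ler_pdivrMl // mulr1.
  rewrite mulr_sumr; apply: eq_bigr => x _.
  by rewrite normcM normc_real exprMn real_normK ?num_real // c2.
move=> /(_ F); under eq_bigr do rewrite hom.
by rewrite sc ler_pdivrMl // mulrC.
Qed.

Lemma opnorm_iter B rho f S n : (forall (c : R) g x, B (fun y => c%:C * g y) x = c%:C * B g x) ->
  0 < rho -> (opnorm B <= rho%:E)%E -> 0 < S -> sq_bounded f S ->
  forall x, normc (iter n B f x) <= rho ^+ n * Num.sqrt S.
Proof.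
move=> hom rho0 oB S0 fS x.
have : sq_bounded (iter n B f) ((rho ^+ 2) ^+ n * S).
  elim: n => [|n IH]; first by rewrite mul1r.
  rewrite iterS exprS -mulrA; apply: opnorm_sq_bounded => //; first exact: ltW.
  by rewrite mulr_gt0 ?exprn_gt0.
move=> /(_ [fset x]%fset); rewrite big_seq_fset1 -exprM mulnC exprM => H.
rewrite -ler_sqr ?nnegrE ?normc_ge0 ?mulr_ge0 ?sqrtr_ge0 ?exprn_ge0 ?(ltW rho0) //.
by rewrite exprMn sqr_sqrtr // ltW.
Qed.

(* The room between the norm and 1/|z| later absorbs a polynomial factor. *)
Lemma opnorm_ratio B (z : R[i]) : z != 0 -> ((normc z)%:E * opnorm B < 1)%E ->
  exists rho : R, [/\ 0 < rho, (opnorm B <= rho%:E)%E & normc z * rho < 1].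
Proof.
move=> z0; have nz : 0 < normc z by rewrite lt_neqAle eq_sym normc_eq0 z0 normc_ge0.
have := opnorm_ge0 B; case: (opnorm B) => [ o | | ] // o0; last by rewrite gt0_muley ?lte_fin.
rewrite lee_fin in o0; rewrite -EFinM lte_fin => zo.
exists ((o + (normc z)^-1) / 2).
have h : o < (normc z)^-1 by rewrite -[X in _ < X]mulr1 -ltr_pdivrMl ?invr_gt0 // invrK.
have iz : 0 < (normc z)^-1 by rewrite invr_gt0.
split; [by lra|by rewrite lee_fin; lra|].
by rewrite -ltr_pdivlMl // mulr1; lra.
Qed.

End OperatorNorm.

(** By Bernoulli's inequality [s = 1 - (1 - q) / (d + 1)] satisfies [q <= s^(d+1)]. Then [d] of the
    factors [s^n] absorb [(n + 1)^d] through [natr_geometric_le], and the last one is the new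
    rate. *)
Lemma poly_geometric_le (R : realType) (q : R) d C : 0 <= q -> q < 1 ->
  exists K r : R, [/\ 0 <= K, 0 <= r, r < 1 &
    forall n, (C * n.+1 ^ d)%N%:R * q ^+ n <= K * r ^+ n].
Proof.
move=> q0 q1; pose x := (1 - q) / d.+1%:R; pose s := 1 - x.
have x0 : 0 <= x by rewrite divr_ge0 ?subr_ge0 // ltW.
have xd : d.+1%:R * x = 1 - q by rewrite /x mulrC divfK.
have x1 : x <= 1.
  rewrite /x ler_pdivrMr ?ltr0n // mul1r; apply: le_trans (_ : 1 <= _); first by lra.
  by rewrite ler1n.
have xp : 0 < x by rewrite divr_gt0 ?subr_gt0.
have s0 : 0 <= s by rewrite subr_ge0.
have s1 : s < 1 by rewrite /s; lra.
have qs : q <= s ^+ d.+1.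
  have aux m : 1 - m%:R * x <= s ^+ m.
    elim: m => [|m IH]; first by rewrite mul0r subr0.
    rewrite exprS; apply: le_trans (ler_wpM2l s0 IH).
    rewrite -natr1 /s -subr_ge0.
    have -> : (1 - x) * (1 - m%:R * x) - (1 - (m%:R + 1) * x) = m%:R * x * x by ring.
    by apply: mulr_ge0 => //; apply: mulr_ge0.
  by apply: le_trans (aux d.+1); rewrite xd; lra.
exists (C%:R * (1 - s)^-1 ^+ d), s; split => //.
  by rewrite mulr_ge0 ?exprn_ge0 // invr_ge0 subr_ge0 ltW.
move=> n; rewrite natrM natrX -!mulrA ler_wpM2l //.
apply: le_trans (_ : n.+1%:R ^+ d * (s ^+ d.+1) ^+ n <= _).
  by rewrite ler_wpM2l ?exprn_ge0 // lerXn2r ?nnegrE ?exprn_ge0.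
rewrite -exprM mulnC exprM exprSr.
rewrite mulrA -exprMn ler_wpM2r ?exprn_ge0 // lerXn2r ?nnegrE ?mulr_ge0 ?exprn_ge0 //.
  by rewrite invr_ge0 subr_ge0 ltW.
exact: natr_geometric_le.
Qed.

(** * Lattice and fiber operators with arbitrary periodic loop weights *)

Section BlochWaves.
Variables (R : realType) (d : nat) (G : periodic_graph R d).
Variables (w : fvertex G -> R) (L : vertex G -> R).
Hypothesis Lw : forall x, L x = w (vclass x).

Definition index_weight (k : 'rV[R]_d) (e : medge G) : R[i] :=
  cis (pairing (medge_index e) k).

Definition loop_extension (e : medge G) : R := if e is inr x then w x else 1.

Definition fiber_weight k e : R[i] := index_weight k e * (loop_extension e)%:C.

Definition fiber_op k (f : fvertex G -> R[i]) (x : fvertex G) : R[i] :=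
  fadjacency k f x + (w x)%:C * f x.

Definition graph_op (f : vertex G -> R[i]) (x : vertex G) : R[i] :=
  adjacency f x + (L x)%:C * f x.

Definition fiber_walk_mx k := walk_mx (@msrc _ _ G) (@mtgt _ _ G) (fiber_weight k).

Lemma pairing0 (k : 'rV[R]_d) : pairing 0 k = 0.
Proof. by rewrite /pairing big1 // => i _; rewrite mxE mul0r. Qed.

Lemma cis0 : cis (0 : R) = 1.
Proof. by rewrite /cis cos0 sin0. Qed.

Lemma fiber_opE k f x :
  fiber_op k f x = \sum_(e | msrc e == x) fiber_weight k e * f (mtgt e).
Proof.
rewrite big_sumType /= /fiber_op /fadjacency; congr (_ + _).
  by apply: eq_bigr => e _; rewrite /fiber_weight mulr1.
rewrite (big_pred1 x) // /fiber_weight /index_weight /= pairing0 cis0 mul1r //.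
Qed.

Lemma fiber_op_walk_mx k f i :
  fiber_op k f (enum_val i) = \sum_j fiber_walk_mx k i j * f (enum_val j).
Proof.
rewrite fiber_opE; under [RHS]eq_bigr do rewrite mxE mulr_suml.
rewrite (exchange_big_dep (fun e => msrc e == enum_val i)) /=; last by move=> j e _ /andP[].
apply: eq_bigr => e se; rewrite se /= (big_pred1 (enum_rank (mtgt e))).
  by rewrite enum_rankK.
by move=> j /=; rewrite -(inj_eq enum_val_inj) enum_rankK eq_sym.
Qed.

Lemma iter_fiber_op k n i j :
  iter n (fiber_op k) (fun y => (y == enum_val j)%:R) (enum_val i) =
  (fiber_walk_mx k ^+ n) i j.
Proof.
elim: n i => [|n IH] i; first by rewrite expr0 mxE /= (inj_eq enum_val_inj).
rewrite iterS fiber_op_walk_mx exprS -mulmxE mxE.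
by apply: eq_bigr => l _; rewrite IH.
Qed.

Lemma fiber_op_hom k (c : R) g x :
  fiber_op k (fun y => c%:C * g y) x = c%:C * fiber_op k g x.
Proof. by rewrite !fiber_opE mulr_sumr; apply: eq_bigr => e _; rewrite mulrCA. Qed.

Lemma delta_sq_bounded (T : finType) (y0 : T) :
  sq_bounded (fun y : T => (y == y0)%:R : R[i]) 1.
Proof.
move=> F; case: (boolP (y0 \in F)) => yF; last first.
  rewrite big_seq big1 ?ler01 // => y yF'; case: eqP => [E|_]; last by rewrite normc_zero expr0n.
  by move: yF; rewrite -E yF'.
rewrite (big_fsetD1 y0) //= eqxx normc1 expr1n big_seq big1 ?addr0 // => y.
by rewrite !inE => /andP[/negPf -> _]; rewrite normc_zero expr0n.
Qed.

(** For [z = 0] the product with an infinite norm is still 0, so the smallness hypothesis carries no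
    information on the operator norm and the bound is obtained directly. *)
Lemma walk_mx_zero_bound (M : 'M[R[i]]_#|fvertex G|) n i j :
  normc (0 : R[i]) ^+ n * normc ((M ^+ n) i j) <= 1 * 0 ^+ n.
Proof.
rewrite normc_zero; case: n => [|n]; last by rewrite exprS !mul0r mul1r.
by rewrite !expr0 !mul1r mxE; case: (_ == _); rewrite ?normc1 ?normc_zero.
Qed.

Lemma fiber_op_bound k (z : R[i]) : ((normc z)%:E * opnorm (fiber_op k) < 1)%E ->
  exists K r, [/\ 0 <= K, 0 <= r, r < 1 & forall n i j,
    normc z ^+ n * normc ((fiber_walk_mx k ^+ n) i j) <= K * r ^+ n].
Proof.
case: (eqVneq z 0) => [->|z0] H.
  by exists 1, 0; split => // n i j; apply: walk_mx_zero_bound.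
have [rho [rho0 oB zr]] := opnorm_ratio z0 H.
exists 1, (normc z * rho); split => //; first by rewrite mulr_ge0 ?normc_ge0 // ltW.
move=> n i j; rewrite mul1r exprMn ler_wpM2l ?exprn_ge0 ?normc_ge0 //.
rewrite -iter_fiber_op.
have := opnorm_iter n (fiber_op_hom k) rho0 oB ltr01 (@delta_sq_bounded _ (enum_val j)) (enum_val i).
by rewrite sqrtr1 mulr1.
Qed.

Lemma vshift0 (x : vertex G) : vshift 0 x = x.
Proof.
by apply: (@position_inj _ _ G); rewrite position_vshift map_mx0 mul0mx addr0.
Qed.

Lemma vshift_fixed a (x : vertex G) : vshift a x = x -> a = 0.
Proof.
move=> E; have := cell_index_vshift a x; rewrite E => /eqP.
by rewrite -subr_eq0 opprD addNKr oppr_eq0 => /eqP.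
Qed.

(** The quotient map is a local isomorphism on outgoing edges. It is injective there because two
    outgoing edges in one orbit differ by a shift fixing [x], and only the zero shift fixes a
    vertex. *)
Lemma out_edges_perm (x : vertex G) :
  perm_eq [seq eclass e | e <- fset_set [set e : edge G | src e = x]]
          [seq e <- index_enum (fedge G) | fsrc e == vclass x].
Proof.
have mem e : reflect (src e = x) (e \in fset_set [set e : edge G | src e = x]).
  by rewrite in_fset_set; [apply: (iffP idP); rewrite in_setE|exact: locally_finite].
apply: uniq_perm; rewrite ?filter_uniq ?index_enum_uniq //.
  rewrite map_inj_in_uniq ?fset_uniq // => e e'.
  move=> /mem se /mem se' /eclassP[a Ea].
  have : vshift a x = x by rewrite -{1}se -src_eshift -Ea.
  by move=> /vshift_fixed a0; rewrite Ea a0 eshift0.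
move=> e; rewrite mem_filter mem_index_enum andbT; apply/mapP/eqP.
  move=> [e0 /mem se ->]; rewrite /fsrc /elift.
  case: cid => e1 /= /eclassP[a Ea]; apply/vclassP; exists a.
  by rewrite -se Ea src_eshift.
rewrite /fsrc => /vclassP[a Ea]; exists (eshift a (elift e)).
  by apply/mem; rewrite src_eshift.
transitivity (eclass (elift e)); first by rewrite /elift; case: cid.
by apply/eclassP; exists a.
Qed.

Lemma sum_out_edges (x : vertex G) (F : fedge G -> R[i]) :
  \sum_(e \in [set e : edge G | src e = x]) F (eclass e) =
  \sum_(e | fsrc e == vclass x) F e.
Proof.
rewrite fsbig_finite /=; last exact: locally_finite.
transitivity (\sum_(e <- [seq eclass e | e <- fset_set [set e : edge G | src e = x]]) F e).
  by rewrite big_map.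
by rewrite (perm_big _ (out_edges_perm x)) big_filter.
Qed.

Definition bloch_wave k (u : fvertex G -> R[i]) (x : vertex G) : R[i] :=
  u (vclass x) * cis (pairing (cell_index x) k).

Lemma pairingD (a b : 'rV[int]_d) (k : 'rV[R]_d) :
  pairing (a + b) k = pairing a k + pairing b k.
Proof.
by rewrite /pairing -big_split /=; apply: eq_bigr => i _; rewrite mxE intrD mulrDl.
Qed.

Lemma elift_eclass (e : edge G) : exists a, e = eshift a (elift (eclass e)).
Proof. by apply/eclassP; rewrite /elift; case: cid. Qed.

(** Along an edge the cell index changes by the edge index, which is exactly the phase of the fiber
    operator. *)
Lemma graph_op_bloch k u x :
  graph_op (bloch_wave k u) x = bloch_wave k (fiber_op k u) x.
Proof.
rewrite /graph_op /bloch_wave /fiber_op mulrDl; congr (_ + _); last by rewrite Lw mulrA.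
rewrite /fadjacency mulr_suml -sum_out_edges /adjacency.
apply: eq_fsbigr => e; rewrite in_setE /= => se.
have [a Ea] := elift_eclass e.
have -> : vclass (tgt e) = ftgt (eclass e).
  by rewrite {1}Ea tgt_eshift /ftgt; apply/esym/vclassP; exists a.
have -> : fedge_index (eclass e) = edge_index e.
  by rewrite [in RHS]Ea edge_index_eshift.
rewrite [cis _ * u _]mulrC -mulrA -cisD -pairingD; congr (_ * cis (pairing _ _)).
by rewrite /edge_index se subrK.
Qed.

Lemma iter_graph_op_bloch k u n x :
  iter n graph_op (bloch_wave k u) x = bloch_wave k (iter n (fiber_op k) u) x.
Proof.
elim: n x => // n IH x; rewrite !iterS -graph_op_bloch.
by congr (graph_op _ x); apply/funext.
Qed.

Definition hop : nat := \max_(e : fedge G) \max_(i < d) absz (fedge_index e 0%R i).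

Definition cube m (x : vertex G) : set (vertex G) :=
  [set y | forall i, (absz (cell_index y 0 i - cell_index x 0 i)%R <= m)%N].

Lemma cube_tgt m (e : edge G) : cube m (tgt e) `<=` cube (hop + m) (src e).
Proof.
move=> y H i; have [a Ea] := elift_eclass e.
have hi : (absz (cell_index (tgt e) 0 i - cell_index (src e) 0 i)%R <= hop)%N.
  have -> : cell_index (tgt e) 0 i - cell_index (src e) 0 i = fedge_index (eclass e) 0 i.
    rewrite /fedge_index -(edge_index_eshift a) -Ea /edge_index !mxE //.
  apply: leq_trans (leq_bigmax_cond (F := fun e => \max_(i < d) absz (fedge_index e 0%R i)) (eclass e) isT).
  exact: (leq_bigmax_cond (F := fun i => absz (fedge_index (eclass e) 0%R i))).
have := H i; move: hi.
move: (cell_index y 0 i) (cell_index (tgt e) 0 i) (cell_index (src e) 0 i) => p q s.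
by lia.
Qed.

(** Each application looks at most [hop] cells further, so values outside the cube never reach [x]
    in [n] steps. *)
Lemma iter_graph_op_local n f g x :
  (forall y, cube (hop * n) x y -> f y = g y) ->
  iter n graph_op f x = iter n graph_op g x.
Proof.
elim: n x => [|n IH] x H; first by apply: H => i; rewrite subrr.
rewrite !iterS /graph_op; congr (_ + _ * _).
  rewrite /adjacency; apply: eq_fsbigr => e; rewrite in_setE /= => se.
  by apply: IH => y Hy; apply: H; rewrite mulnS -se; apply: cube_tgt.
by apply: IH => y Hy; apply: H => i; apply: leq_trans (Hy i) _; rewrite leq_mul2l leqnSn orbT.
Qed.

Lemma cube_card m x (F : {fset vertex G}) : [set` F] `<=` cube m x ->
  (#|` F| <= #|fvertex G| * (2 * m).+1 ^ d)%N.
Proof.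
move=> FC.
(* Class and cell index determine a vertex, since a shift translates the index. Adding [m] moves the
   index differences into the range from 0 to [2 m]. *)
pose pos (y : vertex G) : fvertex G * {ffun 'I_d -> 'I_(2 * m).+1} :=
  (vclass y, [ffun i => inord (absz (cell_index y 0 i - cell_index x 0 i + m%:Z)%R)]).
have inj : {in F &, injective pos}.
  move=> y y' yF y'F [/vclassP[a Ey'] /ffunP E].
  suff a0 : a = 0 by rewrite Ey' a0 vshift0.
  apply/rowP => i; rewrite mxE; have := E i; rewrite !ffunE => /(congr1 (@nat_of_ord _)).
  have e : cell_index y' 0 i = cell_index y 0 i + a 0 i.
    by rewrite Ey' cell_index_vshift mxE.
  have := FC _ yF i; have := FC _ y'F i; rewrite e.
  move: (cell_index y 0 i) (cell_index x 0 i) (a 0 i) => p q b h1 h2.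
  rewrite !inordK; lia.
have u : uniq [seq pos y | y <- F] by rewrite map_inj_in_uniq ?fset_uniq.
have := max_card (mem [seq pos y | y <- F]).
by rewrite (card_uniqP u) size_map card_prod card_ffun !card_ord.
Qed.

Lemma graph_op_hom (c : R) g x : graph_op (fun y => c%:C * g y) x = c%:C * graph_op g x.
Proof.
rewrite /graph_op /adjacency.
rewrite !fsbig_finite; try exact: locally_finite.
rewrite /= mulrDr mulr_sumr.
by congr (_ + _); rewrite mulrCA.
Qed.

(* Cut a Bloch wave off outside the cube seen by n steps: its norm is polynomial in n. *)
Lemma graph_op_bound (z : R[i]) : ((normc z)%:E * opnorm graph_op < 1)%E ->
  exists K r, [/\ 0 <= K, 0 <= r, r < 1 & forall k n i j,
    normc z ^+ n * normc ((fiber_walk_mx k ^+ n) i j) <= K * r ^+ n].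
Proof.
case: (eqVneq z 0) => [->|z0] H.
  by exists 1, 0; split => // k n i j; apply: walk_mx_zero_bound.
have [rho [rho0 oB zr]] := opnorm_ratio z0 H.
have q0 : 0 <= normc z * rho by rewrite mulr_ge0 ?normc_ge0 // ltW.
(* The cube seen by [n] steps has at most [#|fvertex G| (2 hop n + 1)^d] vertices, and
   [2 hop n + 1 <= (2 hop + 1) (n + 1)]. [K] and [r] are fixed before [k], so the bound is uniform
   over the torus. *)
have [K [r [K0 r0 r1 Kr]]] := poly_geometric_le d (#|fvertex G| * (2 * hop).+1 ^ d) q0 zr.
exists K, r; split => // k n i j; apply: le_trans (Kr n).
set C := (_ * _ ^ d)%N.
rewrite exprMn mulrCA ler_wpM2l ?exprn_ge0 ?normc_ge0 //.
have [x Ex] := vclass_surj (enum_val i).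
pose u := fun y : fvertex G => (y == enum_val j)%:R : R[i].
pose f y := if `[< cube (hop * n) x y >] then bloch_wave k u y else 0.
have E : normc ((fiber_walk_mx k ^+ n) i j) = normc (iter n graph_op f x).
  rewrite (_ : iter n graph_op f x = iter n graph_op (bloch_wave k u) x); last first.
    by apply: iter_graph_op_local => y Hy; rewrite /f asboolT.
  by rewrite iter_graph_op_bloch /bloch_wave normcM normc_cis mulr1 Ex iter_fiber_op.
have C1 : (0 < C)%N.
  by rewrite /C !muln_gt0 !expn_gt0 /= !andbT; apply/card_gt0P; exists (enum_val i).
have aux c : ((2 * (hop * n)).+1 ^ c <= ((2 * hop).+1 * n.+1) ^ c)%N.
  by case: c => // c; rewrite leq_exp2r //; nia.
have fS : sq_bounded f C%:R.
  move=> F; pose F1 := [fset y in F | `[< cube (hop * n) x y >]]%fset.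
  have F1C : [set` F1] `<=` cube (hop * n) x.
    by move=> y /=; rewrite !inE => /andP[_ /asboolP].
  apply: le_trans (_ : (#|` F1|)%:R <= _); last first.
    rewrite ler_nat (leq_trans (cube_card F1C)) // /C -mulnA leq_mul2l -expnMn.
    by rewrite aux orbT.
  apply: le_trans (_ : \sum_(y <- F | `[< cube (hop * n) x y >]) 1 <= _).
    rewrite [leRHS]big_mkcond; apply: ler_sum => y _; rewrite /f.
    case: ifP => _; last by rewrite normc_zero expr0n.
    rewrite /bloch_wave normcM normc_cis mulr1 /u; case: (_ == _).
      by rewrite normc1 expr1n.
    by rewrite normc_zero expr0n ler01.
  by rewrite big_fset_condE /= big_const_seq count_predT iter_addr_0.
rewrite E mulrC.
have C0 : 0 < C%:R :> R by rewrite ltr0n.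
apply: le_trans (opnorm_iter n graph_op_hom rho0 oB C0 fS x) _.
rewrite ler_wpM2l ?exprn_ge0 ?(ltW rho0) //.
(* The crude [sqrt C <= C], valid for [C >= 1], keeps the polynomial factor free of square roots. *)
have C0' := ltW C0; rewrite -ler_sqr ?nnegrE ?sqrtr_ge0 // (sqr_sqrtr C0') expr2.
by rewrite ler_peMl // ler1n.
Qed.

End BlochWaves.

(** * Expansions of resolvents, determinants and logarithms *)

Section Expansion.
Variables (R : realType) (d : nat) (G : periodic_graph R d).
Implicit Types (X : set (seq (medge G))) (k : 'rV[R]_d).
Notation nu := (#|fvertex G|).
Notation len := (@class_length R d G).
Notation P := (@prime_classes R d G).
Notation P0 := (@prime_classes0 R d G).

Lemma geo_le (v v' : nat -> R[i]) : geo v' -> (forall n, normc (v n) <= normc (v' n)) -> geo v.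
Proof.
move=> [A [r [A0 r0 r1 H]]] vv; exists A, r; split => // n.
exact: le_trans (vv n) (H n).
Qed.

Lemma eq_abs_sum_to (I : choiceType) (D : set I) (f g : I -> R[i]) s :
  (forall x, D x -> f x = g x) -> abs_sum_to D f s -> abs_sum_to D g s.
Proof.
move=> fg [sf st]; split.
  by rewrite /abs_summable -(eq_esum (a := fun i => (normc (f i))%:E)) // => x Dx; rewrite fg.
move=> e e0; have [F0 F0D H] := st e e0; exists F0 => // F FD F0F.
by rewrite -(eq_big_seq (F1 := f)) ?H // => x /FD; apply: fg.
Qed.

Lemma abs_sum_to_opp (I : choiceType) (D : set I) (f : I -> R[i]) s :
  abs_sum_to D f s -> abs_sum_to D (fun x => - f x) (- s).
Proof.
move=> [sf st]; split.
  rewrite /abs_summable (eq_esum (b := fun i => (normc (f i))%:E)) // => x _.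
  by rewrite normcN.
move=> e e0; have [F0 F0D H] := st e e0; exists F0 => // F FD F0F.
by rewrite sumrN -opprD normcN H.
Qed.

Lemma prime_lengths D : D `<=` P ->
  (forall X, D X -> (0 < len X)%N) /\ (forall n, finite_set [set X | D X /\ (len X <= n)%N]).
Proof.
move=> DP; split=> [X /DP|n]; first exact: class_length_gt0.
by apply: sub_finite_set (prime_classes_bounded_finite G n) => X [/DP].
Qed.

Lemma sub_prime0 : P0 `<=` P. Proof. by move=> X []. Qed.

Section Coefficients.
Variables (D : set (set (seq (medge G)))) (u : set (seq (medge G)) -> R[i]).
Hypothesis DP : D `<=` P.

Lemma resolvent_coefE n : resolvent_coef D u n = - class_power_sum len D u n.
Proof.
rewrite /resolvent_coef fsbig_finite //.
by have [lg fin] := prime_lengths DP; exact: (dvd_set_finite fin n).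
Qed.

Lemma log_product_coefE n : log_product_coef D u n = - (class_power_sum len D u n / n%:R).
Proof.
have [lg fin] := prime_lengths DP.
rewrite /log_product_coef fsbig_finite; last exact: (dvd_set_finite fin n).
congr (- _); rewrite /class_power_sum mulr_suml; apply: eq_big_seq => X.
move=> /(mem_dvd_set fin)[DX n0 Xn]; have lX := lg X DX.
have nl : (0 < n %/ len X)%N by rewrite divn_gt0 // dvdn_leq.
have E : n%:R = (n %/ len X)%:R * (len X)%:R :> R[i] by rewrite -natrM divnK.
rewrite E; move: (u X ^+ _) => y; field.
by rewrite !pnatr_eq0 -!lt0n lX nl.
Qed.

Lemma product_coef_newton :
  product_coef D u 0 = 1 /\ forall n, product_coef D u n *+ n =
    - \sum_(1 <= j < n.+1) class_power_sum len D u j * product_coef D u (n - j)%N.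
Proof.
have [lg fin] := prime_lengths DP; apply: (product_newton lg fin) => n.
by rewrite /product_coef fsbig_finite.
Qed.

Lemma power_series_geo (a : nat -> R[i]) z s : geo (fun n => a n * z ^+ n) ->
  cto (psum (fun n => a n * z ^+ n)) s -> power_series_to a z s.
Proof. exact: geo_abs_sum_to. Qed.

Lemma newton_scale (p c : nat -> R[i]) z :
  (forall n, c n *+ n = - \sum_(1 <= j < n.+1) p j * c (n - j)%N) ->
  forall n, (c n * z ^+ n) *+ n =
    - \sum_(1 <= j < n.+1) (p j * z ^+ j) * (c (n - j)%N * z ^+ (n - j)).
Proof.
move=> rec n; rewrite -mulrnAl rec mulNr mulr_suml; congr (- _).
apply: eq_big_nat => j /andP[_ jn].
have -> : z ^+ n = z ^+ j * z ^+ (n - j) by rewrite -exprD subnKC.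
by rewrite mulrACA.
Qed.

Lemma geo_log (p : nat -> R[i]) : geo p -> geo (fun n => - (p n / n%:R)).
Proof.
move=> gp; apply: geo_le gp _ => n; rewrite normcN normcM normcV normc_natr.
case: n => [|n]; first by rewrite invr0 mulr0 normc_ge0.
by rewrite ler_piMr ?normc_ge0 // invf_le1 ?ltr0n // ler1n.
Qed.

Section Series.
Variables (z : R[i]).
Hypothesis geo_p : geo (fun n => class_power_sum len D u n * z ^+ n).

Lemma log_series s :
  cto (psum (fun n => - (class_power_sum len D u n * z ^+ n / n%:R))) s ->
  power_series_to (log_product_coef D u) z s /\
  power_series_to (product_coef D u) z (cexp s).
Proof.
move=> ps; have [c0 rec] := product_coef_newton; split.
  have E : (fun n => log_product_coef D u n * z ^+ n) =
      (fun n => - (class_power_sum len D u n * z ^+ n / n%:R)).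
    by apply/funext => n; rewrite log_product_coefE mulNr mulrAC.
  by apply: power_series_geo; rewrite E //; apply: geo_log.
have rec' := newton_scale z rec.
apply: power_series_geo; first exact: newton_geo rec' geo_p.
by apply: newton_exp rec' geo_p ps; rewrite c0 mulr1.
Qed.

(** At order 0 the trace is [nu] while the power sum over classes is 0; splitting off this term
    turns the Neumann series of the trace into the series over classes. *)
Lemma resolvent_series (T : nat -> R[i]) lam tau : lam != 0 -> z = lam^-1 ->
  T 0%N = nu%:R -> (forall n, (0 < n)%N -> T n = class_power_sum len D u n) ->
  cto (psum (fun n => T n * z ^+ n)) (- lam * tau) ->
  exists s, [/\ power_series_to (resolvent_coef D u) z s,
     cto (psum (fun n => class_power_sum len D u n * z ^+ n)) (- s) &
     tau = - (nu%:R / lam) + lam^-1 * s].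
Proof.
move=> lam0 zl T0 TE Tt; have [lg fin] := prime_lengths DP.
have H : cto (psum (fun n => class_power_sum len D u n * z ^+ n)) (- (nu%:R + lam * tau)).
  have H1 := ctoB Tt (cto_cst nu%:R).
  apply/ctoP => e e0; have /ctoP/(_ _ e0)[N HN] := H1.
  exists N.+1 => -[//|n] Nn; have := HN n.+1 (ltnW Nn).
  rewrite /psum !big_nat_recl // T0 expr0 !mulr1 class_power_sum0 add0r.
  rewrite (_ : - lam * tau - nu%:R = - (nu%:R + lam * tau)); last by ring.
  rewrite [nu%:R + _ - nu%:R]addrAC subrr add0r.
  by under eq_bigr do rewrite TE //.
exists (nu%:R + lam * tau); split => //; last by field.
have E : (fun n => resolvent_coef D u n * z ^+ n) =
    (fun n => - (class_power_sum len D u n * z ^+ n)).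
  by apply/funext => n; rewrite resolvent_coefE mulNr.
apply: power_series_geo; rewrite E.
  by apply: geo_le geo_p _ => n; rewrite normcN.
rewrite -[nu%:R + _]opprK; apply: eq_cto (ctoN H) => N.
by rewrite /psum sumrN.
Qed.

End Series.
End Coefficients.

(** * Neumann and logarithmic series of a matrix *)

Section Matrices.
Variable n : nat.
Implicit Types M : 'M[R[i]]_n.

Lemma exprZmx (a : R[i]) M m : (a *: M) ^+ m = a ^+ m *: M ^+ m.
Proof.
elim: m => [|m IH]; first by rewrite !expr0 scale1r.
by rewrite !exprS IH -!mulmxE -scalemxAl -scalemxAr scalerA.
Qed.

Variables (M : 'M[R[i]]_n) (z : R[i]) (K r : R).
Hypotheses (K0 : 0 <= K) (r0 : 0 <= r) (r1 : r < 1).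
Hypothesis bound : forall m i j, normc z ^+ m * normc ((M ^+ m) i j) <= K * r ^+ m.

Lemma trace_bound m : normc (\tr (M ^+ m) * z ^+ m) <= n%:R * K * r ^+ m.
Proof.
rewrite /mxtrace normcM normcX mulrC.
apply: le_trans (_ : normc z ^+ m * \sum_i normc ((M ^+ m) i i) <= _).
  by rewrite ler_wpM2l ?exprn_ge0 ?normc_ge0 // le_normc_sum.
rewrite mulr_sumr; apply: le_trans (ler_sum _ (fun i _ => bound m i i)) _.
by rewrite sumr_const card_ord -mulrA mulr_natl.
Qed.

Lemma geo_trace : geo (fun m => \tr (M ^+ m) * z ^+ m).
Proof.
by exists (n%:R * K), r; split => //; [rewrite mulr_ge0|exact: trace_bound].
Qed.

(** If [v M = lam v], then [v = z^N v M^N] for every [N], and the right side tends to 0. *)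
Lemma resolvent_unit lam : lam != 0 -> z = lam^-1 -> M - lam%:M \in unitmx.
Proof.
move=> lam0 zl; rewrite unitmxE unitfE; apply/negP => /det0P[v v0].
rewrite mulmxBr => /eqP; rewrite subr_eq0 => /eqP; rewrite mul_mx_scalar => vM.
have vMm m : v *m (M ^+ m) = lam ^+ m *: v.
  elim: m => [|m IH]; first by rewrite !expr0 mulmx1 scale1r.
  by rewrite exprSr -mulmxE mulmxA IH -scalemxAl vM scalerA -exprSr.
case/negP: v0; apply/eqP/rowP => j; rewrite mxE; apply/eqP.
rewrite -normc_eq0; apply/eqP/le_anti; rewrite normc_ge0 andbT.
have H : (fun m => (\sum_i normc (v 0 i)) * K * r ^+ m) @ \oo --> (0 : R).
  by apply: cvg_geometric; rewrite ger0_norm.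
apply/ler_addgt0Pr => e e0; rewrite add0r.
have /cvgrPdist_lt/(_ _ e0)[N _ HN] := H.
apply/ltW; apply: le_lt_trans (HN N (leqnn N)).
rewrite sub0r normrN ger0_norm; last first.
  by rewrite !mulr_ge0 ?exprn_ge0 // sumr_ge0 // => i _; exact: normc_ge0.
have zlam : z ^+ N * lam ^+ N = 1 by rewrite -exprMn zl mulVf // expr1n.
have -> : normc (v 0 j) = normc (z ^+ N * (v *m (M ^+ N)) 0 j).
  by rewrite vMm mxE mulrA zlam mul1r.
rewrite mxE mulr_sumr -mulrA mulr_suml.
apply: le_trans (le_normc_sum _ _ _) _; apply: ler_sum => i _.
by rewrite mulrCA normcM ler_wpM2l ?normc_ge0 // normcM normcX.
Qed.

Lemma trace_resolvent lam : lam != 0 -> z = lam^-1 ->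
  cto (psum (fun m => \tr (M ^+ m) * z ^+ m)) (- lam * \tr (invmx (M - lam%:M))).
Proof.
move=> lam0 zl; have U := resolvent_unit lam0 zl.
set W := invmx _.
pose S N := \sum_(0 <= m < N) z ^+ m *: M ^+ m.
(* Telescoping gives [S N (M - lam) = - lam + lam z^N M^N], so only the last term, times the
   inverse, has to be estimated. *)
have SE N : S N = - lam *: W + lam *: (z ^+ N *: (M ^+ N *m W)).
  have : S N *m (M - lam%:M) = - lam *: 1%:M + (lam * z ^+ N) *: M ^+ N.
    elim: N => [|N IH].
      by rewrite /S big_geq // mul0mx expr0 mulr1 expr0 scaleNr addNr.
    rewrite /S big_nat_recr //= mulmxDl IH mulmxBr mul_mx_scalar -!scalemxAl.
    rewrite [M ^+ N.+1]exprSr -mulmxE scalerA [z ^+ N.+1]exprSr.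
    rewrite (_ : lam * (z ^+ N * z) = z ^+ N); last by rewrite zl; field.
    by rewrite [lam * z ^+ N]mulrC -addrA [_ + (_ - _)]addrC subrK.
  move/(congr1 (fun A => A *m W)); rewrite mulmxK // => ->.
  by rewrite mulmxDl -!scalemxAl mul1mx scalerA.
have trS N : psum (fun m => \tr (M ^+ m) * z ^+ m) N = \tr (S N).
  rewrite /S raddf_sum; apply: eq_bigr => m _.
  by rewrite /= mxtraceZ mulrC.
pose B := n%:R * K * \sum_i \sum_j normc (W j i).
apply: (@cto_le _ _ _ (fun N => normc lam * B * r ^+ N)).
  by apply: cvg_geometric; rewrite ger0_norm.
move=> N; rewrite trS SE mxtraceD !mxtraceZ.
rewrite addrAC subrr add0r normcM -mulrA ler_wpM2l ?normc_ge0 //.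
rewrite /mxtrace normcM normcX.
apply: le_trans (_ : normc z ^+ N * \sum_i \sum_j normc ((M ^+ N) i j) * normc (W j i) <= _).
  rewrite ler_wpM2l ?exprn_ge0 ?normc_ge0 //.
  apply: le_trans (le_normc_sum _ _ _) _; apply: ler_sum => i _.
  rewrite mxE; apply: le_trans (le_normc_sum _ _ _) _; apply: ler_sum => j _.
  by rewrite normcM.
rewrite mulr_sumr; apply: le_trans (_ : \sum_i \sum_j K * r ^+ N * normc (W j i) <= _).
  apply: ler_sum => i _; rewrite mulr_sumr; apply: ler_sum => j _.
  by rewrite mulrA ler_wpM2r ?normc_ge0.
under eq_bigr do rewrite -mulr_sumr.
rewrite -mulr_sumr /B -!mulrA [r ^+ N * _]mulrC.
set Z := _ * r ^+ N.
have Z0 : 0 <= K * Z.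
  rewrite /Z !mulr_ge0 ?exprn_ge0 // sumr_ge0 // => i _.
  by rewrite sumr_ge0 // => j _; exact: normc_ge0.
(* The spare factor [n] in [B] is at least 1, unless the matrix is empty and all sums vanish. *)
case: (posnP n) => [n00|n0].
  rewrite n00 mul0r /Z big1 ?mul0r ?mulr0 // => -[i ii] _; exfalso; by rewrite n00 in ii.
by rewrite ler_peMl // ler1n.
Qed.

Lemma trace_log : cto (psum (fun m => - (\tr (M ^+ m) * z ^+ m / m%:R)))
  (\tr (mxlog1B (z *: M))).
Proof.
have H i : cto (psum (fun m => - ((M ^+ m) i i * z ^+ m / m%:R))) (mxlog1B (z *: M) i i).
  have g : geo (fun m => (M ^+ m) i i * z ^+ m).
    exists K, r; split => // m; rewrite normcM normcX mulrC; exact: bound.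
  have [s ss] := geo_cvg (geo_log g).
  suff -> : mxlog1B (z *: M) i i = s by [].
  rewrite mxE; apply: cto_clim; apply: eq_cto ss => N.
  rewrite /psum -sumrN; case: N => [|N]; first by rewrite !big_geq.
  rewrite big_nat_recl // invr0 mulr0 oppr0 add0r big_add1 /=.
  by apply: eq_bigr => m _; rewrite exprZmx mxE [z ^+ _ * _]mulrC.
rewrite /mxtrace; apply: eq_cto (cto_sum _ _ H) => N.
rewrite /psum exchange_big /=; apply: eq_bigr => m _.
by rewrite sumrN; congr (- _); rewrite !mulr_suml.
Qed.

End Matrices.

(** The coefficients of the determinant as a polynomial in [t] and those of the product obey the
    same recursion, so they agree and the series terminates. *)
Lemma det1B_series D (u : set (seq (medge G)) -> R[i]) n (M : 'M[R[i]]_n) t :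
  D `<=` P -> (forall m, (0 < m)%N -> class_power_sum len D u m = \tr (M ^+ m)) ->
  power_series_to (product_coef D u) t (\det (1%:M - t *: M)).
Proof.
move=> DP pE; have [Q [detQ Q0 Qrec]] := det1B_newton M.
have [c0 rec] := product_coef_newton u DP.
have cQ : product_coef D u =1 (fun m => Q`_m).
  apply: (recursion_uniq (p := fun m => class_power_sum len D u m)) => //.
    by rewrite c0 Q0.
  move=> m; rewrite Qrec; congr (- _); apply: eq_big_nat => j /andP[j0 _].
  by rewrite pE.
(* A finitely supported sequence fits any rate; [1/2] is taken, and [A] collects the rescaled
   coefficients. *)
pose A := \sum_(0 <= m < size Q) normc (Q`_m * t ^+ m) * 2 ^+ m.
have term0 m : 0 <= normc (Q`_m * t ^+ m) * 2 ^+ m :> R.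
  by rewrite mulr_ge0 ?normc_ge0 ?exprn_ge0.
apply: power_series_geo.
  exists A, 2^-1; split; [by apply: sumr_ge0|by []|by lra|].
  move=> m; rewrite cQ; case: (ltnP m (size Q)) => mQ; last first.
    rewrite nth_default // mul0r normc_zero mulr_ge0 ?exprn_ge0 //.
    exact: sumr_ge0.
  rewrite exprVn ler_pdivlMr ?exprn_gt0 // /A.
  rewrite (bigD1_seq m) ?iota_uniq ?mem_index_iota //= lerDl.
  exact: sumr_ge0.
apply/ctoP => e e0; exists (size Q) => N QN.
rewrite detQ horner_coef (_ : psum _ N = \sum_(i < size Q) Q`_i * t ^+ i).
  by rewrite subrr normc_zero.
rewrite /psum (big_cat_nat (n := size Q)) //= [X in _ + X]big_nat [X in _ + X]big1.
  by rewrite addr0 big_mkord; apply: eq_bigr => i _; rewrite cQ.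
by move=> m /andP[Qm _]; rewrite cQ nth_default // mul0r.
Qed.

(** Each partial sum is again a trigonometric polynomial, with [a n] absorbed in its coefficients,
    so its mean is algebraic and [ctorus_mean_cvg] passes to the limit. *)
Lemma mean_series (T : nat -> seq (R[i] * 'rV[int]_d)) (a : nat -> R[i])
    (g : 'rV[R]_d -> R[i]) (K r : R) : 0 <= K -> 0 <= r -> r < 1 ->
  (forall k n, normc (a n * trig_poly (T n) k) <= K * r ^+ n) ->
  (forall k, cto (psum (fun n => a n * trig_poly (T n) k)) (g k)) ->
  cto (psum (fun n => a n * trig_mean (T n))) (ctorus_mean g).
Proof.
move=> K0 r0 r1 H Hg.
pose h N := flatten [seq [seq (a n * x.1, x.2) | x : R[i] * 'rV[int]_d <- T n] | n <- iota 0 N].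
have hE N k : trig_poly (h N) k = psum (fun n => a n * trig_poly (T n) k) N.
  rewrite /trig_poly /h big_flatten big_map /psum /index_iota subn0.
  by apply: eq_bigr => n _; rewrite big_map mulr_sumr; apply: eq_bigr => x _; rewrite mulrA.
have hM N : trig_mean (h N) = psum (fun n => a n * trig_mean (T n)) N.
  rewrite /trig_mean /h big_flatten big_map /psum /index_iota subn0.
  by apply: eq_bigr => n _; rewrite big_map mulr_sumr.
apply: eq_cto hM _; apply: (@ctorus_mean_cvg _ _ h _ (K / (1 - r))) => [N k|k].
  rewrite hE; apply: le_trans (le_normc_sum _ _ _) _.
  apply: le_trans (ler_sum _ (fun n _ => H k n)) _.
  by apply: le_trans (sum_geometric_le _ _ K0 r0 r1) _; rewrite expr0 mulr1.
by apply: eq_cto (Hg k) => N; rewrite hE.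
Qed.

End Expansion.

(** * Traces of fiber powers as sums over classes *)

Section WeightedTraces.
Variables (R : realType) (d : nat) (G : periodic_graph R d) (w : fvertex G -> R).
Implicit Types (X : set (seq (medge G))) (k : 'rV[R]_d).
Notation nu := (#|fvertex G|).
Notation len := (@class_length R d G).
Notation P := (@prime_classes R d G).
Notation P0 := (@prime_classes0 R d G).
Notation ext := (loop_extension w).

Definition path_index (c : seq (medge G)) : 'rV[int]_d := \sum_(e <- c) medge_index e.

Definition path_weight (c : seq (medge G)) : R := \prod_(e <- c) ext e.

Definition class_loop_weight X : R[i] := (path_weight (class_repr X))%:C.

Lemma pairing_opp (a : 'rV[int]_d) k : pairing a (- k) = - pairing a k.
Proof. by rewrite /pairing -sumrN; apply: eq_bigr => i _; rewrite mxE mulrN. Qed.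

Lemma pairing_oppl (a : 'rV[int]_d) k : pairing (- a) k = - pairing a k.
Proof. by rewrite /pairing -sumrN; apply: eq_bigr => i _; rewrite mxE mulrNz mulNr. Qed.

Lemma prod_fiber_weight k c :
  \prod_(e <- c) fiber_weight w k e = cis (pairing (path_index c) k) * (path_weight c)%:C.
Proof.
rewrite /path_index /path_weight; elim: c => [|e c IH].
  by rewrite !big_nil pairing0 cis0 mul1r.
rewrite !big_cons IH pairingD cisD rmorphM /fiber_weight /index_weight /=.
by rewrite mulrACA.
Qed.

Lemma path_index_rot j c : path_index (rot j c) = path_index c.
Proof. by apply: perm_big; rewrite perm_rot. Qed.

Lemma path_index_wpow m c : path_index (wpow m c) = path_index c *+ m.
Proof.
elim: m => [|m IH]; first by rewrite /path_index big_nil.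
by rewrite wpowS /path_index big_cat /= -!/(path_index _) IH mulrS.
Qed.

(** Integer vectors have no torsion; hence index 0 is a condition on the primitive root. *)
Lemma path_index_wpow_eq0 m c : (0 < m)%N ->
  (path_index (wpow m c) == 0) = (path_index c == 0).
Proof.
case: m => // m _; rewrite path_index_wpow; apply/eqP/eqP => [|->]; last by rewrite mul0rn.
move=> /rowP E; apply/rowP => i; have := E i; rewrite mulmxnE !mxE => /eqP.
by rewrite mulrn_eq0 => /eqP.
Qed.

Definition frev (e : fedge G) : fedge G := eclass (reversal (elift e)).

Lemma fsrc_eclass (e : edge G) : fsrc (eclass e) = vclass (src e).
Proof.
have [a E] := elift_eclass e; rewrite [in RHS]E src_eshift /fsrc.
by apply/vclassP; exists a.
Qed.

Lemma ftgt_eclass (e : edge G) : ftgt (eclass e) = vclass (tgt e).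
Proof.
have [a E] := elift_eclass e; rewrite [in RHS]E tgt_eshift /ftgt.
by apply/vclassP; exists a.
Qed.

Lemma fedge_index_eclass (e : edge G) : fedge_index (eclass e) = edge_index e.
Proof. by have [a E] := elift_eclass e; rewrite [in RHS]E edge_index_eshift. Qed.

Lemma tgt_reversal (e : edge G) : tgt (reversal e) = src e.
Proof. by rewrite -src_reversal reversalK. Qed.

(** The chosen lift of a reversed class need not be the reversal of the chosen lift, but the two
    differ by a shift, which commutes with reversal. *)
Lemma frevK : involutive frev.
Proof.
move=> e; rewrite /frev.
have [a E] := elift_eclass (reversal (elift e)).
transitivity (eclass (elift e)); last by rewrite /elift; case: cid.
apply/eclassP; exists a.
by rewrite -reversal_eshift -E reversalK.
Qed.

Definition mrev (e : medge G) : medge G :=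
  match e with inl e => inl (frev e) | inr x => inr x end.

Lemma mrevK : involutive mrev.
Proof. by case=> [e|x] //=; rewrite frevK. Qed.

Lemma fiber_weight_mrev k e : fiber_weight w (- k) (mrev e) = fiber_weight w k e.
Proof.
rewrite /fiber_weight /index_weight pairing_opp; case: e => [e|x] /=; last by rewrite pairing0 oppr0.
rewrite /frev fedge_index_eclass /edge_index src_reversal tgt_reversal -opprB.
by rewrite pairing_oppl opprK.
Qed.

Lemma msrc_mrev e : msrc (mrev e) = mtgt e.
Proof. by case: e => //= e; rewrite /frev fsrc_eclass src_reversal. Qed.

Lemma mtgt_mrev e : mtgt (mrev e) = msrc e.
Proof. by case: e => //= e; rewrite /frev ftgt_eclass tgt_reversal. Qed.

(* Reversing all edges turns the phases of the index into their conjugates. *)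
Lemma fiber_walk_mx_opp k : fiber_walk_mx w (- k) = (fiber_walk_mx w k)^T.
Proof.
apply/matrixP => i j; rewrite !mxE (reindex_inj (inv_inj mrevK)) /=.
apply: eq_big => e; first by rewrite msrc_mrev mtgt_mrev andbC.
by move=> _; rewrite fiber_weight_mrev.
Qed.

Lemma trmx_exp (K : comPzRingType) n (M : 'M[K]_n) m : M^T ^+ m = (M ^+ m)^T.
Proof.
elim: m => [|m IH]; first by rewrite !expr0 [RHS]trmx1.
by rewrite exprS exprSr IH -!mulmxE trmx_mul.
Qed.

Lemma trace_exp_opp k n : \tr (fiber_walk_mx w (- k) ^+ n) = \tr (fiber_walk_mx w k ^+ n).
Proof. by rewrite fiber_walk_mx_opp trmx_exp mxtrace_tr. Qed.

Lemma class_power_sum_prime (a : medge G -> R[i]) n : (0 < n)%N ->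
  class_power_sum len P (fun X => \prod_(e <- class_repr X) a e) n =
  \tr (walk_mx (@msrc _ _ G) (@mtgt _ _ G) a ^+ n).
Proof.
move=> n0; rewrite trace_walk_mx_exp //.
have H := @sum_cycles_classes R d G predT P (fun _ _ => erefl) (fun _ _ _ => erefl).
rewrite -[LHS](H _ _ a n n0); last by move=> X; split=> [//|[]].
by apply: eq_bigl => c; rewrite andbT.
Qed.

(** The phases of the twisted weights are those of closed walks at [- k]; [trace_exp_opp] brings the
    trace back to [k]. *)
Lemma class_power_sum_twisted k n : (0 < n)%N ->
  class_power_sum len P (fun X => cis (- pairing (class_index X) k) * class_loop_weight X) n =
  \tr (fiber_walk_mx w k ^+ n).
Proof.
move=> n0; rewrite -trace_exp_opp -class_power_sum_prime //.
congr (class_power_sum _ _ _ n); apply/funext => X.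
by rewrite prod_fiber_weight pairing_opp.
Qed.

Definition trace_trig n : seq (R[i] * 'rV[int]_d) :=
  if n is 0%N then [:: (nu%:R, 0)]
  else [seq ((path_weight c)%:C, path_index c) | c <- words (medge G) n & is_cycle c].

Lemma trig_poly_trace n k : trig_poly (trace_trig n) k = \tr (fiber_walk_mx w k ^+ n).
Proof.
case: n => [|n]; rewrite /trig_poly.
  by rewrite big_seq1 /= pairing0 cis0 mulr1 expr0 [RHS]mxtrace1.
rewrite trace_walk_mx_exp // big_map big_filter; apply: eq_bigr => c _.
by rewrite prod_fiber_weight mulrC.
Qed.

Lemma trig_mean_trace n : (0 < n)%N ->
  trig_mean (trace_trig n) = class_power_sum len P0 class_loop_weight n.
Proof.
case: n => // n n0.
have H := @sum_cycles_classes R d G (fun c => path_index c == 0) P0.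
have E c : (path_weight c)%:C = \prod_(e <- c) (ext e)%:C.
  by rewrite /path_weight rmorph_prod.
transitivity (\sum_(c <- words (medge G) n.+1 | is_cycle c && (path_index c == 0))
  \prod_(e <- c) (ext e)%:C).
  rewrite /trig_mean /trace_trig big_map big_filter_cond.
  by apply: eq_bigr => c _; exact: E.
rewrite H //.
- by apply: eq_bigr => X _; rewrite /class_loop_weight E.
- by move=> j c; rewrite path_index_rot.
- by move=> m c m0; rewrite path_index_wpow_eq0.
- by move=> X; split=> [[PX E0]|[PX /eqP E0]]; split => //; apply/eqP.
Qed.

Lemma trig_mean_trace0 : trig_mean (trace_trig 0) = nu%:R.
Proof. by rewrite /trig_mean big_cons big_nil eqxx addr0. Qed.

End WeightedTraces.

(** * Domination by the fiber at zero with absolute loop weights *)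

Section AbsoluteBounds.
Variables (R : realType) (d : nat) (G : periodic_graph R d) (w : fvertex G -> R).
Notation len := (@class_length R d G).
Notation P := (@prime_classes R d G).
Notation nu := (#|fvertex G|).

Let aw (x : fvertex G) : R := `|w x|.

Lemma fiber_weight_abs e : fiber_weight aw 0 e = `|loop_extension w e|%:C.
Proof.
rewrite /fiber_weight /index_weight (_ : pairing _ 0 = 0) ?cis0 ?mul1r.
  by case: e => //= e; rewrite normr1.
by rewrite /pairing big1 // => i _; rewrite mxE mulr0.
Qed.

Lemma normc_fiber_weight k e : normc (fiber_weight w k e) = `|loop_extension w e|.
Proof. by rewrite /fiber_weight normcM normc_cis mul1r normc_real. Qed.

(** At [k = 0] with absolute loop weights the walk sum has no cancellation, so it dominates the walk
    sum at every [k] term by term. *)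
Lemma fiber_walk_mx_abs k n i j :
  normc ((fiber_walk_mx w k ^+ n) i j) <= normc ((fiber_walk_mx aw 0 ^+ n) i j).
Proof.
rewrite !walk_mx_exp; apply: le_trans (le_normc_sum _ _ _) _.
rewrite [X in _ <= normc X](eq_bigr (fun c : seq (medge G) =>
  (\prod_(e <- c) `|loop_extension w e|)%:C)); last first.
  by move=> c _; rewrite rmorph_prod; apply: eq_bigr => e _; rewrite fiber_weight_abs.
rewrite -rmorph_sum normc_real; apply: le_trans (ler_norm _).
apply: ler_sum => c _; rewrite normc_prod.
by under eq_bigr do rewrite normc_fiber_weight.
Qed.

(** For nonnegative weights the sum over all prime classes is itself a trace, without loss, and the
    subfamily [D] contributes no more than [P]. *)
Lemma abs_class_bound D (u : set (seq (medge G)) -> R[i]) (z : R[i]) K r :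
  D `<=` P -> (forall X, normc (u X) = `|path_weight w (class_repr X)|) ->
  0 <= K -> (forall n i j,
    normc z ^+ n * normc ((fiber_walk_mx aw 0 ^+ n) i j) <= K * r ^+ n) ->
  forall n, (0 < n)%N ->
  \sum_(X <- fset_set (dvd_set len D n))
    (len X)%:R * normc (u X) ^+ (n %/ len X) * normc z ^+ n <= nu%:R * K * r ^+ n.
Proof.
move=> DP uE K0 H n n0.
have [lg fin] := prime_lengths (@subset_refl _ P).
have [lgD finD] := prime_lengths DP.
have normu X : normc (u X) = \prod_(e <- class_repr X) `|loop_extension w e|.
  by rewrite uE /path_weight normr_prod.
apply: le_trans (_ : \sum_(X <- fset_set (dvd_set len P n))
    (len X)%:R * normc (u X) ^+ (n %/ len X) * normc z ^+ n <= _).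
  have sub X : X \in fset_set (dvd_set len D n) -> X \in fset_set (dvd_set len P n).
    move=> /(mem_dvd_set finD)[DX _ Xn]; apply/(mem_dvd_set fin).
    by split => //; apply: DP.
  apply: le_trans (_ : \sum_(X <- fset_set (dvd_set len D n) | X \in fset_set (dvd_set len P n))
    (len X)%:R * normc (u X) ^+ (n %/ len X) * normc z ^+ n <= _).
    rewrite [leRHS]big_mkcond big_seq [leRHS]big_seq.
    by apply: ler_sum => X /sub ->.
  apply: sum_mem_le; rewrite ?fset_uniq // => X.
  by rewrite !mulr_ge0 ?exprn_ge0 ?normc_ge0.
rewrite -mulr_suml.
have tr := class_power_sum_prime (fiber_weight aw 0) n0.
have -> : \sum_(X <- fset_set (dvd_set len P n)) (len X)%:R * normc (u X) ^+ (n %/ len X) =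
    normc (\tr (fiber_walk_mx aw 0 ^+ n)).
  rewrite -tr /class_power_sum.
  rewrite [in RHS](eq_bigr (fun X => ((len X)%:R * normc (u X) ^+ (n %/ len X))%:C)); last first.
    move=> X _; rewrite rmorphM rmorphXn rmorph_nat normu rmorph_prod.
    congr (_ * _ ^+ _); apply: eq_bigr => e _; exact: fiber_weight_abs.
  rewrite -rmorph_sum normc_real ger0_norm //.
  by apply: sumr_ge0 => X _; rewrite mulr_ge0 ?exprn_ge0 ?normc_ge0.
have := trace_bound H n; rewrite normcM normcX.
exact.
Qed.

End AbsoluteBounds.

Section Potential.
Variables (R : realType) (d : nat) (G : periodic_graph R d).
Variables (V : vertex G -> R) (V_periodic : periodic_potential V).

Lemma degree_vclass (x y : vertex G) : vclass x = vclass y -> degree x = degree y.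
Proof.
move=> E; have H (v : vertex G) : degree v = size [seq e <- index_enum (fedge G) | fsrc e == vclass v].
  by rewrite -(perm_size (out_edges_perm v)) size_map.
by rewrite !H E.
Qed.

(** [floop_weight] is read on a chosen lift; periodicity of [V] and equality of degrees along an
    orbit make the choice immaterial. *)
Lemma loop_weight_vclass x : loop_weight V x = floop_weight V (vclass x).
Proof.
rewrite /floop_weight /loop_weight.
have E : vclass (vlift (vclass x)) = vclass x by rewrite /vlift; case: cid.
rewrite (degree_vclass E); congr (_ - _).
by move/vclassP: E => [a {1}->]; rewrite V_periodic.
Qed.

Lemma medge_weightE e : medge_weight V e = loop_extension (floop_weight V) e.
Proof. by case: e. Qed.

Lemma class_weightE : class_weight V = class_loop_weight (floop_weight V).
Proof.
apply/funext => X; rewrite /class_weight /class_loop_weight /path_weight.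
by congr (_%:C); apply: eq_bigr => e _; rewrite medge_weightE.
Qed.

Lemma fiber_mxE k : fiber_mx V k = fiber_walk_mx (floop_weight V) k.
Proof.
apply/matrixP => i j; rewrite mxE.
rewrite -[LHS]/(fiber_op (floop_weight V) k _ _) fiber_op_walk_mx.
rewrite (bigD1 j) //= eqxx mulr1 big1 ?addr0 // => l lj.
by rewrite (inj_eq enum_val_inj) (negPf lj) mulr0.
Qed.

End Potential.

(** * Fiber formulas, mean formulas and the final theorem *)

Section Assembly.
Variables (R : realType) (d : nat) (G : periodic_graph R d).
Variables (V : vertex G -> R).
Implicit Types (X : set (seq (medge G))) (k : 'rV[R]_d) (z lam : R[i]).
Notation nu := (#|fvertex G|).
Notation len := (@class_length R d G).
Notation P := (@prime_classes R d G).
Notation P0 := (@prime_classes0 R d G).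
Notation w := (floop_weight V).
Notation M k := (fiber_walk_mx w k).
Notation wk k := (twisted_weight V k).

Lemma twisted_weightE k :
  twisted_weight V k = (fun X => cis (- pairing (class_index X) k) * class_loop_weight w X).
Proof. by apply/funext => X; rewrite /twisted_weight class_weightE. Qed.

Lemma normc_class_loop_weight X : normc (class_loop_weight w X) = `|path_weight w (class_repr X)|.
Proof. by rewrite /class_loop_weight normc_real. Qed.

Lemma normc_twisted_weight k X : normc (wk k X) = `|path_weight w (class_repr X)|.
Proof. by rewrite twisted_weightE normcM normc_cis mul1r normc_class_loop_weight. Qed.

Lemma sum_to_uniq (I : choiceType) (D : set I) (f : I -> R[i]) s s' :
  sum_to D f s -> sum_to D f s' -> s = s'.
Proof.
move=> H H'; apply/eqP; rewrite -subr_eq0 -normc_eq0; apply/eqP/le_anti.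
rewrite normc_ge0 andbT; apply/ler_addgt0Pr => e e0; rewrite add0r.
have e2 : 0 < e / 2 by rewrite divr_gt0.
have [F0 D0 HF] := H _ e2; have [F1 D1 HF1] := H' _ e2.
have FD : [set` (F0 `|` F1)%fset] `<=` D.
  by move=> x /=; rewrite inE => /orP[/D0|/D1].
have h := HF _ FD (fsubsetUl _ _); have h' := HF1 _ FD (fsubsetUr _ _).
set S := \sum_(i <- _) f i in h h'.
rewrite (_ : s - s' = (S - s') - (S - s)); last by ring.
by apply: le_trans (le_normcD _ _) _; rewrite normcN; lra.
Qed.

Lemma trig_mean_le (s : seq (R[i] * 'rV[int]_d)) (B : R) :
  (forall k, normc (trig_poly s k) <= B) -> normc (trig_mean s) <= 2 * B.
Proof.
move=> H; apply: le_trans (normc_le_ReIm _) _.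
have h1 : `|complex.Re (trig_mean s)| <= B.
  by apply: torus_mean_bound => k; apply: le_trans (le_Re_normc _) (H k).
suff h2 : `|complex.Im (trig_mean s)| <= B by lra.
pose s' := [seq (- 'i%C * x.1, x.2) | x : R[i] * 'rV[int]_d <- s].
have ImE (z : R[i]) : complex.Im z = complex.Re (- 'i%C * z).
  by case: z => a b /=; ring.
have -> : complex.Im (trig_mean s) = complex.Re (trig_mean s').
  by rewrite ImE /trig_mean big_map mulr_sumr.
apply: torus_mean_bound => k.
have -> : trig_poly s' k = - 'i%C * trig_poly s k.
  by rewrite /trig_poly big_map mulr_sumr; apply: eq_bigr => x _; rewrite mulrA.
by rewrite -ImE; apply: le_trans (le_Im_normc _) (H k).
Qed.

(** With [q = u z^l] and [z = lam^-1], the stated form comes from [- q / (1 - q) = (1 - q^-1)^-1],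
    where [q^-1] is [lam^l] over the weight, times the phase. A class of weight 0 has [q = 0], in
    accordance with the convention. *)
Lemma resolvent_termE lam (phase u : set (seq (medge G)) -> R[i]) X :
  phase X != 0 -> u X = (phase X)^-1 * class_weight V X ->
  normc (u X * lam^-1 ^+ len X) < 1 -> lam != 0 ->
  - ((len X)%:R * (u X * lam^-1 ^+ len X / (1 - u X * lam^-1 ^+ len X)))
    = resolvent_term V lam phase X.
Proof.
move=> ph0 uE q1 lam0; rewrite /resolvent_term; case: eqP => [c0|/eqP c0].
  by rewrite uE c0 mulr0 !mul0r mulr0 oppr0.
rewrite -mulrN; congr (_ * _).
set q := u X * _ in q1 *.
have q0 : q != 0 by rewrite /q uE !mulf_neq0 ?expf_neq0 ?invr_neq0.
have qn1 : 1 - q != 0.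
  by apply: contraTneq q1 => /eqP; rewrite subr_eq0 => /eqP <-; rewrite normc1 ltxx.
have -> : lam ^+ len X / class_weight V X * phase X = q^-1.
  rewrite /q uE exprVn !invfM !invrK.
  by move: (lam ^+ _) (class_weight V X)^-1 (phase X) => *; ring.
have -> : 1 - q^-1 = - ((1 - q) / q) by field.
by rewrite invrN invf_div.
Qed.

Lemma inverse_bound (T : choiceType) (B : (T -> R[i]) -> T -> R[i]) lam :
  (opnorm B < (normc lam)%:E)%E ->
  lam != 0 /\ ((normc lam^-1)%:E * opnorm B < 1)%E.
Proof.
have := opnorm_ge0 B; case: (opnorm B) => [ o | | ] // o0.
rewrite lte_fin lee_fin in o0 * => ol.
have l0 : 0 < normc lam by apply: le_lt_trans ol.
split; first by rewrite -normc_eq0 gt_eqF.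
by rewrite normcV -EFinM lte_fin mulrC ltr_pdivrMr // mul1r.
Qed.

Lemma geo_power_sum D u (T : nat -> R[i]) z :
  (forall n, (0 < n)%N -> class_power_sum len D u n = T n) ->
  geo (fun n => T n * z ^+ n) -> geo (fun n => class_power_sum len D u n * z ^+ n).
Proof.
move=> E g; apply: geo_le g _ => -[|n]; last by rewrite E.
by rewrite class_power_sum0 mul0r normc_zero normc_ge0.
Qed.

Section Fiber.
Variables (k : 'rV[R]_d) (z : R[i]) (K r : R).
Hypotheses (K0 : 0 <= K) (r0 : 0 <= r) (r1 : r < 1).
Hypothesis bound : forall n i j, normc z ^+ n * normc ((M k ^+ n) i j) <= K * r ^+ n.

Lemma twisted_power_sum n : (0 < n)%N -> class_power_sum len P (wk k) n = \tr (M k ^+ n).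
Proof. by move=> n0; rewrite twisted_weightE class_power_sum_twisted. Qed.

Lemma geo_twisted : geo (fun n => class_power_sum len P (wk k) n * z ^+ n).
Proof. exact: (geo_power_sum twisted_power_sum (geo_trace K0 r0 r1 bound)). Qed.

Lemma fiber_resolvent lam : lam != 0 -> z = lam^-1 ->
  exists s, [/\ power_series_to (resolvent_coef P (wk k)) z s,
     cto (psum (fun n => class_power_sum len P (wk k) n * z ^+ n)) (- s) &
     \tr (invmx (M k - lam%:M)) = - (nu%:R / lam) + lam^-1 * s].
Proof.
move=> lam0 zl; apply: (resolvent_series (@subset_refl _ P) geo_twisted lam0 zl _ _
  (trace_resolvent K0 r0 r1 bound lam0 zl)).
  by rewrite expr0 mxtrace1.
by move=> n n0; rewrite twisted_power_sum.
Qed.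

End Fiber.

Section Mean.
Variables (z : R[i]) (K r : R).
Hypotheses (K0 : 0 <= K) (r0 : 0 <= r) (r1 : r < 1).
Hypothesis bound : forall k n i j, normc z ^+ n * normc ((M k ^+ n) i j) <= K * r ^+ n.

Notation w0 := (class_loop_weight w).

(** A mean is controlled by the supremum over [k], here by the uniform trace bound; treating real
    and imaginary parts separately costs the factor 2. *)
Lemma geo_mean : geo (fun n => class_power_sum len P0 w0 n * z ^+ n).
Proof.
apply: (@geo_power_sum _ _ (fun n => trig_mean (trace_trig w n))).
  by move=> n n0; rewrite trig_mean_trace.
exists (2 * (nu%:R * K)), r; split => //; first by rewrite !mulr_ge0.
move=> n; have zn : 0 <= normc z ^+ n by rewrite exprn_ge0 // normc_ge0.
pose s := [seq (z ^+ n * x.1, x.2) | x : R[i] * 'rV[int]_d <- trace_trig w n].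
have -> : trig_mean (trace_trig w n) * z ^+ n = trig_mean s.
  by rewrite /trig_mean big_map mulr_suml; apply: eq_bigr => x _; rewrite mulrC.
rewrite -mulrA; apply: trig_mean_le => k.
have -> : trig_poly s k = trig_poly (trace_trig w n) k * z ^+ n.
  by rewrite /trig_poly big_map mulr_suml; apply: eq_bigr => x _; rewrite /= mulrAC mulrC mulrA mulrAC.
rewrite trig_poly_trace; exact: (trace_bound (bound k)).
Qed.

Lemma mean_resolvent lam : lam != 0 -> z = lam^-1 ->
  exists s, [/\ power_series_to (resolvent_coef P0 w0) z s,
     cto (psum (fun n => class_power_sum len P0 w0 n * z ^+ n)) (- s) &
     ctorus_mean (fun k => \tr (invmx (M k - lam%:M))) = - (nu%:R / lam) + lam^-1 * s].
Proof.
move=> lam0 zl.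
have RS := resolvent_series (T := fun n => trig_mean (trace_trig w n)) (@sub_prime0 _ _ G) geo_mean
  lam0 zl (trig_mean_trace0 w) (trig_mean_trace w).
apply: RS.
(* This scaling makes the sum at each [k] the trace of the resolvent itself, whose mean is
   wanted. *)
pose a n := - lam^-1 * z ^+ n.
have H : cto (psum (fun n => a n * trig_mean (trace_trig w n)))
    (ctorus_mean (fun k => \tr (invmx (M k - lam%:M)))).
  apply: (@mean_series R d (trace_trig w) a _ (normc lam^-1 * (nu%:R * K)) r) => //.
  - by rewrite !mulr_ge0 // normc_ge0.
  - move=> k n; rewrite trig_poly_trace /a -mulrA normcM normcN -[leRHS]mulrA.
    by rewrite ler_wpM2l ?normc_ge0 // mulrC (trace_bound (bound k)).
  - move=> k; have := ctoM (- lam^-1) (trace_resolvent K0 r0 r1 (bound k) lam0 zl).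
    rewrite mulrA mulrNN mulVf // mul1r; apply: eq_cto => N.
    rewrite /psum mulr_sumr; apply: eq_bigr => n _.
    by rewrite trig_poly_trace /a -mulrA [z ^+ n * _]mulrC.
apply: eq_cto (ctoM (- lam) H) => N; rewrite /psum mulr_sumr; apply: eq_bigr => n _.
by rewrite /a !mulrA mulrNN divff // mul1r mulrC.
Qed.

Lemma mean_log : cto (psum (fun n => - (class_power_sum len P0 w0 n * z ^+ n / n%:R)))
  (ctorus_mean (fun k => \tr (mxlog1B (z *: M k)))).
Proof.
pose a n := - (z ^+ n / n%:R).
have H : cto (psum (fun n => a n * trig_mean (trace_trig w n)))
    (ctorus_mean (fun k => \tr (mxlog1B (z *: M k)))).
  apply: (@mean_series R d (trace_trig w) a _ (nu%:R * K) r) => //.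
  - by rewrite mulr_ge0.
  - move=> k n; rewrite trig_poly_trace /a mulNr mulrC normcN mulrA.
    apply: le_trans (trace_bound (bound k) n).
    rewrite normcM normcV normc_natr; case: n => [|n]; first by rewrite invr0 mulr0 normc_ge0.
    by rewrite ler_piMr ?normc_ge0 // invf_le1 ?ltr0n // ler1n.
  - move=> k; apply: eq_cto (trace_log K0 r0 r1 (bound k)) => N.
    apply: eq_bigr => n _.
    by rewrite trig_poly_trace /a mulNr; congr (- _); rewrite [RHS]mulrC mulrA.
apply: eq_cto H => N; apply: eq_bigr => -[|n] _.
  by rewrite /a invr0 !mulr0 oppr0 mul0r.
by rewrite trig_mean_trace // /a mulNr mulrC mulrA.
Qed.

End Mean.
End Assembly.

Theorem corollary3p5 (R : realType) (d : nat) (G : periodic_graph R d)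
    (V : vertex G -> R) (V_periodic : periodic_potential V) :
  let nu := #|fvertex G| in
  let H := fiber_mx V in
  let trR lam k := \tr (invmx (H k - lam%:M)) in
  let trlog t k := \tr (mxlog1B (t *: H k)) in
  let e k X := cis (pairing (class_index X) k) in
  let w := class_weight V in
  let wk k := twisted_weight V k in
  let P := prime_classes (G := G) in
  let P0 := prime_classes0 (G := G) in
  (* (i), trace of the resolvent of H(k) *)
  (forall k lam, (opnorm (fiber V k) < (normc lam)%:E)%E ->
     H k - lam%:M \in unitmx /\
     exists2 s, power_series_to (resolvent_coef P (wk k)) lam^-1 s &
       trR lam k = - (nu%:R / lam) + lam^-1 * s) /\
  (forall k lam, (opnorm (abs_fiber0 V) < (normc lam)%:E)%E ->
     exists2 s, abs_sum_to P (resolvent_term V lam (e k)) s &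
       trR lam k = - (nu%:R / lam) + lam^-1 * s) /\
  (* (i), mean of the trace of the resolvent *)
  (forall lam, (opnorm (schrodinger V) < (normc lam)%:E)%E ->
     (forall k, H k - lam%:M \in unitmx) /\
     exists2 s, power_series_to (resolvent_coef P0 w) lam^-1 s &
       ctorus_mean (trR lam) = - (nu%:R / lam) + lam^-1 * s) /\
  (forall lam, (opnorm (abs_schrodinger V) < (normc lam)%:E)%E ->
     exists2 s, abs_sum_to P0 (resolvent_term V lam (fun=> 1)) s &
       ctorus_mean (trR lam) = - (nu%:R / lam) + lam^-1 * s) /\
  (* (ii), determinant of I - t H(k) *)
  (forall k t, ((normc t)%:E * opnorm (fiber V k) < 1)%E ->
     power_series_to (product_coef P (wk k)) t (\det (1%:M - t *: H k))) /\
  (forall k t, ((normc t)%:E * opnorm (abs_fiber0 V) < 1)%E ->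
     abs_prod1B_to P (fun X => wk k X * t ^+ class_length X)
       (\det (1%:M - t *: H k))) /\
  (* (ii), mean of Tr log (I - t H(k)) *)
  (forall t, ((normc t)%:E * opnorm (schrodinger V) < 1)%E ->
     power_series_to (product_coef P0 w) t (cexp (ctorus_mean (trlog t))) /\
     power_series_to (log_product_coef P0 w) t (ctorus_mean (trlog t))) /\
  (forall t, ((normc t)%:E * opnorm (abs_schrodinger V) < 1)%E ->
     abs_prod1B_to P0 (fun X => w X * t ^+ class_length X)
       (cexp (ctorus_mean (trlog t))) /\
     abs_sum_to P0 (fun X => clog1B (w X * t ^+ class_length X))
       (ctorus_mean (trlog t))).
Proof.
set w := floop_weight V.
pose aw x := `|w x|.
have Lw := loop_weight_vclass V_periodic.
have aLw x : `|loop_weight V x| = aw (vclass x) by rewrite /aw Lw.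
have HE : fiber_mx V = fun k => fiber_walk_mx w k by apply/funext => k; rewrite fiber_mxE.
have cwE := class_weightE V.
have lenE D : D `<=` @prime_classes _ _ G -> _ := @prime_lengths _ _ G D.
move=> nu H trR trlog e w' wk P P0; rewrite /trR /trlog /H HE {H trR trlog}.
have [lgP finP] := lenE P (@subset_refl _ P).
have [lgP0 finP0] := lenE P0 (@sub_prime0 _ _ G).
(* A bound for absolute weights at [k = 0] yields the bound for the actual weights at every [k], so
   the trace identities remain available in the regime of absolute convergence. *)
have dom (z : R[i]) K r : (forall n i j, normc z ^+ n *
    normc ((fiber_walk_mx aw 0 ^+ n) i j) <= K * r ^+ n) ->
  forall k n i j, normc z ^+ n * normc ((fiber_walk_mx w k ^+ n) i j) <= K * r ^+ n.
  move=> h k n i j; apply: le_trans (h n i j).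
  by rewrite ler_wpM2l ?exprn_ge0 ?normc_ge0 // fiber_walk_mx_abs.
have FB k z := @fiber_op_bound R d G w k z.
have AFB z := @fiber_op_bound R d G aw 0 z.
have SB z := @graph_op_bound R d G w (loop_weight V) Lw z.
have ASB z := @graph_op_bound R d G aw (fun x => `|loop_weight V x|) aLw z.
have bP z K r k := abs_class_bound (w := w) (u := wk k) (z := z) (K := K) (r := r)
  (@subset_refl _ P) (normc_twisted_weight V k).
have bP0 z K r := abs_class_bound (w := w) (u := class_loop_weight w) (z := z) (K := K) (r := r)
  (@sub_prime0 _ _ G) (normc_class_loop_weight V).
have nuK (K : R) : 0 <= K -> 0 <= #|fvertex G|%:R * K by move=> ?; rewrite mulr_ge0.
have w'E : w' = class_loop_weight w by exact: cwE.
have cis_neq0 x : cis x != 0 :> R[i].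
  by rewrite -normc_eq0 normc_cis oner_eq0.
have cisV x : cis (- x) = (cis x)^-1 :> R[i].
  apply: (mulfI (cis_neq0 x)); rewrite -cisD subrr divff //.
  exact: cis0.
split.
  move=> k lam /inverse_bound[lam0 /FB[K [r [K0 r0 r1 b]]]]; split.
    exact: (resolvent_unit K0 r0 r1 b lam0 erefl).
  by have [s [s1 _ s3]] := fiber_resolvent K0 r0 r1 b lam0 erefl; exists s.
split.
  move=> k lam /inverse_bound[lam0 /AFB[K [r [K0 r0 r1 b]]]].
  have [s [_ s2 s3]] := fiber_resolvent K0 r0 r1 (dom _ _ _ b k) lam0 erefl.
  (* The terms [|X| q / (1 - q)] add up to [- s]; the opposite terms are those of
     [resolvent_termE]. *)
  exists s => //; rewrite -[s]opprK.
  apply: eq_abs_sum_to (abs_sum_to_opp (class_resolvent_sum lgP finP (nuK K K0) r0 r1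
    (bP _ _ _ k K0 b) s2)) => X PX.
  apply: resolvent_termE => //; first exact: cis_neq0.
    by rewrite /wk /twisted_weight cisV.
  exact: (normc_factor_lt1 lgP finP (nuK K K0) r0 r1 (bP _ _ _ k K0 b) PX).
split.
  move=> lam /inverse_bound[lam0 /SB[K [r [K0 r0 r1 b]]]]; split.
    by move=> k; exact: (resolvent_unit K0 r0 r1 (b k) lam0 erefl).
  by have [s [s1 _ s3]] := mean_resolvent K0 r0 r1 b lam0 erefl; exists s; rewrite ?w'E.
split.
  move=> lam /inverse_bound[lam0 /ASB[K [r [K0 r0 r1 b]]]].
  have [s [_ s2 s3]] := mean_resolvent K0 r0 r1 (dom _ _ _ (b 0)) lam0 erefl.
  exists s => //; rewrite -[s]opprK.
  apply: eq_abs_sum_to (abs_sum_to_opp (class_resolvent_sum lgP0 finP0 (nuK K K0) r0 r1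
    (bP0 _ _ _ K0 (b 0)) s2)) => X PX.
  apply: resolvent_termE => //.
    by rewrite invr1 mul1r cwE.
  exact: (normc_factor_lt1 lgP0 finP0 (nuK K K0) r0 r1 (bP0 _ _ _ K0 (b 0)) PX).
have detE k t : power_series_to (product_coef P (wk k)) t
    (\det (1%:M - t *: fiber_walk_mx w k)).
  by apply: det1B_series; [exact: subset_refl|exact: twisted_power_sum].
split; first by move=> k t _; exact: detE.
split.
  move=> k t /AFB[K [r [K0 r0 r1 b]]].
  have gp := geo_twisted K0 r0 r1 (dom _ _ _ b k).
  (* [s] sums the logarithmic series; the determinant equals [cexp s] because both are sums of the
     same power series in [t]. *)
  have [s hs] := geo_cvg (geo_log gp).
  have [_ [_ hd]] := log_series (@subset_refl _ P) gp hs.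
  have [_ hd'] := detE k t.
  rewrite (sum_to_uniq hd' hd).
  exact: (class_prod1B lgP finP (nuK K K0) r0 r1 (bP _ _ _ k K0 b) hs).
split.
  move=> t /SB[K [r [K0 r0 r1 b]]]; rewrite w'E.
  have [h1 h2] := log_series (@sub_prime0 _ _ G) (geo_mean K0 r0 r1 b) (mean_log K0 r0 r1 b).
  by split.
move=> t /ASB[K [r [K0 r0 r1 b]]]; rewrite w'E.
have ml := mean_log K0 r0 r1 (dom _ _ _ (b 0)).
split.
  exact: (class_prod1B lgP0 finP0 (nuK K K0) r0 r1 (bP0 _ _ _ K0 (b 0)) ml).
exact: (class_log_sum lgP0 finP0 (nuK K K0) r0 r1 (bP0 _ _ _ K0 (b 0)) ml).
Qed.
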